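(* Every homomorphism $\mathfrak{g}\to\mathfrak{h}$ of triangular finite-dimensional real Lie algebras induces a continuous homomorphism $C^\infty_\mathfrak{g}\to C^\infty_\mathfrak{h}$ (extending the induced homomorphism $U(\mathfrak{g})\to U(\mathfrak{h})$ of universal enveloping algebras). The resulting correspondence is a functor from the category of triangular finite-dimensional real Lie algebras to the category of Fréchet--Arens--Michael $\mathbb{R}$-algebras of polynomial growth (with continuous homomorphisms as morphisms).
   Context: Associative algebras have an identity and homomorphisms preserve identities. A finite-dimensional Lie algebra $\mathfrak{g}$ over a field $\mathbb{K}$ is triangular if it is soluble (solvable) and for every $x\in\mathfrak{g}$ all eigenvalues of $\operatorname{ad}x$ lie in $\mathbb{K}$. An Arens--Michael algebra is a complete Hausdorff locally convex algebra whose topology can be determined by a family of submultiplicative seminorms; it is Fréchet--Arens--Michael if its underlying space is also a Fréchet space. An element $b$ of a complex Arens--Michael algebra is of polynomial growth if for every continuous submultiplicative seminorm $\|\cdot\|$ there are $K>0$ and $\alpha\ge 0$ with $\|e^{isb}\|\le K(1+|s|)^\alpha$ for all $s\in\mathbb{R}$. An element of a real Arens--Michael algebra is of polynomial growth if it is so in the complexification. A real Arens--Michael algebra is of polynomial growth if all its elements are. Definition of $C^\infty_\mathfrak{g}$: put $\mathfrak{n}=[\mathfrak{g},\mathfrak{g}]$, fix a linear basis $e_{k+1},\dots,e_m$ of $\mathfrak{n}$ and a complement $e_1,\dots,e_k$ to a linear basis of $\mathfrak{g}$, and let $C^\infty_\mathfrak{g}:=C^\infty(\mathbb{R}^k)\mathbin{\widehat{\otimes}}\mathbb{R}[[e_{k+1},\dots,e_m]]$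 as a Fréchet space, where $C^\infty(\mathbb{R}^k)$ consists of real-valued functions, $\mathbb{R}[[e_{k+1},\dots,e_m]]$ is the space of formal power series in (commuting) variables with the product topology, and $\widehat\otimes$ is the complete projective tensor product. $U(\mathfrak{g})$ is identified with a dense linear subspace by sending the PBW monomial $e_1^{\alpha_1}\cdots e_m^{\alpha_m}$ to $\lambda_1^{\alpha_1}\cdots\lambda_k^{\alpha_k}\otimes e_{k+1}^{\alpha_{k+1}}\cdots e_m^{\alpha_m}$ ($\lambda_j$ the coordinate functions on $\mathbb{R}^k$). The multiplication of $U(\mathfrak{g})$ extends by continuity to a continuous multiplication on $C^\infty_\mathfrak{g}$; the resulting topological algebra does not depend on the choices. *)

(* Defs.v *)
From HB Require Import structures.
Set Warnings "-notation-overridden,-ambiguous-paths,-notation-incompatible-prefix,-redundant-canonical-projection".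
From mathcomp Require Import all_boot all_order all_algebra.
From mathcomp Require Import all_classical all_reals all_analysis.
From mathcomp Require Import complex.

Set Implicit Arguments.
Unset Strict Implicit.
Unset Printing Implicit Defensive.

Import Order.TTheory GRing.Theory Num.Theory.
Import numFieldNormedType.Exports passmx.

Local Open Scope classical_set_scope.
Local Open Scope ring_scope.

Record lieAlg (R : realType) := LieAlg {
  lie_sort :> vectType R;
  lie_br : lie_sort -> lie_sort -> lie_sort;
  lie_brDl : forall a x y z,
    lie_br (a *: x + y) z = a *: lie_br x z + lie_br y z;
  lie_brDr : forall a x y z,
    lie_br z (a *: x + y) = a *: lie_br z x + lie_br z y;
  lie_brxx : forall x, lie_br x x = 0;
  lie_jacobi : forall x y z,
    lie_br x (lie_br y z) + lie_br y (lie_br z x) + lie_br z (lie_br x y) = 0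
}.

Section LieAlgebras.
Variable R : realType.
Implicit Types g h : lieAlg R.

Definition lie_hom g h (f : g -> h) :=
  linear f /\ forall x y, f (lie_br x y) = lie_br (f x) (f y).

(* By bilinearity, the brackets of basis vectors span all brackets. *)
Definition lie_brv g (U V : {vspace g}) : {vspace g} :=
  <<[seq lie_br u v | u <- vbasis U, v <- vbasis V]>>%VS.

Definition derived_alg g : {vspace g} := lie_brv fullv fullv.

Definition soluble g :=
  exists n, iter n (fun U : {vspace g} => lie_brv U U) fullv = 0%VS.

Definition ad_mx g (x : g) : 'M[R]_(\dim {:g}) :=
  mxof (vbasis {:g}) (vbasis {:g}) (linfun (lie_br x)).

(* Eigenvalues are taken in the algebraic closure R[i] of R. *)
Definition triangular g :=
  soluble g /\
  forall (x : g) (z : complex R),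
    eigenvalue (map_mx (real_complex R) (ad_mx x)) z ->
    exists a : R, z = real_complex R a.

End LieAlgebras.

Section Enveloping.
Variable R : realType.

Definition alg_hom (A B : algType R) (f : A -> B) :=
  linear f /\ monoid_morphism f.

Definition lie_alg_hom (g : lieAlg R) (A : algType R) (f : g -> A) :=
  linear f /\ forall x y, f (lie_br x y) = f x * f y - f y * f x.

Record envelope (g : lieAlg R) := Envelope {
  env_sort :> algType R;
  env_inj : g -> env_sort;
  env_lie : lie_alg_hom env_inj;
  env_univ : forall (A : algType R) (f : g -> A), lie_alg_hom f ->
    exists! F : env_sort -> A, alg_hom F /\ forall x, F (env_inj x) = f x
}.

Definition env_map_of (g h : lieAlg R) (f : g -> h)
    (U : envelope g) (V : envelope h) (F : U -> V) :=
  alg_hom F /\ forall x, F (env_inj U x) = env_inj V (f x).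

End Enveloping.

Section LocallyConvex.
Variable R : realType.

(* Completeness for the translation-invariant uniformity; [tvsType] also
   carries a uniform structure, but its axioms only force that structure to
   induce the topology. *)
Definition lc_complete (E : tvsType R) :=
  forall F : set_system E, ProperFilter F ->
    (fun xy : E * E => xy.1 - xy.2) @ filter_prod F F --> (0 : E) ->
    exists x : E, F --> x.

Definition seminorm (E : lmodType R) (p : E -> R) :=
  (forall x y, p (x + y) <= p x + p y) /\
  (forall a x, p (a *: x) = `|a| * p x).

Definition determines_topology (E : tvsType R) (I : choiceType)
    (p : I -> E -> R) :=
  (forall i, seminorm (p i)) /\
  forall U : set E, nbhs (0 : E) U <->
    exists2 s : seq I, True & exists2 eps : R, 0 < eps &
      [set x | forall i, i \in s -> p i x < eps] `<=` U.

Definition frechet (E : tvsType R) :=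
  [/\ hausdorff_space E, lc_complete E &
      exists p : nat -> E -> R, determines_topology p].

(* Complete projective tensor product of [E] and [F], by its universal
   property among complete Hausdorff locally convex spaces. *)
Definition bilinear_map (E F G : lmodType R) (b : E -> F -> G) :=
  (forall y, linear (b^~ y)) /\ (forall x, linear (b x)).

Definition complete_projective_tensor (E F : preTopologicalLmodType R)
    (T : tvsType R) (t : E -> F -> T) :=
  [/\ hausdorff_space T, lc_complete T, bilinear_map t,
      continuous (fun xy : E * F => t xy.1 xy.2) &
      forall (G : tvsType R) (b : E -> F -> G),
        hausdorff_space G -> lc_complete G -> bilinear_map b ->
        continuous (fun xy : E * F => b xy.1 xy.2) ->
        exists! L : T -> G,
          [/\ linear L, continuous L & forall x y, L (t x y) = b x y]].

End LocallyConvex.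

#[short(type="preTopAlgType")]
HB.structure Definition PreTopAlgebra (K : numDomainType) :=
  {A of Topological A & GRing.Algebra K A}.

#[short(type="lcAlgType")]
HB.structure Definition LcAlgebra (K : numDomainType) :=
  {A of Tvs K A & GRing.Algebra K A}.

Section ArensMichael.
Variable R : realType.

Definition submultiplicative (A : algType R) (p : A -> R) :=
  forall x y, p (x * y) <= p x * p y.

Definition arens_michael (A : lcAlgType R) :=
  [/\ hausdorff_space A, lc_complete A &
      exists (I : choiceType) (p : I -> A -> R),
        determines_topology p /\ forall i, submultiplicative (p i)].

Definition frechet_arens_michael (A : lcAlgType R) :=
  arens_michael A /\ frechet A.

End ArensMichael.

Definition complexification (R : realType) (A : lcAlgType R) : Type :=
  (A * A)%type.

Section Complexification.
Variables (R : realType) (A : lcAlgType R).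
Local Notation AC := (complexification A).

HB.instance Definition _ := GRing.Zmodule.copy AC (A * A)%type.
HB.instance Definition _ := Topological.copy AC (A * A)%type.

Definition cplx_one : AC := (1, 0).
Definition cplx_mul (u v : AC) : AC :=
  (u.1 * v.1 - u.2 * v.2, u.1 * v.2 + u.2 * v.1).
Definition cplx_scale (z : complex R) (u : AC) : AC :=
  (complex.Re z *: u.1 - complex.Im z *: u.2,
   complex.Re z *: u.2 + complex.Im z *: u.1).

Fact cplx_mulA : associative cplx_mul.
Proof.
move=> [a b] [c d] [e f]; rewrite /cplx_mul /=; congr pair.
  rewrite !(mulrDl, mulrDr, mulrN, mulNr, mulrA, opprD) !addrA.
  by rewrite [RHS](ACl (1 * 3 * 4 * 2)).
rewrite !(mulrDl, mulrDr, mulrN, mulNr, mulrA, opprD) !addrA.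
by rewrite [RHS](ACl (1 * 3 * 4 * 2)).
Qed.

Fact cplx_mul1l : left_id cplx_one cplx_mul.
Proof. by move=> [a b]; rewrite /cplx_mul /= !mul1r !mul0r subr0 addr0. Qed.

Fact cplx_mul1r : right_id cplx_one cplx_mul.
Proof. by move=> [a b]; rewrite /cplx_mul /= !mulr1 !mulr0 subr0 add0r. Qed.

Fact cplx_mulDl : left_distributive cplx_mul +%R.
Proof.
move=> [a b] [c d] [e f]; rewrite /cplx_mul /=; congr pair => /=.
  by rewrite !mulrDl opprD addrACA.
by rewrite !mulrDl addrACA.
Qed.

Fact cplx_mulDr : right_distributive cplx_mul +%R.
Proof.
move=> [a b] [c d] [e f]; rewrite /cplx_mul /=; congr pair => /=.
  by rewrite !mulrDr opprD addrACA.
by rewrite !mulrDr addrACA.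
Qed.

Fact cplx_one_neq0 : cplx_one != 0.
Proof. by apply/eqP => -[] /eqP; rewrite oner_eq0. Qed.

HB.instance Definition _ := GRing.Zmodule_isNzRing.Build AC
  cplx_mulA cplx_mul1l cplx_mul1r cplx_mulDl cplx_mulDr cplx_one_neq0.

Fact cplx_scaleA x y u :
  cplx_scale x (cplx_scale y u) = cplx_scale (x * y) u.
Proof.
case: x y u => [a b] [c d] [u v]; rewrite /cplx_scale /=; congr pair.
  rewrite !(scalerDl, scalerDr, scalerN, scaleNr, scalerA, opprD) !addrA.
  by rewrite [RHS](ACl (1 * 3 * 4 * 2)).
rewrite !(scalerDl, scalerDr, scalerN, scaleNr, scalerA, opprD) !addrA.
by rewrite [RHS](ACl (1 * 3 * 4 * 2)).
Qed.

Fact cplx_scale1 : left_id 1 cplx_scale.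
Proof. by move=> [a b]; rewrite /cplx_scale /= !scale1r !scale0r subr0 addr0. Qed.

Fact cplx_scaleDr : right_distributive cplx_scale +%R.
Proof.
move=> [a b] [u v] [u' v']; rewrite /cplx_scale /=; congr pair => /=.
  by rewrite !scalerDr opprD addrACA.
by rewrite !scalerDr addrACA.
Qed.

Fact cplx_scaleDl u : {morph cplx_scale^~ u : a b / a + b}.
Proof.
case: u => [u v] [a b] [c d]; rewrite /cplx_scale /=; congr pair => /=.
  by rewrite !scalerDl opprD addrACA.
by rewrite !scalerDl addrACA.
Qed.

HB.instance Definition _ := GRing.Zmodule_isLmodule.Build (complex R) AC
  cplx_scaleA cplx_scale1 cplx_scaleDr cplx_scaleDl.

Fact cplx_scaleAl (z : complex R) (u v : AC) : z *: (u * v) = (z *: u) * v.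
Proof.
case: z u v => [a b] [c d] [e f]; congr pair => /=;
  rewrite !(mulrDl, mulNr, mulrN, scalerDr, scalerN, =^~ scalerAl, opprD);
  by rewrite !addrA [RHS](ACl (1 * 3 * 4 * 2)).
Qed.

HB.instance Definition _ :=
  GRing.Lmodule_isLalgebra.Build (complex R) AC cplx_scaleAl.

Fact cplx_scaleAr (z : complex R) (u v : AC) : z *: (u * v) = u * (z *: v).
Proof.
case: z u v => [a b] [c d] [e f]; congr pair => /=;
  rewrite !(mulrDr, mulNr, mulrN, scalerDr, scalerN, =^~ scalerAr, opprD);
  by rewrite !addrA [RHS](ACl (1 * 3 * 2 * 4)).
Qed.

HB.instance Definition _ :=
  GRing.Lalgebra_isAlgebra.Build (complex R) AC cplx_scaleAr.

Definition cplx_inj (a : A) : AC := (a, 0).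

End Complexification.

(* [e^z] as the sum of the exponential series; the series converges in every
   complete Arens--Michael algebra. *)
Definition alg_exp (K : numFieldType) (B : preTopAlgType K) (z : B) : B :=
  xget 0 [set w | series (fun n => (n`!%:R : K)^-1 *: z ^+ n) @ \oo --> w].

Section PolynomialGrowth.
Variable R : realType.

Definition cplx_submult_seminorm (B : preTopAlgType (complex R))
    (p : B -> R) :=
  [/\ forall x y, p (x + y) <= p x + p y,
      forall (a : complex R) x, p (a *: x) = ComplexField.Normc.normc a * p x &
      forall x y, p (x * y) <= p x * p y].

Definition polynomial_growth_elt (B : preTopAlgType (complex R)) (b : B) :=
  forall p : B -> R, cplx_submult_seminorm p -> continuous p ->
    exists K alpha : R, [/\ 0 < K, 0 <= alpha &
      forall s : R,
        p (alg_exp (Complex 0 s *: b)) <= K * (1 + `|s|) `^ alpha].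

Definition polynomial_growth (A : lcAlgType R) :=
  forall b : A, polynomial_growth_elt (cplx_inj b).

End PolynomialGrowth.

Section Smooth.
Variables (R : realType) (k : nat).
Local Notation V := 'rV[R]_k.

Definition iter_partial (s : seq 'I_k) (f : V -> R^o) : V -> R^o :=
  foldr (fun i g x => 'D_(delta_mx 0 i) g x) f s.

Definition is_smooth (f : V -> R^o) := forall s : seq 'I_k,
  continuous (iter_partial s f) /\
  forall (i : 'I_k) (x : V), derivable (iter_partial s f) x (delta_mx 0 i).

Definition smooth_pred : {pred V -> R^o} := fun f => `[< is_smooth f >].

Lemma smooth_predP f : f \in smooth_pred <-> is_smooth f.
Proof. by split=> [/asboolP|?]; last exact/asboolP. Qed.

Lemma iter_partial_linear s a f g : is_smooth f -> is_smooth g ->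
  iter_partial s (a *: f + g) = a *: iter_partial s f + iter_partial s g.
Proof.
move=> sf sg; elim: s => [//|i s IHs] /=; rewrite {}IHs; apply/funext => x.
have [_ df] := sf s; have [_ dg] := sg s.
rewrite deriveD; [|exact: derivableZ|exact: dg].
by rewrite deriveZ.
Qed.

Lemma smooth_submod : submod_closed smooth_pred.
Proof.
have s0 : is_smooth 0.
  suff e s : iter_partial s 0 = 0.
    move=> s; rewrite e; split=> [|i x]; first exact: cst_continuous.
    exact: derivable_cst.
  elim: s => [//|i s IHs] /=; rewrite IHs; apply/funext => x.
  exact: derive_cst.
split; first exact/smooth_predP.
move=> a f g /smooth_predP sf /smooth_predP sg; apply/smooth_predP => s.
rewrite iter_partial_linear //; have [cf df] := sf s; have [cg dg] := sg s.
split=> [x|i x].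
  by apply: (@cvgD _ _ _ (nbhs x)); [exact: cvgZl_tmp (cf x)|exact: cg].
by apply: derivableD; [exact: derivableZ|exact: dg].
Qed.

HB.instance Definition _ := GRing.isSubmodClosed.Build _ _ smooth_pred
  smooth_submod.

Record smooth := Smooth { smooth_fun :> V -> R^o; _ : smooth_fun \in smooth_pred }.

HB.instance Definition _ := [isSub for smooth_fun].
HB.instance Definition _ := [Choice of smooth by <:].
HB.instance Definition _ := [SubChoice_isSubLmodule of smooth by <:].


(* Uniform convergence of all partial derivatives on compact sets. *)
Definition jet (f : smooth) :
  prod_topology (fun _ : seq 'I_k => {family compact, V -> R^o}) :=
  fun s => iter_partial s f.

HB.instance Definition _ := Topological.copy smooth (initial_topology jet).

Inductive polyfun : (V -> R^o) -> Prop :=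
| polyfun_cst c : polyfun (cst c)
| polyfun_coord i : polyfun (fun x => x 0 i)
| polyfun_add f g : polyfun f -> polyfun g -> polyfun (f \+ g)
| polyfun_mul f g : polyfun f -> polyfun g -> polyfun (f \* g).

Lemma polyfun_diff f : polyfun f -> continuous f /\ forall i,
  (forall x, derivable f x (delta_mx 0 i)) /\
  polyfun (fun x => 'D_(delta_mx 0 i) f x).
Proof.
elim=> [c|j|{}f g pf [cf IHf] pg [cg IHg]|{}f g pf [cf IHf] pg [cg IHg]].
- split; first exact: cst_continuous.
  move=> i; split=> [x|]; first exact: derivable_cst.
  rewrite (_ : (fun x => _) = cst 0); first exact: polyfun_cst.
  by apply/funext => x; exact: derive_cst.
- split; first exact: coord_continuous.
  move=> i.
  have dj x : is_derive x (delta_mx 0 i) (fun x : V => x 0 j : R^o)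
     ((delta_mx 0 i : V) 0 j).
    have e (h : R) : h != 0 ->
        h^-1 *: (((fun x : V => x 0 j : R^o) \o shift x) (h *: delta_mx 0 i) - x 0 j)
        = (delta_mx 0 i : V) 0 j.
      by move=> h0; rewrite /= !mxE addrK [LHS]mulrA mulVf ?mul1r.
    have c : (fun h : R => h^-1 *: (((fun x : V => x 0 j : R^o) \o shift x)
        (h *: delta_mx 0 i) - x 0 j)) @ 0^' --> ((delta_mx 0 i : V) 0 j : R^o).
      apply: cvg_near_cst; near=> h; apply/e.
      by near: h; exact: nbhs_dnbhs_neq.
    by split; [exact: cvgP c|exact: cvg_lim c].
  split=> [x|]; first by case: (dj x).
  rewrite (_ : (fun x => _) = cst ((delta_mx 0 i : V) 0 j)); first exact: polyfun_cst.
  by apply/funext => x; exact: derive_val.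
- split; first by move=> x; exact: continuousD (cf x) (cg x).
  move=> i; have [df qf] := IHf i; have [dg qg] := IHg i.
  split=> [x|]; first exact: derivableD.
  rewrite (_ : (fun x => _) = (fun x => 'D_(delta_mx 0 i) f x) \+
                              (fun x => 'D_(delta_mx 0 i) g x)).
    exact: polyfun_add.
  by apply/funext => x; rewrite deriveD.
- split; first by move=> x; exact: continuousM (cf x) (cg x).
  move=> i; have [df qf] := IHf i; have [dg qg] := IHg i.
  split=> [x|]; first exact: derivableM.
  rewrite (_ : (fun x => _) = (f \* (fun x => 'D_(delta_mx 0 i) g x)) \+
                              (g \* (fun x => 'D_(delta_mx 0 i) f x))).
    by apply: polyfun_add; exact: polyfun_mul.
  by apply/funext => x; rewrite deriveM.
Unshelve. all: by end_near. Qed.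

Lemma polyfun_smooth f : polyfun f -> f \in smooth_pred.
Proof.
move=> pf; apply/smooth_predP => s.
have {pf} : polyfun (iter_partial s f).
  by elim: s => [//|i s /polyfun_diff[_ /(_ i)[]]].
by move=> /polyfun_diff[cf df]; split=> // i x; case: (df i).
Qed.

Lemma monomial_polyfun (al : {ffun 'I_k -> nat}) :
  polyfun (fun x => \prod_(i < k) x 0 i ^+ al i).
Proof.
have pX i n : polyfun (fun x => x 0 i ^+ n).
  elim: n => [|n IHn]; first exact: polyfun_cst.
  rewrite (_ : (fun x => _) = (fun x : V => x 0 i : R^o) \* (fun x => x 0 i ^+ n)).
    exact: polyfun_mul (polyfun_coord i) IHn.
  by apply/funext => x; rewrite exprS.
elim: (index_enum _) => [|i s IHs].
  rewrite (_ : (fun x => _) = cst 1); first exact: polyfun_cst.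
  by apply/funext => x; rewrite big_nil.
rewrite (_ : (fun x => _) = (fun x : V => x 0 i ^+ al i : R^o) \*
                            (fun x => \prod_(i <- s) x 0 i ^+ al i)).
  exact: polyfun_mul.
by apply/funext => x; rewrite big_cons.
Qed.

Definition monomial_fun (al : {ffun 'I_k -> nat}) : smooth :=
  Smooth (polyfun_smooth (monomial_polyfun al)).

End Smooth.

Section FormalPowerSeries.
Variables (R : realType) (l : nat).

(* A power series is the family of its coefficients, indexed by exponents,
   with the product topology. *)
Definition fps : Type := {ffun 'I_l -> nat} -> R^o.

HB.instance Definition _ := GRing.Lmodule.copy fps ({ffun 'I_l -> nat} -> R^o).
HB.instance Definition _ :=
  Topological.copy fps {ptws {ffun 'I_l -> nat} -> R^o}.

Definition monomial_fps (be : {ffun 'I_l -> nat}) : fps :=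
  fun ga => (ga == be)%:R.

End FormalPowerSeries.

Section CInf.
Variable R : realType.

(* A realization of [C^oo_g]. [cinf_e] spans a complement of [g, g], of which
   [cinf_n] is a basis; the enveloping algebra and the complete tensor product
   are given by their universal properties. The multiplication of [cinf_sort]
   is the continuous extension of that of the enveloping algebra, embedded by
   the PBW basis; density makes it unique. *)
Record cinf (g : lieAlg R) := Cinf {
  cinf_sort :> lcAlgType R;
  cinf_k : nat;
  cinf_l : nat;
  cinf_e : cinf_k.-tuple g;
  cinf_n : cinf_l.-tuple g;
  cinf_n_basis : basis_of (derived_alg g) cinf_n;
  cinf_basis : basis_of fullv (cinf_e ++ cinf_n);
  cinf_tens : smooth R cinf_k -> fps R cinf_l -> cinf_sort;
  cinf_tensP : complete_projective_tensor cinf_tens;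
  cinf_env : envelope g;
  cinf_inc : cinf_env -> cinf_sort;
  cinf_inc_pbw : forall (al : {ffun 'I_cinf_k -> nat})
                        (be : {ffun 'I_cinf_l -> nat}),
    cinf_inc ((\prod_(i < cinf_k) env_inj cinf_env (tnth cinf_e i) ^+ al i) *
              (\prod_(j < cinf_l) env_inj cinf_env (tnth cinf_n j) ^+ be j))
    = cinf_tens (monomial_fun R al) (monomial_fps R be);
  cinf_inc_hom : alg_hom cinf_inc;
  cinf_inc_inj : injective cinf_inc;
  cinf_inc_dense : dense (range cinf_inc);
  cinf_mul_continuous :
    continuous (fun xy : cinf_sort * cinf_sort => xy.1 * xy.2)
}.

Definition cinf_extends (g h : lieAlg R) (f : g -> h) (A : cinf g) (B : cinf h)
    (phi : A -> B) :=
  exists2 Uf : cinf_env A -> cinf_env B, env_map_of f Uf &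
    forall u, phi (cinf_inc u) = cinf_inc (Uf u).

End CInf.
Arguments cinf_extends {R g h} f A B phi.

Record category := Category {
  cat_ob :> Type;
  cat_hom : cat_ob -> cat_ob -> Type;
  cat_id : forall x, cat_hom x x;
  cat_comp : forall x y z, cat_hom y z -> cat_hom x y -> cat_hom x z;
  cat_comp1f : forall x y (f : cat_hom x y), cat_comp (cat_id y) f = f;
  cat_compf1 : forall x y (f : cat_hom x y), cat_comp f (cat_id x) = f;
  cat_compA : forall x y z t
      (f : cat_hom z t) (g : cat_hom y z) (h : cat_hom x y),
    cat_comp f (cat_comp g h) = cat_comp (cat_comp f g) h
}.

Record functor_on (C D : category) (obj : C -> D) := FunctorOn {
  functor_map : forall x y : C, cat_hom x y -> cat_hom (obj x) (obj y);
  functor_map_id : forall x, functor_map (cat_id x) = cat_id (obj x);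
  functor_map_comp : forall (x y z : C) (f : cat_hom y z) (g : cat_hom x y),
    functor_map (cat_comp f g) = cat_comp (functor_map f) (functor_map g)
}.
Arguments functor_map {C D obj} _ {x y} _.

Lemma sval_inj (T : Type) (P : T -> Prop) : injective (@sval T P).
Proof. by move=> [x p] [y q] /= e; exact: eq_exist. Qed.

Section TriangularLieAlgebras.
Variable R : realType.

Lemma lie_hom_id (g : lieAlg R) : lie_hom (fun x : g => x).
Proof. by []. Qed.

Lemma lie_hom_comp (g h k : lieAlg R) (f : h -> k) (f' : g -> h) :
  lie_hom f -> lie_hom f' -> lie_hom (fun x => f (f' x)).
Proof.
move=> [lf bf] [lf' bf']; split=> [a x y|x y]; first by rewrite lf' lf.
by rewrite bf' bf.
Qed.

Definition tri_ob : Type := {g : lieAlg R | triangular g}.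

Definition tri_hom (g h : tri_ob) : Type :=
  {f : sval g -> sval h | lie_hom f}.

Definition tri_id (g : tri_ob) : tri_hom g g :=
  exist _ _ (@lie_hom_id (sval g)).

Definition tri_comp (g h k : tri_ob) (f : tri_hom h k) (f' : tri_hom g h) :
    tri_hom g k :=
  exist _ _ (lie_hom_comp (svalP f) (svalP f')).

Definition tri_lie : category.
Proof.
by apply: (@Category tri_ob tri_hom tri_id tri_comp);
  move=> *; apply: sval_inj.
Defined.

End TriangularLieAlgebras.

Section FrechetArensMichaelAlgebras.
Variable R : realType.

Definition cont_alg_hom (A B : lcAlgType R) (f : A -> B) :=
  alg_hom f /\ continuous f.

Lemma cont_alg_hom_id (A : lcAlgType R) : cont_alg_hom (fun x : A => x).
Proof. by split=> // x; exact: cvg_id. Qed.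

Lemma cont_alg_hom_comp (A B C : lcAlgType R) (f : B -> C) (f' : A -> B) :
  cont_alg_hom f -> cont_alg_hom f' -> cont_alg_hom (fun x => f (f' x)).
Proof.
move=> [[lf [f1 fM]] cf] [[lf' [f'1 f'M]] cf']; split; [split; [|split]|].
- by move=> a x y; rewrite lf' lf.
- by rewrite f'1 f1.
- by move=> x y; rewrite f'M fM.
- by move=> x; apply: (@continuous_comp _ _ _ f' f); [exact: cf'|exact: cf].
Qed.

Definition is_fam_pg (A : lcAlgType R) :=
  frechet_arens_michael A /\ polynomial_growth A.

Definition fam_pg_ob : Type := {A : lcAlgType R | is_fam_pg A}.

Definition fam_pg_hom (A B : fam_pg_ob) : Type :=
  {f : sval A -> sval B | cont_alg_hom f}.

Definition fam_pg_id (A : fam_pg_ob) : fam_pg_hom A A :=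
  exist _ _ (@cont_alg_hom_id (sval A)).

Definition fam_pg_comp (A B C : fam_pg_ob) (f : fam_pg_hom B C)
    (f' : fam_pg_hom A B) : fam_pg_hom A C :=
  exist _ _ (cont_alg_hom_comp (svalP f) (svalP f')).

Definition fam_pg : category.
Proof.
by apply: (@Category fam_pg_ob fam_pg_hom fam_pg_id fam_pg_comp);
  move=> *; apply: sval_inj.
Defined.

Definition cinf_ob (C : forall g : tri_lie R, cinf (sval g))
    (HC : forall g, is_fam_pg (C g)) (g : tri_lie R) : fam_pg :=
  exist _ (C g : lcAlgType R) (HC g).

End FrechetArensMichaelAlgebras.

(* Main.v *)
Require Import Defs.
From HB Require Import structures.
From mathcomp Require Import all_boot all_order all_algebra.
From mathcomp Require Import all_classical all_reals all_analysis.
From mathcomp Require Import complex.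
From mathcomp Require Import ring lra zify.

Set Implicit Arguments.
Unset Strict Implicit.
Unset Printing Implicit Defensive.

Import Order.TTheory GRing.Theory Num.Theory.
Import numFieldNormedType.Exports passmx.

Local Open Scope classical_set_scope.
Local Open Scope ring_scope.

(** The derived algebra [n] of a triangular [g] is nilpotent by Lie's theorem, and
    [U(g)] is commutative modulo the ideal generated by [n], where it is evaluated
    by characters [chi x].  A continuous seminorm [q] annihilates all long products
    of elements of the intersection [I] of their kernels, because by continuity of
    the multiplication it annihilates the ideal generated by high powers of the
    basis of [n].  Hence a quantity defined by a multiplicative recursion can be
    compared with its image under a linear section of the characters: the
    errors lie in [I], and telescoping terminates after finitely many steps.
    Applied to products this gives submultiplicative seminorms; applied to the
    Chebyshev polynomials [T_n] it gives [q(T_n(b)) <= C (n+1)^a] for small [b], so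
    that expanding [p] in Chebyshev polynomials bounds [q(p(b))] by finitely many
    derivatives of [p].  For the Taylor polynomials of [exp(i s x)] this is polynomial
    growth; used in one variable after another it shows that [U(g) -> U(h)] is
    continuous, so that it extends to the completion, uniquely by density. *)

(** * Lie's theorem and nilpotency of the derived algebra *)

(** The enveloping algebra and the tensor product are known only through universal properties.
    Seminorms with a concrete meaning are therefore obtained by mapping the tensor product to
    bounded functions, and the injectivity of [cinf_inc] stands in for the linear independence of
    ordered monomials, so that only spanning is proved. The obstacle is that the section of the
    characters is linear but not multiplicative. Each comparison lasts at most [N] rounds, and a
    round sums over at most as many positions as there are factors; the loss is a power of that
    number. For products this is absorbed by a constant per factor, for Chebyshev polynomials by one
    more derivative or two. Chebyshev polynomials take the place of the functions [exp(i n x)]: they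
    can be evaluated at any element without a convergence question, they satisfy a linear recursion,
    and their derivatives on [[-1, 1]] grow only polynomially in [n]. Coefficients are allowed in
    the algebra itself, on the left of the variable; this is what lets the one-variable estimate be
    repeated for noncommuting elements. *)

Section LieBracket.
Variables (R : realType) (g : lieAlg R).
Implicit Types (x y z v w : g) (a : R).
Local Notation "{[ x , y ]}" := (lie_br x y) (at level 0).

Lemma br0l z : {[0, z]} = 0.
Proof.
by have := lie_brDl 1 0 0 z; rewrite !scale1r addr0 => /eqP; rewrite -subr_eq subrr => /eqP <-.
Qed.

Lemma br0r z : {[z, 0]} = 0.
Proof.
by have := lie_brDr 1 0 0 z; rewrite !scale1r addr0 => /eqP; rewrite -subr_eq subrr => /eqP <-.
Qed.

Lemma brDl x y z : {[x + y, z]} = {[x, z]} + {[y, z]}.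
Proof. by rewrite -[x]scale1r lie_brDl !scale1r. Qed.

Lemma brDr x y z : {[z, x + y]} = {[z, x]} + {[z, y]}.
Proof. by rewrite -[x]scale1r lie_brDr !scale1r. Qed.

Lemma brZl a x z : {[a *: x, z]} = a *: {[x, z]}.
Proof. by rewrite -[a *: x]addr0 lie_brDl br0l addr0. Qed.

Lemma brZr a x z : {[z, a *: x]} = a *: {[z, x]}.
Proof. by rewrite -[a *: x]addr0 lie_brDr br0r addr0. Qed.

Lemma brNl x z : {[- x, z]} = - {[x, z]}.
Proof. by rewrite -scaleN1r brZl scaleN1r. Qed.

Lemma brNr x z : {[z, - x]} = - {[z, x]}.
Proof. by rewrite -scaleN1r brZr scaleN1r. Qed.

Lemma brBr x y z : {[z, x - y]} = {[z, x]} - {[z, y]}.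
Proof. by rewrite brDr brNr. Qed.

Lemma br_anti x y : {[x, y]} = - {[y, x]}.
Proof.
have := lie_brxx (x + y); rewrite brDl !brDr !lie_brxx addr0 add0r => /eqP.
by rewrite addr_eq0 => /eqP.
Qed.

Lemma br_deriv x y z : {[x, {[y, z]}]} = {[y, {[x, z]}]} + {[{[x, y]}, z]}.
Proof.
have /eqP := lie_jacobi x y z; rewrite -addrA addr_eq0 => /eqP ->.
by rewrite opprD -brNr -br_anti -br_anti.
Qed.

Lemma lie_br_linear x : linear (lie_br x).
Proof. by move=> a y z; rewrite lie_brDr. Qed.

HB.instance Definition _ x :=
  GRing.isLinear.Build R g g _ (lie_br x) (lie_br_linear x).

Lemma mem_span_lin (E F : vectType R) (f : E -> F) (X : seq E) (W : {vspace F}) :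
  linear f -> (forall u, u \in X -> f u \in W) ->
  forall u, u \in <<X>>%VS -> f u \in W.
Proof.
move=> lf XW u uX.
pose f' : {linear E -> F} := HB.pack f (GRing.isLinear.Build R E F _ f lf).
have : (<<X>> <= linfun f' @^-1: W)%VS.
  apply/span_subvP => y /XW yW; rewrite -memv_preim lfunE; exact: yW.
by move/subvP => /(_ _ uX); rewrite -memv_preim lfunE.
Qed.

Lemma mem_brv (U V : {vspace g}) x y : x \in U -> y \in V ->
  {[x, y]} \in lie_brv U V.
Proof.
move=> xU yV.
have xX : x \in <<vbasis U>>%VS by rewrite (span_basis (vbasisP U)).
have yX : y \in <<vbasis V>>%VS by rewrite (span_basis (vbasisP V)).
apply: (mem_span_lin (f := fun x => {[x, y]})) xX; first by move=> a u v /=; rewrite lie_brDl.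
move=> u uU; apply: (mem_span_lin (f := lie_br u)) yX; first exact: lie_br_linear.
by move=> v vV; apply: memv_span; apply: allpairs_f.
Qed.

Lemma brv_sub (U V W : {vspace g}) :
  (forall x y, x \in U -> y \in V -> {[x, y]} \in W) -> (lie_brv U V <= W)%VS.
Proof.
move=> UVW; apply/span_subvP => _ /allpairsP[[u v] /= [uU vV ->]].
by apply: UVW; exact: vbasis_mem.
Qed.

Lemma mem_derived x y : {[x, y]} \in derived_alg g.
Proof. by apply: mem_brv; exact: memvf. Qed.

End LieBracket.

Section SplitOperators.
Variable R : realType.

(** All roots in [R[i]] of the characteristic polynomial are real, so it splits over [R], and
    Cayley-Hamilton becomes the vanishing of a composition of operators [A - a]. This factored form
    yields eigenvectors in subquotients. *)
Lemma real_spectrum_split n (A : 'M[R]_n) :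
  (forall z : complex R, eigenvalue (map_mx (real_complex R) A) z ->
    exists a : R, z = real_complex R a) ->
  exists2 s : seq R, size s = n &
    forall v : 'rV_n, foldr (fun a v => v *m A - a *: v) v s = 0.
Proof.
case: n A => [|n] A Areal.
  by exists [::] => // v; apply/matrixP => i [].
have [r pr] := closed_field_poly_normal (char_poly (map_mx (real_complex R) A)).
have rreal (z : complex R) : z \in r -> exists a : R, z = real_complex R a.
  move=> zr; apply: Areal; rewrite eigenvalue_root_char pr rootZ ?root_prod_XsubC //.
  by rewrite lead_coef_eq0 -size_poly_eq0 size_char_poly.
have /monicP mon := char_poly_monic (map_mx (real_complex R) A).
rewrite mon scale1r in pr.
have [s rs] : exists s, r = map (real_complex R) s.
  elim: r rreal {pr} => [|z r IHr] rreal; first by exists [::].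
  have [a za] := rreal z (mem_head _ _).
  have [s ->] := IHr (fun y yr => rreal y (@mem_behead _ (z :: r) y yr)).
  by exists (a :: s); rewrite za.
have ps : char_poly A = \prod_(a <- s) ('X - a%:P).
  apply: (map_poly_inj (real_complex R)).
  rewrite map_char_poly pr rs big_map rmorph_prod; apply: eq_bigr => a _.
  by rewrite rmorphB /= map_polyX map_polyC.
exists s.
  by have := size_char_poly A; rewrite ps size_prod_XsubC => -[].
move=> v.
suff -> : foldr (fun a v => v *m A - a *: v) v s = v *m horner_mx A (char_poly A).
  by rewrite Cayley_Hamilton mulmx0.
rewrite ps; elim: s {rs ps} => [|a s IHs] /=.
  by rewrite big_nil rmorph1 mulmx1.
rewrite big_cons mulrC rmorphM /= IHs mulmxA.
rewrite [X in _ = _ *m X]rmorphB /= horner_mx_X horner_mx_C mulmxBr.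
by rewrite mul_mx_scalar.
Qed.

Lemma ad_split (g : lieAlg R) (x : g) : triangular g ->
  exists2 s : seq R, size s = \dim {:g} &
    forall v : g, foldr (fun a v => lie_br x v - a *: v) v s = 0.
Proof.
move=> [_ /(_ x)/real_spectrum_split[s ss sv]]; exists s => // v.
have inj : injective (rVof (vbasis {:g})).
  by apply: (can_inj (g := vecof (vbasis {:g}))) => u; apply: rVofK; exact: vbasisP.
apply: inj; rewrite linear0 -[RHS](sv (rVof (vbasis {:g}) v)).
elim: s {ss sv} => [//|a s IHs] /=.
rewrite linearB linearZ /= IHs; congr (_ - _).
rewrite -IHs /ad_mx -rVof_app ?lfunE //; exact: vbasisP.
Qed.

End SplitOperators.

Section LieTheorem.
Variables (R : realType) (g : lieAlg R).
Hypothesis tri_g : triangular g.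
Implicit Types (x y z v w : g) (a : R) (L M W : g -> Prop).
Local Notation "{[ x , y ]}" := (lie_br x y) (at level 0).

(** Predicates instead of [{vspace g}], since weight spaces and Krylov spaces are given by
    conditions rather than by spanning families. *)
Definition subspace_pred W := W 0 /\ forall a x y, W x -> W y -> W (a *: x + y).

Lemma sub_predD W x y : subspace_pred W -> W x -> W y -> W (x + y).
Proof. by move=> [_ h] Wx Wy; rewrite -[x]scale1r; exact: h. Qed.

Lemma sub_predZ W a x : subspace_pred W -> W x -> W (a *: x).
Proof. by move=> [h0 h] Wx; rewrite -[_ *: _]addr0; exact: h. Qed.

Lemma sub_predB W x y : subspace_pred W -> W x -> W y -> W (x - y).
Proof. by move=> sW Wx Wy; apply: sub_predD => //; rewrite -scaleN1r; exact: sub_predZ. Qed.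

Definition weight_vector L W1 W2 := exists2 v, W2 v /\ ~ W1 v &
  forall x, L x -> exists a, W1 ({[x, v]} - a *: v).

(** Lie's theorem for [L]: a common eigenvector in every nonzero stable subquotient [W2 / W1] of the
    adjoint module. The subquotients carry the induction on [L] and later the construction of a
    flag. *)
Definition lie_pred L := forall W1 W2, subspace_pred W1 -> subspace_pred W2 ->
  (forall x, W1 x -> W2 x) -> (exists2 x, W2 x & ~ W1 x) ->
  (forall x y, L x -> W1 y -> W1 {[x, y]}) ->
  (forall x y, L x -> W2 y -> W2 {[x, y]}) -> weight_vector L W1 W2.

(** The full composition of the [ad z - a] takes [x0] into [W1]; the last partial composition still
    outside [W1] is an eigenvector modulo [W1]. *)
Lemma eigenvector_mod z W1 W2 : subspace_pred W1 -> subspace_pred W2 ->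
  (exists2 x, W2 x & ~ W1 x) -> (forall x, W2 x -> W2 {[z, x]}) ->
  exists2 v, W2 v /\ ~ W1 v & exists a, W1 ({[z, v]} - a *: v).
Proof.
move=> s1 s2 [x0 x2 x1] zW2; have [s _ sv] := ad_split z tri_g.
have {}sv : W1 (foldr (fun a v => {[z, v]} - a *: v) x0 s) by rewrite sv; case: s1.
elim: s sv => [//|a s IHs] /= sv.
have [/IHs //|n1] := pselect (W1 (foldr (fun a v => {[z, v]} - a *: v) x0 s)).
exists (foldr (fun a v => {[z, v]} - a *: v) x0 s); last by exists a.
split=> //; elim: s {IHs sv n1} => [//|b s IHs] /=.
by apply: sub_predB => //; [exact: zW2|exact: sub_predZ].
Qed.

Fixpoint krylov z w W (p : nat) : g -> Prop :=
  if p is q.+1 then fun y => exists a, krylov z w W q (y - a *: iter q (lie_br z) w)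
  else W.

Lemma krylov_sub z w W p : subspace_pred W -> subspace_pred (krylov z w W p).
Proof.
move=> sW; elim: p => [//|p IHp] /=; split.
  by exists 0; rewrite scale0r subr0; case: IHp.
move=> a x y [b bx] [c cy]; exists (a * b + c).
rewrite (_ : _ - _ = a *: (x - b *: iter p (lie_br z) w) + (y - c *: iter p (lie_br z) w)).
  by case: IHp => _; exact.
by rewrite scalerBr scalerA scalerDl opprD addrACA.
Qed.

Lemma krylov_le z w W p x : krylov z w W p x -> krylov z w W p.+1 x.
Proof. by move=> h; exists 0; rewrite scale0r subr0. Qed.

Lemma krylov_iter z w W p : subspace_pred W ->
  krylov z w W p.+1 (iter p (lie_br z) w).
Proof. by move=> sW; exists 1; rewrite scale1r subrr; case: (krylov_sub z w p sW). Qed.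

Lemma krylov_br z w W p x : subspace_pred W -> (forall x, W x -> W {[z, x]}) ->
  krylov z w W p x -> krylov z w W p.+1 {[z, x]}.
Proof.
move=> sW zW; elim: p x => [|p IHp] x.
  by move=> /zW h; exact: krylov_le.
move=> [a /IHp]; rewrite brBr brZr => -[b h]; by exists a; exists b.
Qed.

(** The vanishing composition of the [ad z - a] is monic in [ad z], so it expresses the iterate of
    order [size s] by lower ones. *)
Lemma krylov_stabilizes z w W : subspace_pred W -> (forall x, W x -> W {[z, x]}) ->
  exists p, krylov z w W p (iter p (lie_br z) w).
Proof.
move=> sW zW; have [s _ sv] := ad_split z tri_g.
have h t : krylov z w W (size t)
    (foldr (fun a v => {[z, v]} - a *: v) w t - iter (size t) (lie_br z) w) /\
  krylov z w W (size t).+1 (foldr (fun a v => {[z, v]} - a *: v) w t).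
  have h2 t' : krylov z w W (size t')
      (foldr (fun a v => {[z, v]} - a *: v) w t' - iter (size t') (lie_br z) w) ->
      krylov z w W (size t').+1 (foldr (fun a v => {[z, v]} - a *: v) w t').
    by move=> h1; exists 1; rewrite scale1r.
  suff h1 : krylov z w W (size t)
      (foldr (fun a v => {[z, v]} - a *: v) w t - iter (size t) (lie_br z) w).
    by split=> //; exact: h2.
  elim: t => [|a t IHt]; first by rewrite /= subrr; case: sW.
  have h1 := krylov_br sW zW IHt.
  have := sub_predB (krylov_sub z w _ sW) h1 (sub_predZ a (krylov_sub z w _ sW) (h2 _ IHt)).
  by rewrite brBr addrAC.
exists (size s); have [+ _] := h s.
rewrite sv sub0r -scaleN1r => /(sub_predZ (-1) (krylov_sub z w (size s) sW)).
by rewrite scalerA mulrNN mul1r scale1r.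
Qed.

(* The matrix of [x] on the span of [w, zw, z^2 w, ...] modulo [W1] is triangular
   with [i * chi [x, z]] just above the diagonal; comparing both sides of the
   first linear relation between the [z^i w] forces [chi [x, z] = 0]. *)
Lemma weight_bracket_eq0 M z W1 w (chi : g -> R) : subspace_pred W1 ->
  (forall x, W1 x -> W1 {[z, x]}) -> (forall x y, M x -> W1 y -> W1 {[x, y]}) ->
  (forall x, M x -> M {[x, z]}) -> ~ W1 w ->
  (forall x, M x -> W1 ({[x, w]} - chi x *: w)) ->
  forall x, M x -> chi {[x, z]} = 0.
Proof.
move=> s1 zW1 MW1 Mz w1 hw x0 Mx0.
set T := krylov z w W1; set u := fun i => iter i (lie_br z) w.
have sT p : subspace_pred (T p) by exact: krylov_sub.
have key i : (forall x, M x ->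
    T i.-1 ({[x, u i]} - chi x *: u i - (i%:R * chi {[x, z]}) *: u i.-1)) /\
    (forall x, M x -> T i ({[x, u i]} - chi x *: u i)).
  elim: i => [|i [IH1 IH2]].
    by split=> x Mx /=; rewrite ?mul0r ?scale0r ?subr0; exact: hw.
  have h x : M x -> T i ({[x, u i.+1]} - chi x *: u i.+1 - (i.+1%:R * chi {[x, z]}) *: u i).
    move=> Mx; rewrite /= br_deriv.
    have h1 := IH2 _ (Mz _ Mx).
    have h2 : T i ({[z, {[x, u i]}]} - chi x *: {[z, u i]} - (i%:R * chi {[x, z]}) *: u i).
      case: i {h1 IH2} IH1 => [|i] IH1.
        have := zW1 _ (hw _ Mx); rewrite brBr brZr mul0r scale0r subr0; exact.
      have := krylov_br s1 zW1 (IH1 _ Mx).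
      by rewrite !brBr !brZr.
    have := sub_predD (sT i) h1 h2; congr (T i _).
    rewrite -addn1 natrD mulrDl mul1r scalerDl opprD.
    by rewrite !addrA [LHS](ACl (3 * 1 * 4 * 5 * 2)).
  split=> x Mx; first exact: h.
  have := sub_predD (sT i.+1) (krylov_le (h _ Mx))
    (sub_predZ (i.+1%:R * chi {[x, z]}) (sT i.+1) (krylov_iter z w i s1)).
  by rewrite subrK.
have [p0 p0T] := krylov_stabilizes w s1 zW1.
have ex : exists p, `[< T p (u p) >] by exists p0; exact/asboolP.
case: (ex_minnP ex) => -[|p] /asboolP Tp minp; first by case: (w1 Tp).
have npT : ~ T p (u p) by move=> /asboolT /minp; rewrite ltnn.
(* On [T q] every [x] in [M] acts by [chi x] modulo [T q.-1]. Applied to [u p.+1], which lies in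
   [T p.+1], and compared with [key], this leaves a multiple of [u p] in [T p], against the
   minimality of [p.+1]. *)
have Tdown q y : T q y -> forall x, M x -> T q.-1 ({[x, y]} - chi x *: y).
  elim: q y => [|q IHq] y.
    by move=> yT x Mx; apply: sub_predB => //; [exact: MW1|exact: sub_predZ].
  move=> [a ya] x Mx.
  have h1 : T q ({[x, y - a *: u q]} - chi x *: (y - a *: u q)).
    case: q {npT} IHq ya => [|q] IHq ya; first exact: IHq.
    by apply: krylov_le; exact: IHq.
  have h2 := sub_predZ a (sT q) ((key q).2 _ Mx).
  have := sub_predD (sT q) h1 h2; congr (T q _).
  rewrite brBr brZr !scalerBr !scalerA [chi x * a]mulrC.
  rewrite opprB !addrA [LHS](ACl (1 * 4 * (2 * 5) * (3 * 6))) /=.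
  by rewrite addNr subrr !addr0.
have h1 := (key p.+1).1 _ Mx0; have h2 := Tdown _ _ Tp _ Mx0.
have := sub_predB (sT p) h2 h1; rewrite /= opprB addrCA subrr addr0 => h3.
apply/eqP; apply: contra_notT npT => nz.
have := sub_predZ (p.+1%:R * chi {[x0, z]})^-1 (sT p) h3.
by rewrite scalerA mulVf ?scale1r // mulf_neq0 // pnatr_eq0.
Qed.

(** The weight space [W] of [M] modulo [W1] is stable under [z], because its weight vanishes on all
    [[x, z]]. An eigenvector of [z] in [W] modulo [W1] is then a weight vector for [M] and [z]
    together. *)
Lemma lie_pred_step M z : subspace_pred M -> lie_pred M ->
  (forall x, M x -> M {[x, z]}) ->
  lie_pred (fun y => exists a, M (y - a *: z)).
Proof.
move=> sM lM Mz W1 W2 s1 s2 W12 ne i1 i2.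
have MN x : M x -> exists a, M (x - a *: z) by move=> Mx; exists 0; rewrite scale0r subr0.
have zN : exists a, M (z - a *: z) by exists 1; rewrite scale1r subrr; case: sM.
have zW1 x : W1 x -> W1 {[z, x]} by exact: i1.
have [v0 [v02 v01]] := lM W1 W2 s1 s2 W12 ne (fun x y Mx => i1 x y (MN x Mx))
  (fun x y Mx => i2 x y (MN x Mx)).
move=> hv; have {hv} [chi hchi] : {chi : g -> R & forall x, M x ->
    W1 ({[x, v0]} - chi x *: v0)}.
  apply: (choice (P := fun x a => M x -> W1 ({[x, v0]} - a *: v0))) => x.
  by have [/hv[a ha]|nM] := pselect (M x); [exists a|exists 0].
pose W w := W2 w /\ forall x, M x -> W1 ({[x, w]} - chi x *: w).
have sW : subspace_pred W.
  split; first by split=> [|x Mx]; [case: s2|rewrite br0r scaler0 subr0; case: s1].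
  move=> a x y [x2 hx] [y2 hy]; split=> [|u Mu]; first by case: s2 => _; exact.
  rewrite brDr brZr scalerDr opprD addrACA scalerA mulrC -scalerA -scalerBr.
  by case: s1 => _; apply; [exact: hx|exact: hy].
have c0 w : W w -> ~ W1 w -> forall x, M x -> chi {[x, z]} = 0.
  by move=> [_ hw] w1; apply: (weight_bracket_eq0 s1 zW1 _ Mz w1 hw) => x y /MN; exact: i1.
have zW w : W w -> W {[z, w]}.
  move=> Ww; have [w1|w1] := pselect (W1 w).
    split; first by apply: W12; exact: zW1.
    move=> x Mx; apply: sub_predB => //; last by apply: sub_predZ => //; exact: zW1.
    by apply: i1; [exact: MN|exact: zW1].
  split; first by apply: i2 => //; case: Ww.
  move=> x Mx; rewrite br_deriv; case: (Ww) => _ hw.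
  have h1 := hw _ (Mz _ Mx); rewrite (c0 w) // scale0r subr0 in h1.
  have := sub_predD s1 (zW1 _ (hw _ Mx)) h1.
  by rewrite brBr brZr addrAC.
have [|v [Wv v1] [a va]] := @eigenvector_mod z W1 W s1 sW _ zW.
  by exists v0.
exists v; first by case: Wv.
move=> y [b Mb]; exists (chi (y - b *: z) + b * a).
have := sub_predD s1 ((Wv.2) _ Mb) (sub_predZ b s1 va).
rewrite brDl brNl brZl scalerBr scalerA scalerDl !opprD; congr (W1 _).
by rewrite !addrA [LHS](ACl (1 * 3 * 5 * (2 * 4))) /= addNr addr0.
Qed.

Definition vpred (U : {vspace g}) x := x \in U.

Lemma vpred_sub U : subspace_pred (vpred U).
Proof. by split=> [|a x y]; [exact: mem0v|move=> xU yU; rewrite /vpred memvD ?memvZ]. Qed.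

Lemma lie_pred_ext L M : (forall x, L x <-> M x) -> lie_pred L -> lie_pred M.
Proof.
move=> LM lL W1 W2 s1 s2 W12 ne i1 i2.
have [||v vW hv] := lL W1 W2 s1 s2 W12 ne; first by move=> x y /LM; exact: i1.
  by move=> x y /LM; exact: i2.
by exists v => // x /LM; exact: hv.
Qed.

(** Every subspace between [[U, U]] and [U] absorbs brackets with [U], so the vectors of a basis of
    [U] can be adjoined to [[U, U]] one at a time. *)
Lemma lie_pred_derived (U : {vspace g}) :
  lie_pred (vpred (lie_brv U U)) -> (lie_brv U U <= U)%VS -> lie_pred (vpred U).
Proof.
move=> lD DU.
suff h (X : seq g) : {subset X <= U} -> lie_pred (vpred (lie_brv U U + <<X>>)%VS).
  apply: lie_pred_ext (h (vbasis U) _) => [x|x]; last exact: vbasis_mem.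
  rewrite (span_basis (vbasisP U)).
  by have /addv_idPr -> := DU.
elim: X => [_|z X IHX zXU].
  by apply: lie_pred_ext lD => x; rewrite span_nil addv0.
have zU : z \in U by apply: zXU; rewrite mem_head.
have XU : {subset X <= U} by move=> x xX; apply: zXU; rewrite inE xX orbT.
have le : (lie_brv U U + <<X>> <= U)%VS.
  by rewrite subv_add DU /=; apply/span_subvP.
have clz x : x \in (lie_brv U U + <<X>>)%VS -> lie_br x z \in (lie_brv U U + <<X>>)%VS.
  move=> xX; apply: (subvP (addvSl _ _)); apply: mem_brv => //.
  exact: (subvP le).
apply: lie_pred_ext (lie_pred_step (vpred_sub _) (IHX XU) clz) => x.
rewrite /vpred span_cons [(<[z]> + _)%VS]addvC addvA; split=> [[a xa]|].
  by rewrite -(subrK (a *: z) x) memv_add // memvZ // memv_line.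
move=> /memv_addP[u uU [_ /vlineP[a ->] ->]].
by exists a; rewrite addrK.
Qed.

Lemma lie_theorem : lie_pred (fun _ => True).
Proof.
have [[n n0] _] := tri_g.
pose D i := iter i (fun U : {vspace g} => lie_brv U U) fullv.
have D_le i : (D i.+1 <= D i)%VS.
  elim: i => [|i IHi]; first exact: subvf.
  by apply: brv_sub => x y xD yD; apply: mem_brv; exact: (subvP IHi).
have lD i : (i <= n)%N -> lie_pred (vpred (D (n - i)%N)).
  elim: i => [_|i IHi ltin].
    rewrite subn0 [D n]n0 => W1 W2 s1 s2 _ [v v2 v1] _ _; exists v => // x.
    by rewrite /vpred memv0 => /eqP ->; exists 0; rewrite br0l scale0r subr0; case: s1.
  apply: lie_pred_derived; last exact: D_le.
  by have := IHi (ltnW ltin); rewrite -(subnSK ltin).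
apply: lie_pred_ext (lD n (leqnn _)) => x.
by rewrite /vpred subnn memvf.
Qed.

(** A weight vector modulo [W] is sent into [W] by [[g, g]], since its weight vanishes on brackets.
    Adding its line to [W] raises the dimension at the cost of one more bracket with [[g, g]]. *)
Lemma derived_flag d : exists2 W : {vspace g},
  (minn d (\dim {:g}) <= \dim W)%N /\ (forall x y, y \in W -> {[x, y]} \in W) &
  forall (s : seq g) y, size s = d -> {subset s <= derived_alg g} -> y \in W ->
    foldr (@lie_br R g) y s = 0.
Proof.
elim: d => [|d [W [dW iW] sW]].
  exists 0%VS; first split; first by rewrite min0n.
    by move=> x y /[!memv0] /eqP ->; rewrite br0r.
  by move=> [|//] y _ _; rewrite memv0 => /eqP.
have [WT|WT] := boolP (W == fullv).
  exists W; first by split=> //; rewrite (eqP WT) geq_minr.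
  move=> [//|x s] y [ss] sU yW /=.
  by rewrite sW ?br0r // => z zs; apply: sU; rewrite inE zs orbT.
have [v vW] : exists v, v \notin W.
  apply: contra_notP (negP WT) => /forallNP h; rewrite eqEsubv subvf /=.
  by apply/subvP => x _; have /negP := h x; rewrite negbK.
have [||||u [_ uW] hu] := lie_theorem (vpred_sub W) (vpred_sub fullv).
- by move=> x _; rewrite /vpred memvf.
- by exists v; [rewrite /vpred memvf|exact/negP].
- by move=> x y _; exact: iW.
- by move=> x y _ _; rewrite /vpred memvf.
have hn x : x \in derived_alg g -> {[x, u]} \in W.
  apply: (mem_span_lin (f := fun x => {[x, u]})); first by move=> a y z /=; rewrite lie_brDl.
  move=> _ /allpairsP[[a b] /= [_ _ ->]].
  have [ca ha] := hu a I; have [cb hb] := hu b I.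
  have /eqP := br_deriv a b u; rewrite addrC -subr_eq => /eqP <-.
  have /(iW a) h1 := hb; have /(iW b) h2 := ha.
  have h3 := memvB h1 h2; have h4 := memvZ cb ha; have h5 := memvZ ca hb.
  suff -> : {[a, {[b, u]}]} - {[b, {[a, u]}]} =
      {[a, {[b, u]} - cb *: u]} - {[b, {[a, u]} - ca *: u]} +
      cb *: ({[a, u]} - ca *: u) - ca *: ({[b, u]} - cb *: u)
    by exact: (memvB (memvD h3 h4) h5).
  apply/esym.
  rewrite !brBr !brZr !scalerBr !scalerA [ca * cb]mulrC !opprB.
  rewrite !addrA [LHS](ACl (1 * 4 * (2 * 5) * (3 * 8) * (6 * 7))) /=.
  by rewrite !addNr subrr !addr0.
exists (W + <[u]>)%VS.
  split.
    have : (\dim W < \dim (W + <[u]>))%N.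
      rewrite ltn_neqAle dimvS ?addvSl // andbT; apply/negP => e; apply: uW.
      have : W == (W + <[u]>)%VS by rewrite eqEdim addvSl /= (eqP e).
      by move=> /eqP ->; apply: (subvP (addvSr W _)); exact: memv_line.
    by lia.
  move=> x y /memv_addP[w wW [_ /vlineP[a ->] ->]]; rewrite brDr brZr.
  have [b hb] := hu x I.
  rewrite -[{[x, u]}](subrK (b *: u)) scalerDr addrA memv_add //.
    by rewrite memvD ?iW // memvZ.
  by rewrite !memvZ // memv_line.
move=> s; elim/last_ind: s => [//|s x _] y; rewrite size_rcons => -[ss] sU.
move=> /memv_addP[w wW [_ /vlineP[a ->] ->]].
rewrite foldr_rcons; apply: sW => //.
  by move=> z zs; apply: sU; rewrite mem_rcons inE zs orbT.
by rewrite brDr brZr memvD ?iW // memvZ // hn // sU // mem_rcons mem_head.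
Qed.

Lemma derived_ad_nilpotent : exists N, forall (s : seq g) y, size s = N ->
  {subset s <= derived_alg g} -> foldr (@lie_br R g) y s = 0.
Proof.
have [W [dW _] sW] := derived_flag (\dim {:g}).
exists (\dim {:g}) => s y ss sU; apply: sW => //.
suff -> : W = fullv by exact: memvf.
by apply/eqP; rewrite eqEdim subvf /= -[X in (X <= _)%N]minnn.
Qed.

End LieTheorem.

(** * Nilpotency of the augmentation ideal modulo an ideal *)

Section LowerCentralSeries.
Variables (R : realType) (g : lieAlg R) (E : seq g).
Hypothesis E_span : <<E>>%VS = derived_alg g.
Local Notation n := (derived_alg g).

(** Generators of the lower central series of [[g, g]] whose right factors come from the fixed list
    [E]: nilpotency modulo an ideal will be known for the elements of [E] and has to be passed on to
    the brackets [[u, e]]. *)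
Fixpoint lcs_gen i : seq g :=
  if i is j.+1 then [seq lie_br u v | u <- vbasis <<lcs_gen j>>%VS, v <- E] else E.

Definition lcs i := <<lcs_gen i>>%VS.

Lemma lcs_br i x y : x \in lcs i -> y \in n -> lie_br x y \in lcs i.+1.
Proof.
move=> xi; rewrite -E_span => yn.
apply: (mem_span_lin (f := lie_br x)) yn; first exact: lie_br_linear.
move=> v vE.
have {}xi : x \in <<vbasis (lcs i)>>%VS by rewrite (span_basis (vbasisP _)).
apply: (mem_span_lin (f := fun x => lie_br x v)) xi.
  by move=> a u w /=; rewrite lie_brDl.
by move=> u uV; apply: memv_span; apply: allpairs_f.
Qed.

Lemma lcs_decr i : (lcs i.+1 <= lcs i)%VS.
Proof.
elim: i => [|i IHi]; apply/span_subvP => _ /allpairsP[[u v] /= [ui vE ->]].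
  by rewrite /lcs /= E_span mem_derived.
apply: lcs_br; first by apply: (subvP IHi); exact: vbasis_mem.
by rewrite -E_span memv_span.
Qed.

Lemma lcs_sub i : (lcs i <= n)%VS.
Proof.
elim: i => [|i IHi]; first by rewrite /lcs /= E_span.
exact: subv_trans (lcs_decr i) IHi.
Qed.

Lemma foldr_br_linear (s : seq g) : linear (fun y => foldr (@lie_br R g) y s).
Proof. by elim: s => [//|x s IHs] a u v /=; rewrite IHs lie_brDr. Qed.

(** Writing a generator [[v, w]] as [- [w, v]] trades one level of the series for one more operator
    in [s], until [N] operators act. *)
Lemma lcs_eq0 : triangular g -> exists N, lcs N = 0%VS.
Proof.
move=> /derived_ad_nilpotent[N hN]; exists N.
suff h i : (i <= N)%N -> forall (s : seq g) u, size s = (N - i)%N ->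
    {subset s <= n} -> u \in lcs i -> foldr (@lie_br R g) u s = 0.
  apply/eqP; rewrite -subv0; apply/subvP => u uN.
  by rewrite memv0; apply/eqP; apply: (h N (leqnn _) [::]) => //; rewrite subnn.
elim: i => [|i IHi] iN s u ss sn ui; first by apply: hN => //; rewrite ss subn0.
apply/eqP; rewrite -memv0.
apply: (mem_span_lin (foldr_br_linear s)) ui => _ /allpairsP[[v w] /= [vi wE ->]].
rewrite memv0 br_anti -scaleN1r -[_ *: _]addr0 foldr_br_linear -foldr_rcons.
rewrite (IHi (ltnW iN)) ?scaler0 ?add0r //.
- elim: (s) => [//=|x t /= /eqP ->]; by rewrite br0r.
- by rewrite size_rcons ss; lia.
- move=> x; rewrite mem_rcons inE => /predU1P[->|/sn //].
  by rewrite -E_span memv_span.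
- exact: vbasis_mem.
Qed.

End LowerCentralSeries.

Section IdealPowers.
Variables (R : realType) (g : lieAlg R) (U : algType R) (j : g -> U).
Hypothesis j_hom : lie_alg_hom j.
Variable K : U -> Prop.
Hypothesis K0 : K 0.
Hypothesis KD : forall u v, K u -> K v -> K (u + v).
Hypothesis KZ : forall a u, K u -> K (a *: u).
Hypothesis Kl : forall u v, K v -> K (u * v).
Hypothesis Kr : forall u v, K u -> K (u * v).
Local Notation n := (derived_alg g).

Lemma lie_alg_hom_br x y : j x * j y = j y * j x + j (lie_br x y).
Proof. by rewrite j_hom.2 addrC subrK. Qed.

Lemma lie_alg_hom_lin a x y : j (a *: x + y) = a *: j x + j y.
Proof. exact: j_hom.1. Qed.

Lemma lie_alg_hom0 : j 0 = 0.
Proof.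
have := lie_alg_hom_lin 1 0 0; rewrite !scale1r addr0 => /eqP.
by rewrite -subr_eq subrr => /eqP <-.
Qed.

Lemma lie_alg_homN x : j (- x) = - j x.
Proof. by rewrite -[- x]addr0 -scaleN1r lie_alg_hom_lin lie_alg_hom0 addr0 scaleN1r. Qed.

(* The [m]-th power of the ideal generated by [T] in the subalgebra generated
   by [n], enlarged by [K]. *)
Inductive ipow (T : {vspace g}) : nat -> U -> Prop :=
| ipowK m u : K u -> ipow T m u
| ipow1 : ipow T 0 1
| ipowD m u v : ipow T m u -> ipow T m v -> ipow T m (u + v)
| ipowZ m a u : ipow T m u -> ipow T m (a *: u)
| ipowL m y u : y \in n -> ipow T m u -> ipow T m (j y * u)
| ipowS m x u : x \in T -> ipow T m u -> ipow T m.+1 (j x * u).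

Lemma ipow0 T m : ipow T m 0.
Proof. exact: ipowK. Qed.

Lemma ipowN T m u : ipow T m u -> ipow T m (- u).
Proof. by rewrite -scaleN1r; exact: ipowZ. Qed.

Lemma ipowB T m u v : ipow T m u -> ipow T m v -> ipow T m (u - v).
Proof. by move=> hu /ipowN hv; exact: ipowD. Qed.

Lemma ipowM T m p u v : ipow T m u -> ipow T p v -> ipow T (m + p) (u * v).
Proof.
move=> + hv; elim=> {m u} [m u Ku||m u u' _ IH1 _ IH2|m a u _ IH|m y u yn _ IH|m x u xT _ IH].
- by apply: ipowK; exact: Kr.
- by rewrite mul1r.
- by rewrite mulrDl; exact: ipowD.
- by rewrite -scalerAl; exact: ipowZ.
- by rewrite -mulrA; exact: ipowL.
- by rewrite -mulrA addSn; exact: ipowS.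
Qed.

Lemma ipow_gen T y : y \in n -> ipow T 0 (j y).
Proof. by move=> yn; rewrite -[j y]mulr1; apply: ipowL => //; exact: ipow1. Qed.

Lemma ipowR T m u y : y \in n -> ipow T m u -> ipow T m (u * j y).
Proof. by move=> yn hu; rewrite -[m]addn0; apply: ipowM => //; exact: ipow_gen. Qed.

Lemma ipow_exp T u m : ipow T 0 u -> ipow T 0 (u ^+ m).
Proof.
move=> hu; elim: m => [|m IHm]; first exact: ipow1.
by rewrite exprS -[0%N]addn0; exact: ipowM.
Qed.

Lemma ipow_mono (T T' : {vspace g}) m u : (T <= T')%VS -> ipow T m u -> ipow T' m u.
Proof.
move=> /subvP TT'; elim=> {m u} *; [exact: ipowK|exact: ipow1|exact: ipowD|exact: ipowZ|exact: ipowL|].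
by apply: ipowS => //; exact: TT'.
Qed.

Lemma ipowW (T : {vspace g}) m u : (T <= n)%VS -> ipow T m.+1 u -> ipow T m u.
Proof.
move=> /subvP Tn; move: {-2}m.+1 (erefl m.+1) => p ep hu.
elim: hu m ep => {p u} [p u Ku m _|//|p u v _ IHu _ IHv m ep|p a u _ IHu m ep|
    p y u yn _ IHu m ep|p x u xT hu _ m [<-]].
- exact: ipowK.
- by apply: ipowD; [exact: IHu|exact: IHv].
- by apply: ipowZ; exact: IHu.
- by apply: ipowL => //; exact: IHu.
- by apply: ipowL => //; exact: Tn.
Qed.

(** Modulo [K], a member of the power [a + b] is a sum of products from the powers [a] and [b]. The
    elimination form avoids naming these sums. *)
Lemma ipow_split T a b (P : U -> Prop) u : (forall u, K u -> P u) ->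
  (forall u v, P u -> P v -> P (u + v)) ->
  (forall p q, ipow T a p -> ipow T b q -> P (p * q)) -> ipow T (a + b) u -> P u.
Proof.
move=> KP PD Ppq hu; move: {-2}(a + b)%N hu (erefl (a + b)%N) => m hu.
elim: hu a P KP PD Ppq => {m u} [m u Ku a P KP PD Ppq|a P KP PD Ppq|m u v hu IHu hv IHv a P KP PD Ppq|
    m c u hu IHu a P KP PD Ppq|m y u yn hu IHu a P KP PD Ppq|m x u xT hu IHu a P KP PD Ppq] em.
- exact: KP.
- have [a0 b0] : a = 0%N /\ b = 0%N by lia.
  rewrite -[1]mulr1; apply: Ppq; rewrite ?a0 ?b0; exact: ipow1.
- by apply: (PD); [exact: (IHu a)|exact: (IHv a)].

- apply: (IHu a (fun u => P (c *: u))) => //.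
  + by move=> w Kw; apply: KP; exact: KZ.
  + by move=> w w' h h'; rewrite scalerDr; exact: PD.
  + by move=> p q hp hq; rewrite scalerAl; apply: Ppq => //; exact: ipowZ.
- apply: (IHu a (fun u => P (j y * u))) => //.
  + by move=> w Kw; apply: KP; exact: Kl.
  + by move=> w w' h h'; rewrite mulrDr; exact: PD.
  + by move=> p q hp hq; rewrite mulrA; apply: Ppq => //; exact: ipowL.
- case: a Ppq em => [|a] Ppq em.
    rewrite -[_ * _]mul1r; apply: Ppq; first exact: ipow1.
    by rewrite -[b]add0n em; exact: ipowS.
  apply: (IHu a (fun u => P (j x * u))) => //.
  + by move=> w Kw; apply: KP; exact: Kl.
  + by move=> w w' h h'; rewrite mulrDr; exact: PD.
  + by move=> p q hp hq; rewrite mulrA; apply: Ppq => //; exact: ipowS.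
  + by move: em; rewrite addSn => -[].
Qed.

Section CentralStep.
Variables (T : {vspace g}) (w : g).
Hypothesis T_n : (T <= n)%VS.
Hypothesis w_n : w \in n.
Hypothesis w_central : forall y, y \in n -> lie_br y w \in T.
Local Notation I := (ipow T 1).

Lemma central_comm v : ipow T 0 v -> I (j w * v - v * j w).
Proof.
move: {-2}0%N (erefl 0%N) => m em hv.
elim: hv em => {m v} [m u Ku _|_|m u v _ IHu _ IHv em|m a u _ IHu em|m y u yn hu IHu em|//].
- by apply: ipowB; apply: ipowK; [exact: Kl|exact: Kr].
- by rewrite mulr1 mul1r subrr; exact: ipow0.
- by rewrite mulrDr mulrDl opprD addrACA; apply: ipowD; [exact: IHu|exact: IHv].
- by rewrite -scalerAr -scalerAl -scalerBr; apply: ipowZ; exact: IHu.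
- rewrite mulrA (lie_alg_hom_br w y) mulrDl addrAC -!mulrA -mulrBr.
  apply: ipowD; first by apply: ipowL => //; exact: IHu.
  rewrite br_anti lie_alg_homN mulNr; apply: ipowN.
  apply: ipowS; [exact: w_central|by move: hu; rewrite em].
Qed.

(** As [w] is central modulo [T], all factors [j w] can be moved to the right end; a factor from
    [T], or a commutator arising on the way, puts the term into [I]. *)
Lemma ipow_add_central m u : ipow (T + <[w]>) m u ->
  exists r v, [/\ I r, ipow T 0 v & u = r + v * j w ^+ m].
Proof.
elim=> {m u} [m u Ku||m u u' _ [r [v [hr hv ->]]] _ [r' [v' [hr' hv' ->]]]|
    m a u _ [r [v [hr hv ->]]]|m y u yn _ [r [v [hr hv ->]]]|m x u xT _ [r [v [hr hv ->]]]].
- exists u, 0; split; [exact: ipowK|exact: ipow0|by rewrite mul0r addr0].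
- exists 0, 1; split; [exact: ipow0|exact: ipow1|by rewrite add0r mulr1].
- exists (r + r'), (v + v'); split; [exact: ipowD|exact: ipowD|].
  by rewrite mulrDl addrACA.
- exists (a *: r), (a *: v); split; [exact: ipowZ|exact: ipowZ|].
  by rewrite scalerDr scalerAl.
- exists (j y * r), (j y * v); split; [exact: ipowL|exact: ipowL|].
  by rewrite mulrDr mulrA.
- move: xT => /memv_addP[t tT [_ /vlineP[c ->] ->]].
  have wm : ipow T 0 (j w ^+ m) by apply: ipow_exp; exact: ipow_gen.
  exists ((j t + c *: j w) * r + j t * v * j w ^+ m +
    c *: ((j w * v - v * j w) * j w ^+ m)), (c *: v); split.
  + apply: ipowD; last first.
      by apply: ipowZ; rewrite -[1%N]addn0; apply: ipowM => //; exact: central_comm.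
    apply: ipowD.
      rewrite mulrDl -scalerAl.
      apply: ipowD; last by apply: ipowZ; exact: ipowL.
      by apply: ipowL => //; exact: (subvP T_n).
    by rewrite -[1%N]addn0; apply: ipowM => //; exact: ipowS.
  + exact: ipowZ.
  + have e : c *: ((j w * v - v * j w) * j w ^+ m) + c *: v * j w ^+ m.+1 =
        c *: j w * (v * j w ^+ m).
      by rewrite exprS -!scalerAl -scalerDr mulrBl -!mulrA subrK.
    rewrite -[RHS]addrA e [t + _]addrC lie_alg_hom_lin [c *: j w + _]addrC.
    by rewrite mulrDr [X in _ + X]mulrDl addrA -mulrA.
Qed.

(** A block of [s] factors lies in [I], since both summands given by [ipow_add_central] do; hence
    [N] blocks lie in the [N]-th power for [T]. *)
Lemma ipow_central_step N s : I (j w ^+ s) ->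
  (forall u, ipow T N u -> K u) -> exists N', forall u, ipow (T + <[w]>) N' u -> K u.
Proof.
move=> ws TN; exists (N * s)%N.
suff h m u : ipow (T + <[w]>) (m * s) u -> ipow T m u by move=> u /h /TN.
elim: m u => [|m IHm] u.
  move=> /ipow_add_central[r [v [hr hv ->]]]; rewrite mulr1.
  by apply: ipowD => //; exact: ipowW.
rewrite mulSn; apply: ipow_split.
- by move=> v Kv; exact: ipowK.
- by move=> v v' hv hv'; exact: ipowD.
- move=> p q /ipow_add_central[r [v [hr hv ->]]] /IHm hq.
  rewrite -addn1 addnC; apply: ipowM => //; apply: ipowD => //.
  by rewrite -[1%N]add0n; exact: ipowM.
Qed.

End CentralStep.

(* [ad x] acts on the quotient by the ideal of [T] as the derivation
   [w d/de], so that applying it [s] times to [e ^ s] gives [s! w ^ s]. *)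
Lemma central_bracket_nilpotent (T : {vspace g}) (x e : g) s : (T <= n)%VS ->
  x \in n -> e \in n -> (forall y, y \in n -> lie_br y (lie_br x e) \in T) ->
  K (j e ^+ s) -> ipow T 1 (j (lie_br x e) ^+ s).
Proof.
move=> Tn xn en cT Ks; set w := lie_br x e in cT *.
have wn : w \in n by exact: mem_derived.
have wT m : ipow T 0 (j w ^+ m) by apply: ipow_exp; exact: ipow_gen.
have eT m : ipow T 0 (j e ^+ m) by apply: ipow_exp; exact: ipow_gen.
have cw v : ipow T 0 v -> ipow T 1 (j w * v - v * j w) by exact: central_comm.
have xw m : ipow T 1 (j x * j w ^+ m - j w ^+ m * j x).
  elim: m => [|m IHm]; first by rewrite mulr1 mul1r subrr; exact: ipow0.
  rewrite exprSr; have h1 := ipowR wn IHm.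
  have h2 := ipowN (ipowM (wT m) (cw _ (ipow_gen T xn))).
  have := ipowD h1 h2; congr (ipow T 1 _).
  by rewrite mulrBl mulrBr opprB !mulrA addrA subrK.
have xe m : ipow T 1 (j x * j e ^+ m.+1 - j e ^+ m.+1 * j x - m.+1%:R *: (j w * j e ^+ m)).
  elim: m => [|m IHm].
    by rewrite !expr1 expr0 mulr1 scale1r lie_alg_hom_br addrAC addrK subrr; exact: ipow0.
  have h1 := ipowL en IHm.
  have h2 : ipow T 1 (- (m.+1%:R *: ((j w * j e - j e * j w) * j e ^+ m))).
    apply: ipowN; apply: ipowZ; rewrite -[1%N]addn0; apply: ipowM => //.
    exact: cw (ipow_gen T en).
  have := ipowD h1 h2; congr (ipow T 1 _).
  have -> : j x * j e ^+ m.+2 = j e * (j x * j e ^+ m.+1) + j w * j e ^+ m.+1.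
    by rewrite exprS mulrA lie_alg_hom_br mulrDl -mulrA.
  rewrite -[m.+2%:R]natr1 scalerDl scale1r !mulrBr mulrBl scalerBr.
  rewrite -scalerAr [j e * (_ * j x)]mulrA -[j e * j e ^+ _]exprS.
  rewrite -[j w * j e * _]mulrA -[j e * j e ^+ _]exprS -[j e * j w * _]mulrA.
  rewrite !opprD !opprK !addrA.
  rewrite [LHS](ACl (1 * 2 * 4 * (3 * 5))) [RHS](ACl (1 * 3 * 4 * (2 * 5))) /=.
  by rewrite addNr subrr.
suff h m : (m <= s)%N -> ipow T 1 (j w ^+ m * j e ^+ (s - m)).
  by have := h s (leqnn _); rewrite subnn mulr1.
elim: m => [_|m IHm ms]; first by rewrite subn0 mul1r; exact: ipowK.
have := IHm (ltnW ms); set r := (s - m.+1)%N; have -> : (s - m)%N = r.+1 by rewrite /r; lia.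
move=> h; have h1 := ipowB (ipowL xn h) (ipowR xn h).
have h2 := ipowM (xw m) (eT r.+1).
have h3 := ipowM (wT m) (xe r).
have := ipowB (ipowB h1 h2) h3.
move=> /(ipowZ (r.+1%:R^-1)); congr (ipow T 1 _).
rewrite !mulrBl !mulrBr !mulrA !opprB !addrA.
rewrite [X in _ *: X](ACl ((1 * 4) * (2 * 6) * (3 * 7) * 5)) /=.
rewrite !subrr addNr !add0r -scalerAr scalerA mulVf ?scale1r ?pnatr_eq0 //.
by rewrite mulrA -exprSr.
Qed.

Definition nil_mod T := exists N, forall u, ipow T N u -> K u.

Lemma nil_mod0 : nil_mod 0%VS.
Proof.
exists 1%N; move: {-2}1%N (erefl 1%N) => m em u hu.
elim: hu em => {m u} [//|//|m u v _ IHu _ IHv em|m a u _ IHu em|m y u _ _ IHu em|m x u x0 _ _ _].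
- by apply: KD; [exact: IHu|exact: IHv].
- by apply: KZ; exact: IHu.
- by apply: Kl; exact: IHu.
- by move: x0; rewrite memv0 => /eqP ->; rewrite lie_alg_hom0 mul0r.
Qed.

Lemma nil_mod_add (T : {vspace g}) (X : seq g) : (T <= n)%VS ->
  (forall w, w \in X -> [/\ w \in n, forall y, y \in n -> lie_br y w \in T &
    exists s, ipow T 1 (j w ^+ s)]) ->
  nil_mod T -> nil_mod (T + <<X>>)%VS.
Proof.
move=> Tn XT nT; elim: X XT => [_|w X IHX XT]; first by rewrite span_nil addv0.
have [N hN] : nil_mod (T + <<X>>)%VS.
  by apply: IHX => v vX; apply: XT; rewrite inE vX orbT.
have [wn wc [s ws]] := XT w (mem_head _ _).
have TX : (T + <<X>> <= n)%VS.
  rewrite subv_add Tn; apply/span_subvP => v vX.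
  by have [] := XT v; rewrite // inE vX orbT.
have -> : (T + <<w :: X>>)%VS = (T + <<X>> + <[w]>)%VS.
  by rewrite span_cons [(<[w]> + _)%VS]addvC addvA.
apply: (ipow_central_step TX wn _ _ hN (s := s)) => [y yn|].
  by apply: (subvP (addvSl _ _)); exact: wc.
exact: ipow_mono (addvSl _ _) ws.
Qed.

(** Climb the lower central series from its zero term. A term is central modulo the next one, and
    its generators are nilpotent modulo the ideal of the next one: by hypothesis on the first level,
    and as brackets with a nilpotent element of [E] on the others. *)
Theorem derived_nil_mod (E : seq g) : triangular g -> <<E>>%VS = n ->
  (forall e, e \in E -> exists s, K (j e ^+ s)) -> nil_mod n.
Proof.
move=> tri En EK; have [c lc] := lcs_eq0 En tri.
suff h i : (i <= c)%N -> nil_mod (lcs E (c - i)).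
  by have := h c (leqnn _); rewrite subnn /lcs /= En.
elim: i => [_|i IHi ic]; first by rewrite subn0 lc; exact: nil_mod0.
have := IHi (ltnW ic); rewrite -(subnSK ic); set m := (c - i.+1)%N => hm.
have -> : lcs E m = (lcs E m.+1 + <<lcs_gen E m>>)%VS.
  by apply/esym/addv_idPr; exact: lcs_decr.
apply: nil_mod_add hm; first exact: lcs_sub.
move=> w wX; have wm : w \in lcs E m by exact: memv_span.
have wn : w \in n by exact: (subvP (lcs_sub En m)).
have wc y : y \in n -> lie_br y w \in lcs E m.+1.
  by move=> yn; rewrite br_anti memvN; exact: lcs_br.
split=> //; case: m wX {wm wn} wc => [wE _|m /allpairsP[[x e] /= [xm eE ->]] wc].
  by have [s Ks] := EK _ wE; exists s; exact: ipowK.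
have [s Ks] := EK _ eE; exists s; apply: central_bracket_nilpotent => //.
- exact: lcs_sub.
- by apply: (subvP (lcs_sub En m)); exact: vbasis_mem.
- by rewrite -En memv_span.
Qed.
End IdealPowers.

(** * Spanning by ordered monomials, and characters *)

Section GeneratedSubalgebra.
Variables (R : realType) (g : lieAlg R) (U : envelope g).
Local Notation j := (env_inj U).

Definition words (r : seq (R * seq g)) : U :=
  \sum_(p <- r) p.1 *: \prod_(x <- p.2) j x.

Definition word_pred : {pred U} := fun u => `[< exists r, u = words r >].

Lemma word_predP u : reflect (exists r, u = words r) (u \in word_pred).
Proof. exact: asboolP. Qed.

Fact word_subalg : GRing.subalg_closed word_pred.
Proof.
split.
- by apply/word_predP; exists [:: (1, [::])]; rewrite /words big_seq1 big_nil scale1r.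
- move=> a _ _ /word_predP[r ->] /word_predP[s ->]; apply/word_predP.
  exists ([seq (a * p.1, p.2) | p <- r] ++ s).
  rewrite /words big_cat big_map /= scaler_sumr; congr (_ + _).
  by apply: eq_bigr => p _; rewrite scalerA.
- move=> _ _ /word_predP[r ->] /word_predP[s ->]; apply/word_predP.
  exists [seq (p.1 * q.1, p.2 ++ q.2) | p <- r, q <- s].
  rewrite /words big_allpairs_dep big_distrl /=; apply: eq_bigr => p _.
  rewrite big_distrr /=; apply: eq_bigr => q _.
  by rewrite big_cat /= -scalerAl -scalerAr scalerA.
Qed.

HB.instance Definition _ := GRing.isSubalgClosed.Build R U word_pred word_subalg.

Record word_alg := WordAlg { word_val :> U; _ : word_val \in word_pred }.
HB.instance Definition _ := [isSub for word_val].
HB.instance Definition _ := [Choice of word_alg by <:].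
HB.instance Definition _ := [SubChoice_isSubAlgebra of word_alg by <:].

Lemma gen_word x : j x \in word_pred.
Proof.
by apply/word_predP; exists [:: (1, [:: x])]; rewrite /words !big_seq1 scale1r.
Qed.

(** The universal map into the subalgebra of words, followed by the inclusion, fixes the generators,
    hence is the identity by uniqueness. *)
Lemma words_span u : exists r, u = words r.
Proof.
pose j' x : word_alg := WordAlg (gen_word x).
have j'_hom : lie_alg_hom j'.
  split=> [a x y|x y]; apply: val_inj; first by rewrite /= (env_lie U).1.
  by rewrite /= (env_lie U).2.
have [F [[[FL [F1 FM]] Fj] _]] := env_univ U j'_hom.
have [G [_ Guniq]] := env_univ U (env_lie U).
have GF : G = \val \o F.
  apply: Guniq; split; last by move=> x; rewrite /= Fj.
  split=> [a x y|]; first by rewrite /= FL.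
  by split=> [|x y]; rewrite /= ?F1 ?FM.
have Gid : G = id by apply: Guniq; split=> //; split.
have -> : u = \val (F u) by rewrite -[LHS]/(id u) -Gid GF.
by apply/word_predP; case: (F u).
Qed.

End GeneratedSubalgebra.

Lemma prod_sorted (A : pzRingType) (F : nat -> A) m lo (t : seq nat) :
  (lo <= m)%N -> sorted leq t -> all (fun i => lo <= i < m)%N t ->
  \prod_(i <- t) F i = \prod_(lo <= i < m) F i ^+ count_mem i t.
Proof.
elim: t lo => [|i t IHt] lo lom st.
  by move=> _; rewrite big_nil big1.
move=> /= /andP[/andP[loi im] tm]; rewrite big_cons.
have it : all (fun x => i <= x)%N t by exact: order_path_min leq_trans st.
rewrite (IHt i) ?(ltnW im) ?(path_sorted st) //; last first.
  by apply/allP => x xt; have /andP[_ ->] := allP tm _ xt; rewrite (allP it).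
have e1 : \prod_(lo <= x < i) F x ^+ ((i == x) + count_mem x t) = 1.
  rewrite big_nat; apply: big1 => x /andP[lox xi]; have -> : (i == x) = false by lia.
  rewrite (_ : count_mem x t = 0%N) //; apply/count_memPn/negP => /(allP it) /=.
  by rewrite leqNgt xi.
rewrite [RHS](big_cat_nat loi (ltnW im)) /= e1 {e1}.
rewrite mul1r big_ltn // [RHS]big_ltn // eqxx mulrA -exprS.
congr (_ * _); rewrite !big_nat; apply: eq_bigr => x /andP[ix _].
by have -> : (i == x) = false by lia.
Qed.

Lemma lie_alg_hom_sum (R : realType) (g : lieAlg R) (A : algType R) (f : g -> A)
    I (r : seq I) (c : I -> R) (x : I -> g) : lie_alg_hom f ->
  f (\sum_(i <- r) c i *: x i) = \sum_(i <- r) c i *: f (x i).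
Proof.
move=> fh; elim: r => [|i r IHr]; first by rewrite !big_nil (lie_alg_hom0 fh).
by rewrite !big_cons fh.1 IHr.
Qed.

(** * Rewriting words into ordered monomials; characters *)

Section PBWSpan.
Variables (R : realType) (g : lieAlg R) (U : envelope g) (k l : nat).
Variables (e : k.-tuple g) (f : l.-tuple g).
Hypothesis ef_basis : basis_of fullv (e ++ f).
Local Notation j := (env_inj U).
Local Notation b := (fun i => (e ++ f)`_i).

Definition mono (al : {ffun 'I_k -> nat}) (be : {ffun 'I_l -> nat}) : U :=
  (\prod_(i < k) j (tnth e i) ^+ al i) * (\prod_(i < l) j (tnth f i) ^+ be i).

Definition pbw (r : seq (R * {ffun 'I_k -> nat} * {ffun 'I_l -> nat})) : U :=
  \sum_(p <- r) p.1.1 *: mono p.1.2 p.2.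

Let B (t : seq nat) : U := \prod_(i <- t) j (b i).

Lemma sorted_mono t : sorted leq t -> all (fun i => i < k + l)%N t ->
  B t = mono [ffun i : 'I_k => count_mem (i : nat) t]
             [ffun i : 'I_l => count_mem (k + i)%N t].
Proof.
move=> st tm; rewrite /B (prod_sorted _ (leq0n (k + l)) st); last exact: tm.
rewrite big_mkord big_split_ord /mono /=; congr (_ * _); apply: eq_bigr => i _; rewrite ffunE.
  by rewrite nth_cat size_tuple ltn_ord (tnth_nth 0).
by rewrite nth_cat size_tuple ltnNge leq_addr addKn (tnth_nth 0).
Qed.

Fixpoint ins (i : nat) t := if t is i' :: t' then
  if (i <= i')%N then i :: t else i' :: ins i t' else [:: i].

Lemma ins_path x i t : (x <= i)%N -> path leq x t -> path leq x (ins i t).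
Proof.
elim: t x => [|y t IHt] x /= xi; first by rewrite xi.
move=> /andP[xy yt]; case: leqP => [iy|yi] /=; first by rewrite xi iy yt.
by rewrite xy IHt // ltnW.
Qed.

Lemma ins_sorted i t : sorted leq t -> sorted leq (ins i t).
Proof.
case: t => [//|y t] /= yt; case: leqP => [iy|yi] /=; first by rewrite iy.
by rewrite ins_path // ltnW.
Qed.

Lemma ins_perm i t : perm_eq (ins i t) (i :: t).
Proof.
elim: t => [//|y t IHt] /=; case: ifP => // _.
apply: (@perm_trans _ [:: y, i & t]); first by rewrite perm_cons.
by have := perm_catCA [:: y] [:: i] t => /= ->.
Qed.

Definition lin_closed (P : U -> Prop) :=
  P 0 /\ forall a u v, P u -> P v -> P (a *: u + v).

Lemma lin_closed_sum P I (r : seq I) (F : I -> U) : lin_closed P ->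
  (forall i, P (F i)) -> P (\sum_(i <- r) F i).
Proof.
move=> [P0 PL] PF; elim: r => [|i r IHr]; first by rewrite big_nil.
by rewrite big_cons -[F i]scale1r; exact: PL.
Qed.

Lemma lin_closedZ P a u : lin_closed P -> P u -> P (a *: u).
Proof. by move=> [P0 PL] Pu; rewrite -[_ *: _]addr0; exact: PL. Qed.

(** Exchanging two neighbours costs a word in which they are replaced by their bracket. It has one
    letter fewer, so inserting [i] at its place is free modulo shorter words. *)
Lemma ins_diff (P : U -> Prop) (p : seq g) i t : lin_closed P ->
  (forall q : seq g, (size q <= size p + size t)%N -> P (\prod_(x <- q) j x)) ->
  P (\prod_(x <- p) j x * (B (i :: t) - B (ins i t))).
Proof.
move=> Pl; elim: t p => [|y t IHt] p hP /=.
  by rewrite subrr mulr0; case: Pl.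
case: leqP => [_|_]; first by rewrite subrr mulr0; case: Pl.
have -> : B [:: i, y & t] - B (y :: ins i t) =
    j (lie_br (b i) (b y)) * B t + j (b y) * (B (i :: t) - B (ins i t)).
  rewrite /B !big_cons (env_lie U).2 mulrBr !mulrBl !mulrA.
  by rewrite addrA subrK.
rewrite mulrDr -[X in P (X + _)]scale1r; apply: Pl.2.
  have := hP (p ++ lie_br (b i) (b y) :: [seq b i | i <- t]).
  rewrite big_cat big_cons big_map /=; apply.
  by rewrite size_cat /= size_map.
have := IHt (rcons p (b y)); rewrite -cats1 big_cat big_seq1 -mulrA; apply.
by move=> q; rewrite size_cat addn1 addSnnS; exact: hP.
Qed.

Definition spb d u := exists r : seq (R * seq nat),
  all (fun p => [&& sorted leq p.2, all (fun i => i < k + l)%N p.2 & (size p.2 <= d)%N]) r /\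
  u = \sum_(p <- r) p.1 *: B p.2.

Lemma spb_lin d : lin_closed (spb d).
Proof.
split; first by exists [::]; rewrite big_nil.
move=> a _ _ [r [hr ->]] [s [hs ->]]; exists ([seq (a * p.1, p.2) | p <- r] ++ s).
split; first by rewrite all_cat all_map hs andbT.
rewrite big_cat big_map /= scaler_sumr; congr (_ + _).
by apply: eq_bigr => p _; rewrite scalerA.
Qed.

Lemma spb_mono d d' u : (d <= d')%N -> spb d u -> spb d' u.
Proof.
move=> dd' [r [hr ->]]; exists r; split=> //; apply: sub_all hr => p /and3P[-> -> h] /=.
exact: leq_trans h dd'.
Qed.

Lemma spb_words d (q : seq g) : (size q <= d)%N -> spb d (\prod_(x <- q) j x).
Proof.
elim: d q => [|d IHd] [|x q] // hq.
- by exists [:: (1, [::])]; rewrite big_seq1 /B !big_nil scale1r.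
- by exists [:: (1, [::])]; rewrite big_seq1 /B !big_nil scale1r.
rewrite big_cons; have [r [hr ->]] := IHd q hq.
have -> : x = \sum_(i < k + l) coord (cat_tuple e f) i x *: b i.
  by rewrite [LHS](coord_basis ef_basis) ?memvf.
rewrite (lie_alg_hom_sum _ _ _ (env_lie U)) big_distrl /=.
apply: lin_closed_sum; first exact: spb_lin.
move=> i; rewrite big_distrr /= big_seq; elim/big_ind: _ => [|u v hu hv|p pr].
- by case: (spb_lin d.+1).
- by rewrite -[u]scale1r; apply: (spb_lin d.+1).2.
have /and3P[ps pm pd] := allP hr _ pr.
rewrite -scalerAl -scalerAr; do 2 (apply: lin_closedZ; first exact: spb_lin).
have -> : j (b i) * B p.2 = 1 *: B (ins i p.2) + (B ((i : nat) :: p.2) - B (ins i p.2)).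
  by rewrite scale1r addrC subrK /B big_cons.
apply: (spb_lin d.+1).2.
  exists [:: (1, ins i p.2)]; rewrite /= big_seq1 scale1r andbT; split=> //.
  rewrite ins_sorted // (perm_all _ (ins_perm _ _)) /= ltn_ord pm.
  by rewrite (perm_size (ins_perm _ _)) ltnS pd.
have := @ins_diff (spb d) [::] i p.2 (spb_lin d); rewrite big_nil mul1r => h.
apply: (@spb_mono d) => //; apply: h => q1 /= hq1; apply: IHd; exact: leq_trans pd.
Qed.

Lemma pbw_span u : exists r, u = pbw r.
Proof.
have [r ->] := words_span u; rewrite /words.
pose Q u := exists r, u = pbw r; have pl : lin_closed Q.
  split; first by exists [::]; rewrite /pbw big_nil.
  move=> a _ _ [r1 ->] [s ->]; exists ([seq (a * p.1.1, p.1.2, p.2) | p <- r1] ++ s).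
  rewrite /pbw big_cat big_map /= scaler_sumr; congr (_ + _).
  by apply: eq_bigr => p _; rewrite scalerA.
apply: (@lin_closed_sum Q) => // p; apply: (@lin_closedZ Q) => //.
have [s [hs ->]] := @spb_words (size p.2) p.2 (leqnn _).
rewrite big_seq; apply: (big_ind Q) => [|v w hv hw|q qs]; first by case: pl.
  by rewrite -[v]scale1r; apply: pl.2.
apply: (@lin_closedZ Q) => //; have /and3P[qs' qm _] := allP hs _ qs.
exists [:: (1, [ffun i : 'I_k => count_mem (i : nat) q.2],
  [ffun i : 'I_l => count_mem (k + i)%N q.2])].
by rewrite /pbw big_seq1 scale1r; exact: sorted_mono.
Qed.

Section Character.
Hypothesis f_derived : basis_of (derived_alg g) f.
Variable x : 'rV[R]_k.

Definition char_fun (v : g) : R^o :=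
  \sum_(i < k) coord (cat_tuple e f) (lshift l i) v * x 0 i.

Lemma char_fun_lin : linear char_fun.
Proof.
move=> a u v; rewrite /char_fun scaler_sumr -big_split /=; apply: eq_bigr => i _.
by rewrite linearP /= mulrDl -mulrA.
Qed.

Lemma free_ef : free (cat_tuple e f).
Proof. exact: basis_free ef_basis. Qed.

Lemma char_fun_e i : char_fun (tnth e i) = x 0 i.
Proof.
have -> : tnth e i = (cat_tuple e f)`_(lshift l i).
  by rewrite /= nth_cat size_tuple ltn_ord (tnth_nth 0).
rewrite /char_fun (bigD1 i) // coord_free ?free_ef // eqxx mul1r big1 => [|i' ne]; first exact: addr0.
by rewrite coord_free ?free_ef // (inj_eq (@lshift_inj _ _)) eq_sym (negPf ne) mul0r.
Qed.

Lemma char_fun_derived v : v \in derived_alg g -> char_fun v = 0.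
Proof.
rewrite -(span_basis f_derived) => vf; apply/eqP; rewrite -(memv0 (char_fun v)).
apply: (mem_span_lin char_fun_lin) vf => _ /tnthP[i ->]; rewrite memv0.
have -> : tnth f i = (cat_tuple e f)`_(rshift k i).
  by rewrite /= nth_cat size_tuple ltnNge leq_addr addKn (tnth_nth 0).
rewrite /char_fun big1 // => i' _; rewrite coord_free ?free_ef //.
by rewrite eq_rlshift mul0r.
Qed.

Lemma exists_character : exists2 chi : U -> R^o, alg_hom chi &
  (forall i, chi (j (tnth e i)) = x 0 i) /\
  forall v, v \in derived_alg g -> chi (j v) = 0.
Proof.
have h : lie_alg_hom char_fun.
  split=> [|u v]; first exact: char_fun_lin.
  by rewrite char_fun_derived ?mem_derived // mulrC subrr.
have [chi [[ch cj] _]] := env_univ U h; exists chi => //.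
by split=> [i|v vn]; rewrite cj ?char_fun_e ?char_fun_derived.
Qed.

End Character.
End PBWSpan.

(** * Continuous seminorms *)

Section Seminorm.
Variables (R : realType) (E : lmodType R) (p : E -> R).
Hypothesis sp : seminorm p.

Lemma seminormD x y : p (x + y) <= p x + p y.
Proof. exact: sp.1. Qed.

Lemma seminormZ a x : p (a *: x) = `|a| * p x.
Proof. exact: sp.2. Qed.

Lemma seminorm0 : p 0 = 0.
Proof. by rewrite -(scale0r 0) seminormZ normr0 mul0r. Qed.

Lemma seminormN x : p (- x) = p x.
Proof. by rewrite -scaleN1r seminormZ normrN1 mul1r. Qed.

Lemma seminorm_ge0 x : 0 <= p x.
Proof.
have := seminormD x (- x); by rewrite subrr seminorm0 seminormN -mulr2n pmulrn_lge0.
Qed.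

Lemma seminormB x y : p (x - y) <= p x + p y.
Proof. by rewrite -[p y]seminormN seminormD. Qed.

Lemma seminorm_distC x y : p (x - y) = p (y - x).
Proof. by rewrite -seminormN opprB. Qed.

Lemma seminorm_dist x y : `|p x - p y| <= p (x - y).
Proof.
have h u v : p u - p v <= p (u - v) by rewrite lerBlDr -{1}(subrK v u) seminormD.
by rewrite ler_norml h lerNl opprB seminorm_distC h.
Qed.

Lemma seminorm_sum I (r : seq I) (P : pred I) (F : I -> E) :
  p (\sum_(i <- r | P i) F i) <= \sum_(i <- r | P i) p (F i).
Proof.
elim/big_rec2: _ => [|i x y _ h]; first by rewrite seminorm0.
by rewrite (le_trans (seminormD _ _)) // lerD2l.
Qed.

End Seminorm.

Definition cont_seminorm (R : realType) (E : tvsType R) (p : E -> R) :=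
  seminorm p /\ continuous p.

Section ContinuousSeminorm.
Variables (R : realType) (E : tvsType R).
Implicit Types p q : E -> R.

Lemma cont_seminorm_nbhs p (x : E) e : cont_seminorm p -> 0 < e ->
  nbhs x [set y | p (y - x) < e].
Proof.
move=> [sp cp] e0.
have h : nbhs (0 : E) [set y | p y < e].
  have := cp 0; move/cvgrPdist_lt/(_ e e0); rewrite (seminorm0 sp).
  by apply: filterS => y; rewrite sub0r normrN /= ger0_norm ?seminorm_ge0.
apply: filterS (nbhsT x h) => _ [y py <-] /=.
by rewrite [x + y]addrC addrK.
Qed.

Lemma seminorm_continuous p : seminorm p -> nbhs (0 : E) [set x | p x < 1] ->
  continuous p.
Proof.
move=> sp p1 x; apply/cvgrPdist_lt => e e0.
have en : e != 0 by rewrite gt_eqF.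
apply: filterS (nbhsT x (nbhs0Z en p1)) => _ [_ [y py <-] <-] /=.
rewrite (le_lt_trans (seminorm_dist sp _ _)) // opprD addrA subrr sub0r.
rewrite (seminormN sp) (seminormZ sp) gtr0_norm //.
by rewrite -ltr_pdivlMl // mulVf.
Qed.

Lemma seminorm_le_continuous p q : seminorm p -> cont_seminorm q ->
  (forall x, p x <= q x) -> cont_seminorm p.
Proof.
move=> sp cq pq; split=> //; apply: seminorm_continuous => //.
have := cont_seminorm_nbhs 0 cq ltr01; apply: filterS => x /=.
by rewrite subr0; apply: le_lt_trans.
Qed.

Lemma cont_seminormD p q : cont_seminorm p -> cont_seminorm q ->
  cont_seminorm (fun x => p x + q x).
Proof.
move=> [sp cp] [sq cq]; split; last first.
  by move=> x; apply: cvgD; [exact: cp|exact: cq].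
split=> [x y|a x]; first by rewrite /= addrACA lerD ?seminormD.
by rewrite /= (seminormZ sp) (seminormZ sq) mulrDr.
Qed.

Lemma cont_seminormZ (a : R) p : 0 <= a -> cont_seminorm p ->
  cont_seminorm (fun x => a * p x).
Proof.
move=> a0 [sp cp]; split; last by move=> x; apply: cvgMr; exact: cp.
split=> [x y|b x]; first by rewrite /= -mulrDr ler_wpM2l ?seminormD.
by rewrite /= (seminormZ sp) mulrCA.
Qed.

Lemma convex_nbhs (U : set E) : nbhs (0 : E) U -> exists2 W : set E,
  nbhs (0 : E) W /\ W `<=` U & forall x y (t : R), 0 <= t <= 1 -> W x -> W y ->
    W (t *: x + (1 - t) *: y).
Proof.
move=> U0; have [B Bc [Bo Bb]] := @locally_convex R E.
have [W [BW W0] WU] := Bb 0 U U0; exists W.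
  by split=> //; apply: open_nbhs_nbhs; split => //; exact: Bo.
move=> x y t /andP[t0 t1] Wx Wy.
have := Bc W (mem_set BW) x y (Itv01 t0 t1) (mem_set Wx) (mem_set Wy).
by rewrite inE.
Qed.

Section Gauge.
Variable W : set E.
Hypothesis W0 : nbhs (0 : E) W.
Hypothesis W_convex : forall x y (t : R), 0 <= t <= 1 -> W x -> W y ->
  W (t *: x + (1 - t) *: y).
Hypothesis W_sym : forall x, W x -> W (- x).

Let S x := [set t : R | 0 < t /\ W (t^-1 *: x)].
(** The Minkowski gauge of [W]. *)
Let p x := inf (S x).

Let absorb x : exists2 d : R, 0 < d & forall s, `|s| < d -> W (s *: x).
Proof.
have := @scale_continuous R E (0, x) W; rewrite /= scale0r => /(_ W0)[[A B] /= [A0 B0] AB].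
have [d /= d0 dA] := A0; exists d => // s sd.
apply: (AB (s, x)); split; last exact: nbhs_singleton.
by apply: dA; rewrite /= sub0r normrN.
Qed.

Let S_nonempty x : S x !=set0.
Proof.
have [d d0 dW] := absorb x; exists (2 / d); split; first by rewrite divr_gt0.
by apply: dW; rewrite invf_div gtr0_norm ?divr_gt0 // ltr_pdivrMr // ltr_pMr // ltr1n.
Qed.

Let S_lb x : lbound (S x) 0.
Proof. by move=> t [/ltW]. Qed.

Let S_inf x : has_inf (S x).
Proof. by split; [exact: S_nonempty|exists 0; exact: S_lb]. Qed.

Let p_le x t : S x t -> p x <= t.
Proof. by move=> St; apply: ge_inf => //; exists 0; exact: S_lb. Qed.

Let p_ge0 x : 0 <= p x.
Proof. by apply: lb_le_inf; [exact: S_nonempty|exact: S_lb]. Qed.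

Let p_approx x e : 0 < e -> exists2 t, S x t & t < p x + e.
Proof. by move=> e0; have [t St te] := inf_adherent e0 (S_inf x); exists t. Qed.

Let pD x y : p (x + y) <= p x + p y.
Proof.
apply/ler_addgt0Pr => e e0.
have e2 : 0 < e / 2 by rewrite divr_gt0.
have [t [t0 Wt] te] := p_approx x e2; have [s [s0 Ws] se] := p_approx y e2.
have ts0 : 0 < t + s by rewrite addr_gt0.
apply: (@le_trans _ _ (t + s)); last by rewrite [e]splitr addrACA ltW // ltrD.
apply: p_le; split=> //.
have h : 0 <= t / (t + s) <= 1.
  apply/andP; split; first by apply: divr_ge0; exact: ltW.
  by rewrite ler_pdivrMr // mul1r lerDl ltW.
have := W_convex h Wt Ws; congr (W _).
have -> : 1 - t / (t + s) = s / (t + s) by field; rewrite gt_eqF.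
rewrite !scalerA scalerDr; congr (_ *: _ + _ *: _); field; rewrite ?gt_eqF //.
Qed.

Let pZle a x : a != 0 -> p (a *: x) <= `|a| * p x.
Proof.
move=> a0; have na : 0 < `|a| by rewrite normr_gt0.
rewrite -ler_pdivrMl //; apply: lb_le_inf => // t [t0 Wt].
rewrite ler_pdivrMl //; apply: p_le; split; first by rewrite mulr_gt0.
rewrite scalerA; have [ap|an|] := ltrgtP 0 a; last by move=> e; rewrite e eqxx in a0.
  by rewrite gtr0_norm // invfM mulrAC mulVf // mul1r.
rewrite ltr0_norm // invfM mulrAC invrN mulNr mulVf // mulN1r scaleNr.
exact: W_sym.
Qed.

Let pZ a x : p (a *: x) = `|a| * p x.
Proof.
have [->|a0] := eqVneq a 0.
  rewrite normr0 mul0r scale0r; apply/eqP; rewrite eq_le p_ge0 andbT.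
  apply/ler_addgt0Pr => e e0; rewrite add0r; apply: p_le; split=> //.
  by rewrite scaler0; exact: nbhs_singleton.
apply/eqP; rewrite eq_le pZle //=.
have := @pZle a^-1 (a *: x); rewrite invr_eq0 scalerA mulVf // scale1r => /(_ a0).
by rewrite normfV ler_pdivlMl ?normr_gt0.
Qed.

Lemma gauge_seminorm : exists2 q : E -> R, cont_seminorm q & [set x | q x < 1] `<=` W.
Proof.
have sp : seminorm p by split; [exact: pD|exact: pZ].
exists p; last first.
  move=> x /= px; have [] := @p_approx x (1 - p x); first by rewrite subr_gt0.
  move=> t [t0 Wt]; rewrite addrC subrK => t1.
  have h : 0 <= t <= 1 by rewrite !ltW.
  have := W_convex h Wt (nbhs_singleton W0).
  by rewrite scaler0 addr0 scalerA divff ?scale1r // gt_eqF.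
split=> //; apply: seminorm_continuous => //.
have h2 : (2^-1 : R) != 0 by rewrite invr_eq0.
apply: filterS (nbhs0Z h2 W0) => _ [x Wx <-] /=.
apply: (@le_lt_trans _ _ 2^-1); last by rewrite invf_lt1 // ltr1n.
by apply: p_le; split; rewrite ?invr_gt0 // invrK scalerA divff // scale1r.
Qed.

End Gauge.

Lemma exists_cont_seminorm (U : set E) : nbhs (0 : E) U ->
  exists2 q : E -> R, cont_seminorm q & [set x | q x < 1] `<=` U.
Proof.
move=> /convex_nbhs[W [W0 WU] Wc].
have := @gauge_seminorm (W `&` [set x | W (- x)]).
case=> [||x [] //=|q cq qW].
- apply: filterI => //; apply: filterS (nbhs0N W0) => _ [x Wx <-] /=.
  by rewrite opprK.
- move=> x y t t01 [Wx Wx'] [Wy Wy']; split; first exact: Wc.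
  by rewrite /= opprD -!scalerN; exact: Wc.
- by rewrite opprK; split.
- by exists q => // x /qW[] /WU.
Qed.

Lemma nbhs_seminormP (x : E) (U : set E) : nbhs x U <->
  exists2 q : E -> R, cont_seminorm q & [set y | q (y - x) < 1] `<=` U.
Proof.
split=> [xU|[q cq qU]].
  2: by apply: filterS qU _; exact: cont_seminorm_nbhs.
have h : nbhs (0 : E) [set y | U (x + y)].
  have := nbhsB (- x) xU; rewrite addNr; apply: filterS => _ [y Uy <-] /=.
  by rewrite addrA subrr add0r.
have [q cq qU] := exists_cont_seminorm h; exists q => // y /= /qU /=.
by rewrite addrC subrK.
Qed.

End ContinuousSeminorm.

Section BilinearBound.
Variables (R : realType).

(** Seminorms may vanish, so one cannot divide by their values; one divides by numbers strictly
    above them and lets these decrease. *)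
Lemma le_mul_approx (a b z : R) : 0 <= a -> 0 <= b ->
  (forall a' b', a < a' -> b < b' -> z <= a' * b') -> z <= a * b.
Proof.
move=> a0 b0 h; apply/ler_addgt0Pr => e e0.
(* As [d <= 1], the excess [d (a + b) + d^2] is at most [d (a + b + 1)]. *)
pose d := Num.min 1 (e / (a + b + 1)).
have ab0 : 0 < a + b + 1 by rewrite ltr_wpDl ?addr_ge0.
have d0 : 0 < d by rewrite lt_min ltr01 divr_gt0.
have d1 : d <= 1 by rewrite ge_min lexx.
have de : d * (a + b + 1) <= e by rewrite -ler_pdivlMr // ge_min lexx orbT.
have := h (a + d) (b + d); rewrite !ltrDl d0 => /(_ erefl erefl) h1.
have : d * d <= d by rewrite -[leRHS]mulr1 ler_wpM2l // ltW.
by nra.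
Qed.

Lemma bilinear_seminorm (E F G : lmodType R) (b : E -> F -> G) (p : E -> R)
    (r : F -> R) (q : G -> R) :
  bilinear_map b -> seminorm p -> seminorm r -> seminorm q ->
  (forall x y, p x < 1 -> r y < 1 -> q (b x y) < 1) ->
  forall x y, q (b x y) <= p x * r y.
Proof.
move=> [bl br] sp sr sq h x y; apply: le_mul_approx; [exact: seminorm_ge0|exact: seminorm_ge0|].
move=> a c pa rc.
have a0 : 0 < a by rewrite (le_lt_trans _ pa) // seminorm_ge0.
have c0 : 0 < c by rewrite (le_lt_trans _ rc) // seminorm_ge0.
have bZl u v s : b (s *: u) v = s *: b u v.
  have := bl v s u 0; rewrite addr0 => ->; have := bl v 1 0 0.
  by rewrite !scale1r addr0 => /eqP; rewrite -subr_eq subrr => /eqP <-; rewrite addr0.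
have bZr u v s : b u (s *: v) = s *: b u v.
  have := br u s v 0; rewrite addr0 => ->; have := br u 1 0 0.
  by rewrite !scale1r addr0 => /eqP; rewrite -subr_eq subrr => /eqP <-; rewrite addr0.
have := h (a^-1 *: x) (c^-1 *: y).
rewrite (seminormZ sp) (seminormZ sr) bZl bZr !(seminormZ sq).
rewrite !gtr0_norm ?invr_gt0 //.
rewrite ![_^-1 * _ < 1]ltr_pdivrMl // !mulr1 => /(_ pa rc).
by rewrite ltr_pdivrMl // [a * c]mulrC => /ltW.
Qed.

End BilinearBound.

Section MulBound.
Variables (R : realType) (A : lcAlgType R).
Hypothesis mul_cont : continuous (fun xy : A * A => xy.1 * xy.2).

Lemma mul_seminorm (q : A -> R) : cont_seminorm q ->
  exists2 p, cont_seminorm p & forall x y, q (x * y) <= p x * p y.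
Proof.
move=> cq; have := @mul_cont (0, 0) [set z | q z < 1].
rewrite /= mul0r => /(_ _)[|[U V] /= [U0 V0] UV].
  by have := cont_seminorm_nbhs 0 cq ltr01; apply: filterS => z /=; rewrite subr0.
have [p1 c1 pU] := exists_cont_seminorm U0.
have [p2 c2 pV] := exists_cont_seminorm V0.
have c12 := cont_seminormD c1 c2.
exists (fun x => p1 x + p2 x) => //.
apply: (bilinear_seminorm (b := fun x y : A => x * y)); rewrite ?c12.1 ?cq.1 //.
- split=> [y a u v|x a u v] /=; first by rewrite mulrDl scalerAl.
  by rewrite mulrDr scalerAr.
- by case: c12.
- by case: c12.
- by case: cq.
move=> x y px py; apply: (UV (x, y)); split; [apply: pU|apply: pV] => /=.
  by apply: le_lt_trans px; rewrite lerDl; apply: seminorm_ge0; case: c2.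
by apply: le_lt_trans py; rewrite lerDr; apply: seminorm_ge0; case: c1.
Qed.

End MulBound.

(** * Bounded functions with the supremum norm *)

Section BoundedFunctions.
Variables (R : realType) (S : Type).

Definition bounded_pred : {pred S -> R^o} :=
  fun f => `[< exists M, forall s, `|f s| <= M >].

Lemma bounded_predP f : reflect (exists M, forall s, `|f s| <= M) (f \in bounded_pred).
Proof. exact: asboolP. Qed.

Fact bounded_submod : submod_closed bounded_pred.
Proof.
split; first by apply/bounded_predP; exists 0 => s; rewrite normr0.
move=> a f g /bounded_predP[M fM] /bounded_predP[N gN]; apply/bounded_predP.
exists (`|a| * M + N) => s; rewrite (le_trans (ler_normD _ _)) // lerD //.
by rewrite normrM ler_wpM2l.
Qed.

HB.instance Definition _ := GRing.isSubmodClosed.Build _ _ bounded_pred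
  bounded_submod.

(** The Banach space to which the universal property of the tensor product is applied: pulling back
    its norm produces continuous seminorms on the tensor product. *)
Record bfun := BFun { bfun_val :> S -> R^o; _ : bfun_val \in bounded_pred }.
HB.instance Definition _ := [isSub for bfun_val].
HB.instance Definition _ := [Choice of bfun by <:].
HB.instance Definition _ := [SubChoice_isSubLmodule of bfun by <:].

Let vals (f : bfun) := [set `|f s| | s in [set: S]].

(* Adjoining [0] keeps the set nonempty when [S] is empty. *)
Definition bfun_norm (f : bfun) : R := sup ([set 0] `|` vals f).

Let has_sup_vals f : has_sup ([set 0] `|` vals f).
Proof.
split; first by exists 0; left.
have /bounded_predP[M fM] : (f : S -> R^o) \in bounded_pred by case: f.
exists `|M| => _ [->|[s _ <-]] //; exact: le_trans (fM s) (ler_norm _).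
Qed.

Lemma bfun_norm_ge0 f : 0 <= bfun_norm f.
Proof. by apply: ub_le_sup; [have [] := has_sup_vals f|left]. Qed.

Lemma bfun_norm_ge (f : bfun) s : `|f s| <= bfun_norm f.
Proof. by apply: ub_le_sup; [have [] := has_sup_vals f|right; exists s]. Qed.

Lemma bfun_norm_le (f : bfun) M : 0 <= M -> (forall s, `|f s| <= M) -> bfun_norm f <= M.
Proof.
move=> M0 fM; apply: ge_sup; first by exists 0; left.
by move=> _ [->|[s _ <-]].
Qed.

Fact bfun_normD f g : bfun_norm (f + g) <= bfun_norm f + bfun_norm g.
Proof.
apply: bfun_norm_le => [|s]; first by rewrite addr_ge0 ?bfun_norm_ge0.
by rewrite (le_trans (ler_normD _ _)) // lerD ?bfun_norm_ge.
Qed.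

Let bfun_normZle (a : R) f : bfun_norm (a *: f) <= `|a| * bfun_norm f.
Proof.
apply: bfun_norm_le => [|s]; first by rewrite mulr_ge0 ?bfun_norm_ge0.
by rewrite normrM ler_wpM2l ?bfun_norm_ge.
Qed.

Fact bfun_normZ (a : R) f : bfun_norm (a *: f) = `|a| * bfun_norm f.
Proof.
have [->|a0] := eqVneq a 0.
  rewrite scale0r normr0 mul0r; apply/eqP; rewrite eq_le bfun_norm_ge0 andbT.
  by apply: bfun_norm_le => // s; rewrite normr0.
apply/eqP; rewrite eq_le bfun_normZle /=.
have := bfun_normZle a^-1 (a *: f); rewrite scalerA mulVf // scale1r normfV.
by rewrite ler_pdivlMl ?normr_gt0.
Qed.

Fact bfun_norm0_eq0 f : bfun_norm f = 0 -> f = 0.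
Proof.
move=> f0; apply: val_inj; apply/funext => s; apply/eqP.
by rewrite -normr_le0 -f0 bfun_norm_ge.
Qed.

HB.instance Definition _ := Lmodule_isNormed.Build R bfun
  bfun_normD bfun_normZ bfun_norm0_eq0.

Lemma bfun_complete : lc_complete bfun.
Proof.
move=> F PF cF.
have cF' e : 0 < e -> exists2 U, F U & forall f g : bfun, U f -> U g ->
    bfun_norm (f - g) < e.
  move=> e0; have := cF [set f | bfun_norm f < e].
  case=> [|[U V] /= [FU FV] UV].
    have := @nbhsx_ballx _ bfun 0 _ e0; apply: filterS => f.
    by rewrite -ball_normE /ball_ /= sub0r normrN.
  exists (U `&` V); first exact: filterI.
  by move=> f g [Uf _] [_ Vg]; exact: (UV (f, g)).
have cs (s : S) : exists l : R, (fun f : bfun => f s) @ F --> l.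
  apply/cvg_ex; apply: cauchy_cvg; apply/cauchy_ballP => e e0.
  have [U FU hU] := cF' e e0.
  exists ((fun f : bfun => f s) @` U, (fun f : bfun => f s) @` U) => /=.
    by split; apply: (@filterS _ F _ U) FU => f Uf; exists f.
  move=> [_ _] /= [[f Uf <-] [g Ug <-]]; rewrite -ball_normE /ball_ /=.
  by apply: le_lt_trans (hU f g Uf Ug); exact: (bfun_norm_ge (f - g) s).
have [L hL] := choice cs.
(* Pointwise convergence to [L] is uniform: all members of a set of the filter with diameter below
   [e] are within [e] of [L] everywhere. *)
have hLU e (U : set bfun) : 0 < e -> F U ->
    (forall f g : bfun, U f -> U g -> bfun_norm (f - g) < e) ->
    forall f, U f -> forall s, `|f s - L s| <= e.
  move=> e0 FU hU f Uf s; apply/ler_addgt0Pr => d d0.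
  have /cvgrPdist_lt/(_ d d0) hd := hL s.
  have [g [/= gd Ug]] := filter_ex (filterI hd FU).
  have -> : f s - L s = (f - g) s - (L s - g s).
    by rewrite -[(f - g) s]/(f s - g s) opprB addrA subrK.
  rewrite (le_trans (ler_normB _ _)) // lerD // ltW //.
  by apply: le_lt_trans (hU f g Uf Ug); exact: bfun_norm_ge.
have Lb : (L : S -> R^o) \in bounded_pred.
  have [U FU hU] := cF' 1 ltr01; have [f Uf] := filter_ex FU.
  apply/bounded_predP; exists (bfun_norm f + 1) => s.
  have -> : L s = f s - (f s - L s) by rewrite subKr.
  by rewrite (le_trans (ler_normB _ _)) // lerD ?bfun_norm_ge // (hLU 1 U).
exists (BFun Lb) => U /nbhs_ballP[e /= e0 eU].
have e2 : 0 < e / 2 by rewrite divr_gt0.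
have [V FV hV] := cF' _ e2; apply: filterS (FV) => f Vf; apply: eU.
rewrite -ball_normE /ball_ /=; apply: (@le_lt_trans _ _ (e / 2)).
  apply: bfun_norm_le; first exact: ltW.
  by move=> s; rewrite -[(BFun Lb - f) s]/(L s - f s) distrC; exact: (hLU _ V).
by rewrite ltr_pdivrMr // ltr_pMr // ltr1n.
Qed.

Lemma bfun_hausdorff : hausdorff_space bfun.
Proof. exact: norm_hausdorff. Qed.

End BoundedFunctions.

(** * The topologies of smooth functions and of formal power series *)

Lemma initial_cvg (S : choiceType) (T : topologicalType) (f : S -> T)
    (F : set_system S) (s : S) : Filter F -> f @ F --> f s ->
  F --> (s : initial_topology f).
Proof.
move=> FF h A [_ [[B Bop <-] Bs sBA]]; apply: filterS sBA _; apply: h.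
exact: open_nbhs_nbhs.
Qed.

Lemma prod_topology_cvg (I : Type) (K : I -> topologicalType)
    (F : set_system (prod_topology K)) (f : prod_topology K) : Filter F ->
  (forall i, (fun g : prod_topology K => g i) @ F --> f i) -> F --> f.
Proof.
by move=> FF h; apply/cvg_sup => i; apply: initial_cvg; exact: h.
Qed.

Section SmoothTopology.
Variables (R : realType) (k : nat).
Local Notation V := 'rV[R]_k.
Implicit Types (f g : V -> R^o) (s : seq 'I_k).

Definition cube (c : R) : set V := [set x | forall i, `|x 0 i| <= c].

Definition jet_le n (c : R) f (M : R) :=
  forall s x, (size s <= n)%N -> cube c x -> `|iter_partial s f x| <= M.

Lemma ler_mx_coord (x : V) i j : `|x i j| <= `|x|.
Proof.
rewrite [leRHS]/Num.Def.normr /= mx_normrE.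
exact: (le_bigmax _ (fun ij : 'I_1 * 'I_k => `|x ij.1 ij.2|) (i, j)).
Qed.

Lemma cube_compact c : compact (cube c).
Proof.
have -> : cube c = [set x : V | forall i, `[- c, c]%classic (x 0 i)].
  apply/seteqP; split=> x /= h i; first by rewrite in_itv /= -ler_norml h.
  by have := h i; rewrite in_itv /= -ler_norml.
by apply: (@rV_compact _ _ (fun=> `[(- c), c]%classic)) => i; exact: segment_compact.
Qed.

Lemma cube_mono c d : c <= d -> cube c `<=` cube d.
Proof. by move=> cd x xc i; exact: le_trans (xc i) cd. Qed.

Lemma jet_bounded n c (f : smooth R k) : exists M, jet_le n c f M.
Proof.
have h s : exists M, forall x, cube c x -> `|iter_partial s f x| <= M.
  have /smooth_predP sf : (f : V -> R^o) \in @smooth_pred R k by case: f.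
  have [cf _] := sf s.
  have := continuous_compact (continuous_subspaceT cf) (@cube_compact c).
  move=> /compact_bounded[M [_ hM]]; exists (M + 1) => x xc.
  by apply: (hM (M + 1)); [rewrite ltrDl|exists x].
have [M hM] := choice h.
exists (\sum_(s : {bseq n of 'I_k}) `|M s|) => s x sn xc.
rewrite (bigD1 (Bseq sn)) //= (le_trans (hM s x xc)) // (le_trans (ler_norm _)) //.
by rewrite lerDl sumr_ge0.
Qed.

Lemma jetB s (f g : smooth R k) x :
  iter_partial s (smooth_fun (g - f)) x = iter_partial s g x - iter_partial s f x.
Proof.
have /smooth_predP sf : (f : V -> R^o) \in @smooth_pred R k by case: f.
have /smooth_predP sg : (g : V -> R^o) \in @smooth_pred R k by case: g.
have -> : ((smooth_fun (g - f)) : V -> R^o) = (- 1) *: (f : V -> R^o) + (g : V -> R^o).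
  by apply/funext => y; rewrite scaleN1r addrC.
by rewrite iter_partial_linear // scaleN1r addrC.
Qed.

Lemma smooth_cvg (F : set_system (smooth R k)) (f : smooth R k) : Filter F ->
  (forall n e, 0 < e -> F [set g : smooth R k | jet_le n n%:R (smooth_fun (g - f)) e]) -> F --> f.
Proof.
move=> FF h; apply: initial_cvg; apply: prod_topology_cvg => s.
apply/fam_cvgP => K cK P /= /uniform_nbhs[E [/= entE EP]].
have [e e0 eE] : exists2 e, 0 < e & forall a b : R^o, `|a - b| < e -> E (a, b).
  by have [e e0 eE] := entE; exists e => // a b ab; apply: eE.
have [n sn Kn] : exists2 n, (size s <= n)%N & K `<=` cube n%:R.
  have := compact_bounded cK => -[M [_ hM]].
  exists (maxn (size s) (Num.truncn `|M + 1|).+1); first exact: leq_maxl.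
  move=> x Kx i; apply: (@le_trans _ _ (M + 1)).
    apply: le_trans (hM (M + 1) _ x Kx); last by rewrite ltrDl.
    by have := ler_mx_coord x 0 i.
  rewrite (le_trans (ler_norm _)) // ltW // (lt_le_trans (truncnS_gt _)) //.
  by rewrite ler_nat leq_maxr.
have e2 : 0 < e / 2 by rewrite divr_gt0.
apply: (@filterS _ F _ _ _ _ (h n (e / 2) e2)).
move=> g gf; apply: EP => x Kx; apply: eE.
have := gf s x sn (Kn x Kx).
rewrite jetB => h1; rewrite distrC; apply: le_lt_trans h1 _.
by rewrite ltr_pdivrMr // ltr_pMr // ltr1n.
Qed.

(** The sets of functions with small jets generate a filter [F], and the convergence of [F] to 0
    says exactly that every neighbourhood of 0 contains one of them. *)
Lemma nbhs0_smooth (U : set (smooth R k)) : nbhs (0 : smooth R k) U ->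
  exists n, exists2 d, 0 < d & forall f : smooth R k, jet_le n n%:R f d -> U f.
Proof.
pose F : set_system (smooth R k) := fun U => exists n, exists2 d, 0 < d &
  forall f : smooth R k, jet_le n n%:R f d -> U f.
have FF : Filter F.
  split.
  - by exists 0%N, 1.
  - move=> A B [n [d d0 hA]] [m [e e0 hB]]; exists (maxn n m), (Num.min d e).
      by rewrite lt_min d0.
    move=> f hf; split; [apply: hA|apply: hB] => s x sn xc.
      apply: le_trans (hf s x _ _) _; first by rewrite leq_max sn.
        by apply: cube_mono xc; rewrite ler_nat leq_maxl.
      by rewrite ge_min lexx.
    apply: le_trans (hf s x _ _) _; first by rewrite leq_max sn orbT.
      by apply: cube_mono xc; rewrite ler_nat leq_maxr.
    by rewrite ge_min lexx orbT.
  - by move=> A B AB [n [d d0 hA]]; exists n, d => // f /hA /AB.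
have : F --> (0 : smooth R k).
  apply: smooth_cvg => n e e0; by exists n, e => // f /=; rewrite subr0.
by move=> h hU; exact: (h U hU).
Qed.

Lemma nbhs_smooth (f : smooth R k) n e : 0 < e ->
  nbhs f [set g : smooth R k | jet_le n n%:R (smooth_fun (g - f)) e].
Proof.
move=> e0.
have h s : nbhs f [set g : smooth R k | forall x, cube n%:R x ->
    `|iter_partial s (smooth_fun (g - f)) x| <= e].
  have := @initial_continuous _ _ (@jet R k) f.
  have := @proj_continuous _ (fun _ : seq 'I_k => {family compact, V -> R^o}) s (jet f).
  move=> hp hj; have {hp hj} := continuous_comp hj hp.
  rewrite /continuous_at => /fam_cvgP/(_ _ (@cube_compact n%:R)) hc.
  have h0 : nbhs (proj s (jet f) : {uniform` (cube n%:R) -> R^o})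
      [set h : {uniform` (cube n%:R) -> R^o} |
        forall x, cube n%:R x -> `|iter_partial s f x - h x| < e].
    apply/uniform_nbhs; exists [set ab : R^o * R^o | `|ab.1 - ab.2| < e]; split=> //.
    by exists e.
  have hF : Filter (nbhs ((proj s \o jet (k:=k)) x @[x --> f])).
    by rewrite nbhs_filterE; apply: fmap_filter; exact: nbhs_filter.
  apply: (@filterS _ (nbhs f) _ _ _ _ (hc hF _ h0)) => g hg x xc.
  by rewrite jetB distrC ltW //; exact: hg.
(* Words of length at most [n] form a finite type, so a finite intersection of neighbourhoods is
   enough. *)
have hn := @filter_forall _ {bseq n of 'I_k} _ (nbhs f) _ (fun t => h t).
have {}hn : nbhs f [set g : smooth R k | forall t : {bseq n of 'I_k}, forall x, cube n%:R x ->
    `|iter_partial t (smooth_fun (g - f)) x| <= e] by exact: hn.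
by apply: filterS hn => g hg s x sn xc; exact: (hg (Bseq sn) x xc).
Qed.

End SmoothTopology.

Section FpsTopology.
Variables (R : realType) (l : nat).
Implicit Types (s : fps R l) (be : {ffun 'I_l -> nat}).

Definition index_le n be := forall j, (be j <= n)%N.

Definition fps_le n s (N : R) := forall be, index_le n be -> `|s be| <= N.

Let trunc n be : {ffun 'I_l -> 'I_n.+1} := [ffun j => inord (be j)].
Let untrunc n (be : {ffun 'I_l -> 'I_n.+1}) : {ffun 'I_l -> nat} := [ffun j => be j : nat].

Let truncK n be : index_le n be -> untrunc (trunc n be) = be.
Proof. by move=> h; apply/ffunP => j; rewrite !ffunE inordK // ltnS. Qed.

Lemma fps_bounded n s : exists N, fps_le n s N.
Proof.
exists (\sum_(be : {ffun 'I_l -> 'I_n.+1}) `|s (untrunc be)|) => be hbe.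
by rewrite (bigD1 (trunc n be)) //= truncK // lerDl sumr_ge0.
Qed.

Lemma nbhs0_fps (U : set (fps R l)) : nbhs (0 : fps R l) U ->
  exists n, exists2 d, 0 < d & forall s, fps_le n s d -> U s.
Proof.
pose F : set_system (fps R l) := fun U => exists n, exists2 d, 0 < d &
  forall s, fps_le n s d -> U s.
have FF : Filter F.
  split.
  - by exists 0%N, 1.
  - move=> A B [n [d d0 hA]] [m [e e0 hB]]; exists (maxn n m), (Num.min d e).
      by rewrite lt_min d0.
    move=> s hs; split; [apply: hA|apply: hB] => be hbe.
      apply: le_trans (hs be _) _; last by rewrite ge_min lexx.
      by move=> j; rewrite (leq_trans (hbe j)) ?leq_maxl.
    apply: le_trans (hs be _) _; last by rewrite ge_min lexx orbT.
    by move=> j; rewrite (leq_trans (hbe j)) ?leq_maxr.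
  - by move=> A B AB [n [d d0 hA]]; exists n, d => // f /hA /AB.
have : F --> (0 : fps R l).
  apply: prod_topology_cvg => be A /nbhs_ballP[e /= e0 eA].
  exists (\max_j be j)%N, (e / 2); first by rewrite divr_gt0.
  move=> s hs; apply: eA; rewrite -ball_normE /ball_ /= sub0r normrN.
  apply: le_lt_trans (hs be _) _; first by move=> j; exact: leq_bigmax.
  by rewrite ltr_pdivrMr // ltr_pMr // ltr1n.
by move=> h hU; exact: (h U hU).
Qed.

Lemma nbhs_fps s n e : 0 < e -> nbhs s [set s' | fps_le n (s' - s) e].
Proof.
move=> e0.
have h (be : {ffun 'I_l -> nat}) : nbhs s [set s' : fps R l | `|s' be - s be| <= e].
  have hc := @proj_continuous _ (fun _ : {ffun 'I_l -> nat} => R^o) be s.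
  have hb : nbhs (s be : R^o) [set y : R^o | `|y - s be| <= e].
    by apply: filterS (nbhsx_ballx (s be : R^o) e e0) => y; rewrite -ball_normE /= distrC => /ltW.
  exact: (hc _ hb).
have hn := @filter_forall _ {ffun 'I_l -> 'I_n.+1} _ (nbhs s) _ (fun b => h (@untrunc n b)).
have {}hn : nbhs s [set s' : fps R l | forall be : {ffun 'I_l -> 'I_n.+1},
  `|s' (untrunc be) - s (untrunc be)| <= e] by exact: hn.
apply: filterS hn => s' hs be hbe; rewrite -(truncK hbe); exact: hs.
Qed.

End FpsTopology.

(** * The seminorms of the tensor product *)

Section LinearMaps.
Variables (R : realType) (E F : lmodType R) (f : E -> F).
Hypothesis fL : linear f.
Let f' : {linear E -> F} := HB.pack f (GRing.isLinear.Build R E F _ f fL).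

Lemma linear_fun0 : f 0 = 0.
Proof. exact: (linear0 f'). Qed.

Lemma linear_funZ a x : f (a *: x) = a *: f x.
Proof. exact: (linearZ_LR f'). Qed.

Lemma linear_funD x y : f (x + y) = f x + f y.
Proof. exact: (linearD f'). Qed.

Lemma linear_funB x y : f (x - y) = f x - f y.
Proof. exact: (linearB f'). Qed.

Lemma linear_fun_sum I (r : seq I) (P : pred I) (F0 : I -> E) :
  f (\sum_(i <- r | P i) F0 i) = \sum_(i <- r | P i) f (F0 i).
Proof. exact: (linear_sum f'). Qed.

End LinearMaps.

Section Jets.
Variables (R : realType) (k : nat).
Local Notation V := 'rV[R]_k.

Lemma jet_linear (s : seq 'I_k) (x : V) :
  linear (fun f : smooth R k => iter_partial s f x : R^o).
Proof.
move=> a f g.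
have /smooth_predP sf : (f : V -> R^o) \in @smooth_pred R k by case: f.
have /smooth_predP sg : (g : V -> R^o) \in @smooth_pred R k by case: g.
by rewrite -[RHS]/((a *: iter_partial s f + iter_partial s g) x) -iter_partial_linear.
Qed.

Lemma jet_sum I (r : seq I) (P : pred I) (F : I -> smooth R k) (s : seq 'I_k) (x : V) :
  iter_partial s (\sum_(i <- r | P i) F i : smooth R k) x =
  \sum_(i <- r | P i) iter_partial s (F i) x.
Proof. exact: (linear_fun_sum (jet_linear s x)). Qed.

Lemma jetZ a (f : smooth R k) s x :
  iter_partial s (a *: f : smooth R k) x = a * iter_partial s f x.
Proof. exact: (linear_funZ (jet_linear s x)). Qed.

Lemma jetD (f g : smooth R k) s x :
  iter_partial s (f + g : smooth R k) x = iter_partial s f x + iter_partial s g x.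
Proof. exact: (linear_funD (jet_linear s x)). Qed.

Lemma jet_leZ n c (a : R) (f : smooth R k) M : jet_le n c f M ->
  jet_le n c (a *: f : smooth R k) (`|a| * M).
Proof. by move=> h s x sn xc; rewrite jetZ normrM ler_wpM2l // h. Qed.

Lemma jet_le_mono n m c d (f : V -> R^o) M M' : (n <= m)%N -> c <= d -> M <= M' ->
  jet_le m d f M -> jet_le n c f M'.
Proof.
move=> nm cd MM h s x sn xc; apply: le_trans (h s x _ _) MM; first exact: leq_trans nm.
exact: cube_mono xc.
Qed.

End Jets.

Section TensorSeminorms.
Variables (R : realType) (k l : nat) (T : tvsType R).
Variable t : smooth R k -> fps R l -> T.
Hypothesis tP : complete_projective_tensor t.
Local Notation V := 'rV[R]_k.

Lemma tens_lin_l s : linear (t^~ s).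
Proof. by case: tP => _ _ []. Qed.

Lemma tens_lin_r f : linear (t f).
Proof. by case: tP => _ _ []. Qed.

Lemma tens0r f : t f 0 = 0.
Proof. exact: (linear_fun0 (tens_lin_r f)). Qed.

Lemma tensZl a f s : t (a *: f) s = a *: t f s.
Proof. exact: (linear_funZ (tens_lin_l s)). Qed.

Lemma tensZr a f s : t f (a *: s) = a *: t f s.
Proof. exact: (linear_funZ (tens_lin_r f)). Qed.

Lemma tens_suml I (r : seq I) (P : pred I) (F : I -> smooth R k) s :
  t (\sum_(i <- r | P i) F i) s = \sum_(i <- r | P i) t (F i) s.
Proof. exact: (linear_fun_sum (tens_lin_l s)). Qed.

Lemma tens_bound (q : T -> R) : cont_seminorm q -> exists n, exists2 C, 0 <= C &
  forall (f : smooth R k) (s : fps R l) (M N : R), 0 <= M -> 0 <= N ->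
    jet_le n n%:R f M -> fps_le n s N ->
    q (t f s) <= C * (M * N).
Proof.
move=> cq; have [_ _ _ ct _] := tP.
have := ct (0, 0) [set z | q z < 1]; rewrite /= tens0r => /(_ _)[|[U W] /= [U0 W0] UW].
  by have := cont_seminorm_nbhs 0 cq ltr01; apply: filterS => z /=; rewrite subr0.
have [n [d d0 hU]] := nbhs0_smooth U0; have [m [e e0 hW]] := nbhs0_fps W0.
exists (maxn n m), (d^-1 * e^-1) => [|f s M N M0 N0 fM sN].
  by rewrite mulr_ge0 ?invr_ge0 ?ltW.
rewrite -invfM mulrC ler_pdivlMr ?mulr_gt0 //.
apply: le_mul_approx => // M' N' MM' NN'.
have M'0 : 0 < M' by exact: le_lt_trans MM'.
have N'0 : 0 < N' by exact: le_lt_trans NN'.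
have := UW ((d / M') *: f, (e / N') *: s).
have h1 : U ((d / M') *: f).
  apply: hU; apply: (@jet_le_mono _ _ _ (maxn n m) _ (maxn n m)%:R _ (`|d / M'| * M)).
  - exact: leq_maxl.
  - by rewrite ler_nat leq_maxl.
  - rewrite gtr0_norm ?divr_gt0 // mulrAC ler_pdivrMr // ler_wpM2l ?ltW //.
  - exact: jet_leZ.
have h2 : W ((e / N') *: s).
  apply: hW => be hbe; rewrite normrM gtr0_norm ?divr_gt0 // mulrAC ler_pdivrMr //.
  apply: ler_wpM2l; first exact: ltW.
  apply: le_trans (ltW NN'); apply: sN => j; exact: leq_trans (hbe j) (leq_maxr _ _).
rewrite /= tensZl tensZr !(seminormZ cq.1) => /(_ (conj h1 h2)).
rewrite !gtr0_norm ?divr_gt0 // mulrA => h3; apply: ltW.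
have := h3; rewrite -[in X in X -> _](ltr_pM2l (mulr_gt0 M'0 N'0)) mulr1; congr (_ < _).
by field; rewrite !gt_eqF.
Qed.

Section Seminorm.
Variable n : nat.
Let S := (seq 'I_k * V * {ffun 'I_l -> nat})%type.
Let inS (z : S) := [/\ (size z.1.1 <= n)%N, cube n%:R z.1.2 & index_le n z.2].

(** The jets of [f] times the coefficients of [s], cut off to finitely many orders, exponents and a
    compact cube so that they are bounded. *)
Let ev (f : smooth R k) (s : fps R l) : S -> R^o :=
  fun z => if `[< inS z >] then iter_partial z.1.1 f z.1.2 * s z.2 else 0.

Let ev_le (f : smooth R k) (s : fps R l) (M N : R) z : 0 <= M -> 0 <= N -> jet_le n n%:R f M -> fps_le n s N ->
  `|ev f s z| <= M * N.
Proof.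
move=> M0 N0 fM sN; rewrite /ev; case: asboolP => [[zs zx zb]|_].
  by rewrite normrM ler_pM // ?fM ?sN.
by rewrite normr0 mulr_ge0.
Qed.

Let jet_bounded0 (f : smooth R k) : exists2 M, 0 <= M & jet_le n n%:R f M.
Proof.
have [M fM] := jet_bounded n n%:R f; exists `|M| => //.
by apply: jet_le_mono fM => //; exact: ler_norm.
Qed.

Let fps_bounded0 (s : fps R l) : exists2 N, 0 <= N & fps_le n s N.
Proof.
have [N sN] := fps_bounded n s; exists `|N| => // be hbe.
exact: le_trans (sN _ hbe) (ler_norm _).
Qed.

Let ev_bounded f s : ev f s \in @bounded_pred R S.
Proof.
have [M M0 fM] := jet_bounded0 f; have [N N0 sN] := fps_bounded0 s.
by apply/bounded_predP; exists (M * N) => z; exact: ev_le.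
Qed.

Let evb f s : bfun R S := BFun (ev_bounded f s).

Let evb_bilinear : bilinear_map evb.
Proof.
split=> [s a f g|f a s s']; apply: val_inj; apply/funext => z;
  rewrite -[RHS]/(a * ev _ _ z + ev _ _ z) /= /ev; case: ifP => _; rewrite ?mulr0 ?addr0 //.
  by rewrite (jetD (a *: f) g) jetZ mulrDl -mulrA.
by rewrite mulrDr mulrCA.
Qed.

Let evb_continuous : continuous (fun xy : smooth R k * fps R l => evb xy.1 xy.2).
Proof.
move=> [f0 s0]; apply/cvgrPdist_le => e e0 /=.
have [M M0 fM] := jet_bounded0 f0; have [N N0 sN] := fps_bounded0 s0.
pose d := Num.min 1 (e / (M + N + 1)).
have MN0 : 0 < M + N + 1 by rewrite ltr_wpDl ?addr_ge0.
have d0 : 0 < d by rewrite lt_min ltr01 divr_gt0.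
have d1 : d <= 1 by rewrite ge_min lexx.
have de : d * (M + N + 1) <= e by rewrite -ler_pdivlMr // ge_min lexx orbT.
exists ([set g : smooth R k | jet_le n n%:R (smooth_fun (g - f0)) d], [set s | fps_le n (s - s0) d]).
  by split; [exact: nbhs_smooth|exact: nbhs_fps].
move=> [f s] [hf0 hs0].
have hf : jet_le n n%:R (smooth_fun (f - f0)) d := hf0.
have hs : fps_le n (s - s0) d := hs0.
rewrite {hf0 hs0} -[X in `|X|]/(evb f0 s0 - evb f s).
have -> : evb f0 s0 - evb f s = - (evb (f - f0) (s - s0) + evb (f - f0) s0 + evb f0 (s - s0)).
  apply: val_inj; apply/funext => z.
  rewrite -[LHS]/(ev f0 s0 z - ev f s z).
  rewrite -[RHS]/(- (ev (f - f0) (s - s0) z + ev (f - f0) s0 z + ev f0 (s - s0) z)).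
  rewrite /ev; case: ifP => _; last by rewrite subr0 !addr0 oppr0.
  by rewrite !jetB -[(s - s0) z.2]/(s z.2 - s0 z.2); ring.
rewrite normrN; apply: bfun_norm_le => [|z]; first exact: ltW.
rewrite -[X in `|X|]/(ev (f - f0) (s - s0) z + ev (f - f0) s0 z + ev f0 (s - s0) z).
apply: le_trans (ler_normD _ _) _.
have h1 := @ev_le _ _ _ _ z (ltW d0) (ltW d0) hf hs.
have h2 := @ev_le _ _ _ _ z (ltW d0) N0 hf sN.
have h3 := @ev_le _ _ _ _ z M0 (ltW d0) fM hs.
have h4 := ler_normD (ev (f - f0) (s - s0) z) (ev (f - f0) s0 z).
have : d * d <= d by rewrite -[leRHS]mulr1 ler_wpM2l // ltW.
by nra.
Qed.

(** The supremum norm pulled back along the linear map induced by [evb]. On a finite sum of tensors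
    it is the largest jet of its coefficients, which the two inequalities characterise. *)
Lemma exists_jet_seminorm : exists2 p : T -> R, cont_seminorm p &
  forall I (r : seq I) (f : I -> smooth R k) (s : I -> fps R l),
  let a := \sum_(i <- r) t (f i) (s i) in
  let c be ga x := \sum_(i <- r) iter_partial ga (f i) x * s i be in
  (forall be ga x, index_le n be -> (size ga <= n)%N -> cube n%:R x -> `|c be ga x| <= p a) /\
  forall M, 0 <= M ->
    (forall be ga x, index_le n be -> (size ga <= n)%N -> cube n%:R x -> `|c be ga x| <= M) ->
    p a <= M.
Proof.
have [_ _ _ _ univ] := tP.
have [L [[linL contL Lt] _]] := univ _ evb (@bfun_hausdorff R S) (@bfun_complete R S)
  evb_bilinear evb_continuous.
exists (fun a => bfun_norm (L a)).
  split; first split=> [x y|a x].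
  - by rewrite (linear_funD linL); exact: bfun_normD.
  - by rewrite (linear_funZ linL); exact: bfun_normZ.
  - move=> x; exact: (continuous_comp (contL x) (@norm_continuous _ (bfun R S) (L x))).
move=> I r f s a c.
have Lc z : L a z = if `[< inS z >] then c z.2 z.1.1 z.1.2 else 0.
  pose evz (h : bfun R S) : R^o := h z.
  have evz_lin : linear evz by [].
  rewrite /a (linear_fun_sum linL) -[LHS]/(evz (\sum_(i <- r) L (t (f i) (s i)))).
  rewrite (linear_fun_sum evz_lin) /c; under eq_bigr => i _ do rewrite Lt.
  rewrite -[LHS]/(\sum_(i <- r) ev (f i) (s i) z) /ev.
  by case: asboolP => // _; rewrite big1.
split=> [be ga x hbe hga hx|M M0 hM].
  by have := bfun_norm_ge (L a) (ga, x, be); rewrite Lc; case: asboolP => // -[]; split.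
apply: bfun_norm_le => // z; rewrite Lc; case: asboolP => [[z1 z2 z3]|_]; first exact: hM.
by rewrite normr0.
Qed.

End Seminorm.
End TensorSeminorms.

(** * Seminorms, characters and the augmentation ideal of a realization *)

Section DominatingSeminorms.
Variables (R : realType) (E : tvsType R).

Lemma dense_le (D : set E) (F G : E -> R) : dense D -> continuous F -> continuous G ->
  (forall x, D x -> F x <= G x) -> forall x, F x <= G x.
Proof.
move=> dD cF cG FG x; rewrite leNgt; apply/negP => GF.
have cFG : continuous (fun x => F x - G x).
  by move=> y; apply: cvgB; [exact: cF|exact: cG].
have [||y [/= yO Dy]] := dD ((fun x => F x - G x) @^-1` [set y | 0 < y]).
- by exists x; rewrite /= subr_gt0.
- by apply: open_comp; [move=> y _; exact: cFG|exact: open_gt].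
- by move: yO; rewrite subr_gt0 ltNge FG.
Qed.

Lemma dominating_determines (p : nat -> E -> R) : (forall n, cont_seminorm (p n)) ->
  (forall q, cont_seminorm q -> exists n, exists2 C, 0 <= C & forall x, q x <= C * p n x) ->
  determines_topology p.
Proof.
move=> cp dom; split=> [i|U]; first by case: (cp i).
split=> [/exists_cont_seminorm[q cq qU]|[s _ [eps e0 sU]]].
  have [n [C C0 qC]] := dom q cq; exists [:: n] => //; exists (C + 1)^-1.
    by rewrite invr_gt0 ltr_wpDl.
  move=> x /= /(_ n (mem_head _ _)) px; apply: qU; apply: le_lt_trans (qC x) _.
  have C1 : 0 < C + 1 by rewrite ltr_wpDl.
  have px0 := seminorm_ge0 (cp n).1 x.
  rewrite -[ltRHS](mulfV (lt0r_neq0 C1)); apply: le_lt_trans (_ : (C + 1) * p n x < _).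
    by rewrite ler_wpM2r // lerDl.
  by rewrite ltr_pM2l.
apply: filterS sU _; elim: s => [|i s IHs]; first by apply: filterS filterT => x _ i.
have := cont_seminorm_nbhs 0 (cp i) e0; move=> /(filterI IHs); apply: filterS => x /= [hs].
rewrite subr0 => hi j; rewrite inE => /predU1P[->//|]; exact: hs.
Qed.

End DominatingSeminorms.

(** At most [(n + 1)^l] exponents contribute, however long [s] is; this keeps later constants
    independent of the element that is expanded. *)
Lemma sum_index_le (R : realType) l n (s : seq {ffun 'I_l -> nat})
    (F : {ffun 'I_l -> nat} -> R) (M : R) : uniq s -> 0 <= M ->
  (forall be, ~ index_le n be -> F be = 0) -> (forall be, index_le n be -> F be <= M) ->
  \sum_(be <- s) F be <= #|{: {ffun 'I_l -> 'I_n.+1}}|%:R * M.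
Proof.
move=> us M0 F0 FM.
pose ib (be : {ffun 'I_l -> nat}) := [forall i, be i <= n]%N.
have ibP be : reflect (index_le n be) (ib be) by exact: forallP.
rewrite (bigID ib) /= [X in _ + X]big1 ?addr0; last by move=> be /ibP; exact: F0.
apply: (@le_trans _ _ (\sum_(be <- s | ib be) M)).
  by apply: ler_sum => be /ibP; exact: FM.
rewrite -big_filter big_const_seq count_predT iter_addr_0 -[leLHS]mulr_natl.
rewrite ler_wpM2r // ler_nat.
pose un (b : {ffun 'I_l -> 'I_n.+1}) : {ffun 'I_l -> nat} := [ffun i => b i : nat].
rewrite cardE -(size_map un); apply: uniq_leq_size; first by rewrite filter_uniq.
move=> be; rewrite mem_filter => /andP[/ibP hb _]; apply/mapP.
exists [ffun i => inord (be i)]; first by rewrite mem_enum.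
by apply/ffunP => i; rewrite !ffunE inordK // ltnS.
Qed.

(** * The dense copy of the enveloping algebra and its characters *)

Section Realization.
Variables (R : realType) (g : lieAlg R) (A : cinf g).
Local Notation k := (cinf_k A).
Local Notation l := (cinf_l A).
Local Notation U := (cinf_env A).
Local Notation V := 'rV[R]_k.
Local Notation inc := (@cinf_inc R g A).
Local Notation j := (env_inj U).
Local Notation t := (@cinf_tens R g A).
Local Notation terms := (seq (R * {ffun 'I_k -> nat} * {ffun 'I_l -> nat})).
Local Notation pbwA := (@pbw R g U k l (cinf_e A) (cinf_n A)).

(** The smooth coefficient at [be]. It is attached to the list [r] and not to the element [pbwA r],
    so no uniqueness of expansions has to be known in advance. *)
Definition coef (r : terms) (be : {ffun 'I_l -> nat}) : smooth R k :=
  \sum_(p <- r | p.2 == be) p.1.1 *: monomial_fun R p.1.2.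

Lemma cinf_pbw_span (u : U) : exists r, u = pbwA r.
Proof. by apply: pbw_span; exact: cinf_basis. Qed.

Lemma incL : linear inc.
Proof. by case: (cinf_inc_hom A). Qed.

Lemma inc1 : inc 1 = 1.
Proof. by case: (cinf_inc_hom A) => _ []. Qed.

Lemma incM u v : inc (u * v) = inc u * inc v.
Proof. by case: (cinf_inc_hom A) => _ [_]. Qed.

Lemma inc_pbw r : inc (pbwA r) =
  \sum_(p <- r) t (p.1.1 *: monomial_fun R p.1.2) (monomial_fps R p.2).
Proof.
rewrite /pbw (linear_fun_sum incL); apply: eq_bigr => p _.
rewrite (linear_funZ incL) (tensZl (cinf_tensP A)); congr (_ *: _).
exact: cinf_inc_pbw.
Qed.

Lemma inc_pbw_coef r : inc (pbwA r) =
  \sum_(be <- undup (map snd r)) t (coef r be) (monomial_fps R be).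
Proof.
rewrite inc_pbw; under [RHS]eq_bigr => be _.
  rewrite /coef (tens_suml (cinf_tensP A)) big_mkcond /=.
  over.
rewrite exchange_big /= !big_seq; apply: eq_bigr => p pr.
rewrite -big_mkcond (eq_bigl (pred1 p.2)) => [|be]; last by rewrite eq_sym.
rewrite -big_filter filter_pred1_uniq ?undup_uniq ?mem_undup ?map_f //.
by rewrite big_seq1.
Qed.

Definition jet_seminorm n (p : A -> R) := [/\ cont_seminorm p,
  forall r be ga x, index_le n be -> (size ga <= n)%N -> cube n%:R x ->
    `|iter_partial ga (coef r be) x| <= p (inc (pbwA r)) &
  forall r M, 0 <= M -> (forall be ga x, index_le n be -> (size ga <= n)%N ->
    cube n%:R x -> `|iter_partial ga (coef r be) x| <= M) -> p (inc (pbwA r)) <= M].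

Lemma exists_cinf_seminorm : {p : nat -> A -> R & forall n, jet_seminorm n (p n)}.
Proof.
apply: (choice (P := jet_seminorm)) => n.
have [p cp hp] := exists_jet_seminorm (cinf_tensP A) n; exists p.
have hc (r : terms) be ga x : iter_partial ga (coef r be) x =
    \sum_(p <- r) iter_partial ga (p.1.1 *: monomial_fun R p.1.2) x * monomial_fps R p.2 be.
  rewrite /coef jet_sum big_mkcond; apply: eq_bigr => q _.
  by rewrite /monomial_fps eq_sym; case: ifP; rewrite ?mulr1 ?mulr0.
split=> // r; have [h1 h2] := hp _ r (fun p => p.1.1 *: monomial_fun R p.1.2)
   (fun p => monomial_fps R p.2).
  by move=> be ga x hb hg hx; rewrite inc_pbw hc; exact: h1.
move=> M M0 hM; rewrite inc_pbw; apply: h2 => // be ga x hb hg hx; rewrite -hc.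
exact: hM.
Qed.

Definition pn := projT1 exists_cinf_seminorm.

Lemma pnP n : jet_seminorm n (pn n).
Proof. exact: (projT2 exists_cinf_seminorm n). Qed.

Lemma pn_cont n : cont_seminorm (pn n).
Proof. by case: (pnP n). Qed.

Lemma inc_dense_le (F G : A -> R) : continuous F -> continuous G ->
  (forall u, F (inc u) <= G (inc u)) -> forall a, F a <= G a.
Proof.
move=> cF cG FG; apply: (dense_le (@cinf_inc_dense R g A) cF cG).
by move=> _ [u _ <-]; exact: FG.
Qed.

(** In the product topology of power series [q] sees only finitely many coefficients and annihilates
    monomials with a large exponent. All nilpotency modulo [q] originates here. *)
Lemma section_bound q : cont_seminorm q -> exists n, exists2 C, 0 <= C &
  forall (f : smooth R k) M, 0 <= M -> jet_le n n%:R f M -> forall be,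
    q (t f (monomial_fps R be)) <= C * M /\
    (~ index_le n be -> q (t f (monomial_fps R be)) = 0).
Proof.
move=> cq; have [n [C C0 h]] := tens_bound (cinf_tensP A) cq.
exists n, C => // f M M0 fM be; split.
  rewrite -[M]mulr1; apply: h => // ga _; rewrite /monomial_fps.
  by case: eqP => _; rewrite ?normr1 ?normr0.
move=> nb; apply/eqP; rewrite eq_le (seminorm_ge0 cq.1) andbT -(mulr0 (C * M)) -mulrA.
apply: h => // ga hga; rewrite /monomial_fps; case: eqP => [e|_]; last by rewrite normr0.
by case: nb; rewrite -e.
Qed.

Lemma jet_le_coef n r be : index_le n be ->
  jet_le n n%:R (coef r be) (pn n (inc (pbwA r))).
Proof. by move=> hb s x; case: (pnP n) => _ h _; exact: h. Qed.

Lemma pn_dominates q : cont_seminorm q -> exists n, exists2 C, 0 <= C &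
  forall a, q a <= C * pn n a.
Proof.
move=> cq; have [n [C C0 h]] := section_bound cq.
pose N := #|{: {ffun 'I_l -> 'I_n.+1}}|.
have NC0 : 0 <= N%:R * C by rewrite mulr_ge0.
exists n, (N%:R * C) => //.
apply: inc_dense_le; [by case: cq|by case: (cont_seminormZ NC0 (pn_cont n))|].
move=> u; have [r ->] := cinf_pbw_span u.
have pr0 := seminorm_ge0 (pn_cont n).1 (inc (pbwA r)).
rewrite {1}inc_pbw_coef (le_trans (seminorm_sum cq.1 _ _ _)) //.
rewrite -mulrA; apply: sum_index_le => [||be nb|be hb]; rewrite ?undup_uniq ?mulr_ge0 //.
  have [M hM] := jet_bounded n n%:R (coef r be).
  have [_] := h (coef r be) `|M| (normr_ge0 _) (jet_le_mono (leqnn _) (lexx _) (ler_norm _) hM) be.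
  exact.
by have [] := h _ _ pr0 (jet_le_coef r hb) be.
Qed.

Theorem cinf_frechet : frechet A.
Proof.
have [hA cA _ _ _] := cinf_tensP A; split=> //; exists pn.
exact: dominating_determines pn_cont pn_dominates.
Qed.

Lemma env_lieA : lie_alg_hom j.
Proof. exact: env_lie. Qed.

Let chi_sig (x : V) : {chi : U -> R^o | alg_hom chi &
  (forall i, chi (j (tnth (cinf_e A) i)) = x 0 i) /\
  forall v, v \in derived_alg g -> chi (j v) = 0}.
Proof.
exact: (cid2 (exists_character U (cinf_basis A) (cinf_n_basis A) x)).
Qed.

(* [chi x u] is the value at [x] of the zeroth coefficient of [u]. *)
Definition chi (x : V) : U -> R^o := s2val (chi_sig x).

Lemma chiL x : linear (chi x).
Proof. by rewrite /chi; case: (chi_sig x) => c [] /=. Qed.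

Lemma chi1 x : chi x 1 = 1.
Proof. by rewrite /chi; case: (chi_sig x) => c [_ []] /=. Qed.

Lemma chiM x u v : chi x (u * v) = chi x u * chi x v.
Proof. by rewrite /chi; case: (chi_sig x) => c [_ [_ cM]] /= _; exact: cM. Qed.

Lemma chi_e x i : chi x (j (tnth (cinf_e A) i)) = x 0 i.
Proof. by rewrite /chi; case: (chi_sig x) => c _ [] /=. Qed.

Lemma chi_derived x v : v \in derived_alg g -> chi x (j v) = 0.
Proof. by rewrite /chi; case: (chi_sig x) => c _ [] /= _; exact. Qed.

Lemma chiX x u n : chi x (u ^+ n) = chi x u ^+ n.
Proof. by elim: n => [|n IHn]; rewrite ?chi1 // !exprS chiM IHn. Qed.

Lemma chi_prod x I (r : seq I) (F : I -> U) :
  chi x (\prod_(i <- r) F i) = \prod_(i <- r) chi x (F i).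
Proof. by elim: r => [|i r IHr]; rewrite ?big_nil ?chi1 // !big_cons chiM IHr. Qed.

Lemma cinf_n_mem i : tnth (cinf_n A) i \in derived_alg g.
Proof. by rewrite -(span_basis (cinf_n_basis A)) memv_span ?mem_tnth. Qed.

Let be0 : {ffun 'I_l -> nat} := [ffun => 0%N].

Lemma chi_mono x al be : chi x (mono U (cinf_e A) (cinf_n A) al be) =
  (be == be0)%:R * monomial_fun R al x.
Proof.
rewrite /mono chiM !chi_prod mulrC; congr (_ * _); last first.
  by apply: eq_bigr => i _; rewrite chiX chi_e.
have [->|nb] := eqVneq.
  by rewrite big1 // => i _; rewrite ffunE expr0 chi1.
have [i bi] : exists i, be i != 0%N.
  apply: contra_neqP nb => /forallNP h; apply/ffunP => i; rewrite ffunE.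
  by have /negP := h i; rewrite negbK => /eqP.
apply/eqP; rewrite mulr0n prodf_seq_eq0; apply/hasP; exists i => //=.
  by rewrite mem_index_enum.
by rewrite chiX chi_derived ?cinf_n_mem // expf_eq0 lt0n bi eqxx.
Qed.

Lemma chi_pbw x r : chi x (pbwA r) = coef r be0 x.
Proof.
rewrite /pbw (linear_fun_sum (chiL x)) /coef.
have := jet_sum r (fun p => p.2 == be0) (fun p => p.1.1 *: monomial_fun R p.1.2) [::] x.
rewrite /= => ->; rewrite [RHS]big_mkcond; apply: eq_bigr => p _.
rewrite (linear_funZ (chiL x)) chi_mono; case: eqP => _.
  by rewrite mul1r; have := jetZ p.1.1 (monomial_fun R p.1.2) [::] x => /= ->.
by rewrite mul0r scaler0.
Qed.

Lemma jet_le_chi n u : jet_le n n%:R (fun x => chi x u) (pn n (inc u)).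
Proof.
have [r ->] := cinf_pbw_span u.
have -> : (fun x => chi x (pbwA r)) = coef r be0.
  by apply/funext => x; exact: chi_pbw.
by apply: jet_le_coef => i; rewrite ffunE.
Qed.

Definition aug (u : U) := forall x, chi x u = 0.

Lemma augMr u v : aug u -> aug (u * v).
Proof. by move=> h x; rewrite chiM h mul0r. Qed.

(* The left module generated by products of [m] elements of [[g, g]]. *)
Definition dprod_span m (u : U) := forall P : U -> Prop,
  (forall v w, P v -> P w -> P (v + w)) -> P 0 ->
  (forall a (xs : seq g), size xs = m -> {subset xs <= derived_alg g} ->
    P (a * \prod_(x <- xs) j x)) -> P u.

Lemma dprod_spanD m u v : dprod_span m u -> dprod_span m v -> dprod_span m (u + v).
Proof. by move=> hu hv P PD P0 Pa; apply: (PD); [exact: hu|exact: hv]. Qed.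

Lemma dprod_span0 m : dprod_span m 0.
Proof. by move=> P. Qed.

Lemma dprod_spanM m a u : dprod_span m u -> dprod_span m (a * u).
Proof.
move=> hu P PD P0 Pa; apply: (hu (fun u => P (a * u))).
- by move=> v w hv hw; rewrite mulrDr; exact: PD.
- by rewrite mulr0.
- by move=> b xs sx xn; rewrite mulrA; exact: Pa.
Qed.

(** The characters read off the coefficient at exponent 0, which thus vanishes. The terms of [r]
    with that exponent need not vanish one by one, but their sum does, by injectivity of [inc];
    every other term ends with a factor from [[g, g]]. *)
Lemma aug_span u : aug u -> dprod_span 1 u.
Proof.
have [r ->] := cinf_pbw_span u => hu.
have e0 : coef r be0 = 0.
  by apply: val_inj; apply/funext => x; have := hu x; rewrite chi_pbw.
rewrite /pbw (bigID (fun p => p.2 == be0)) /= [X in dprod_span _ (X + _)](_ : _ = 0).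
  rewrite add0r; apply: (big_ind (dprod_span 1)); [exact: dprod_span0|exact: dprod_spanD|].
  move=> p pb; rewrite /mono -[_ *: _]mul1r -scalerAr scalerAl mulrA.
  apply: dprod_spanM.
  suff h (s : seq 'I_l) : (all (fun i => p.2 i == 0%N) s /\
      \prod_(i <- s) j (tnth (cinf_n A) i) ^+ p.2 i = 1) \/
      dprod_span 1 (\prod_(i <- s) j (tnth (cinf_n A) i) ^+ p.2 i).
    have [[/allP hs _]|//] := h (index_enum _).
    move: pb; rewrite (_ : p.2 = be0) ?eqxx //; apply/ffunP => i.
    by rewrite ffunE; apply/eqP/hs; rewrite mem_index_enum.
  elim/last_ind: s => [|s i IHs]; first by left; rewrite big_nil.
  rewrite all_rcons -cats1 big_cat big_seq1 /=.
  have [pi|pi] := eqVneq (p.2 i) 0%N; first by rewrite pi mulr1.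
  right; rewrite -(prednK (_ : (0 < p.2 i)%N)) ?lt0n // exprSr mulrA.
  move=> P _ _ Pa; have := Pa (\prod_(i0 <- s) j (tnth (cinf_n A) i0) ^+ p.2 i0 *
    j (tnth (cinf_n A) i) ^+ (p.2 i).-1) [:: tnth (cinf_n A) i] erefl.
  by rewrite big_seq1; apply => x; rewrite inE => /eqP ->; exact: cinf_n_mem.
apply: (@cinf_inc_inj _ _ A); rewrite (linear_fun_sum incL) (linear_fun0 incL).
transitivity (t (coef r be0) (monomial_fps R be0)); last first.
  by rewrite e0 (linear_fun0 (tens_lin_l (cinf_tensP A) _)).
rewrite /coef (tens_suml (cinf_tensP A)); apply: eq_bigr => p /eqP pb.
rewrite (linear_funZ incL) (tensZl (cinf_tensP A)) -pb; congr (_ *: _).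
exact: cinf_inc_pbw.
Qed.

(** In [z * (a * ...)] the product [z * a] still lies in the augmentation ideal, so a new factor
    from [[g, g]] appears to the left of those already present. *)
Lemma aug_mul_span m z u : aug z -> dprod_span m u -> dprod_span m.+1 (z * u).
Proof.
move=> az hu P PD P0 Pa; apply: (hu (fun u => P (z * u))).
- by move=> v w hv hw; rewrite mulrDr; exact: PD.
- by rewrite mulr0.
move=> a xs sx xn; rewrite mulrA.
apply: (aug_span (augMr a az) (P := fun w => P (w * _))).
- by move=> v w hv hw; rewrite mulrDl; exact: PD.
- by rewrite mul0r.
move=> b [//|y [|//]] // _ yn; rewrite big_seq1 -mulrA.
have := Pa b (y :: xs); rewrite big_cons /= sx; apply => // x.
by rewrite inE => /predU1P[->|/xn //]; apply: yn; rewrite mem_head.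
Qed.

Lemma aug_prod_span zs : (forall z, z \in zs -> aug z) ->
  dprod_span (size zs) (\prod_(z <- zs) z).
Proof.
elim: zs => [_ P PD P0 Pa|z zs IHzs hz].
  by rewrite big_nil; have := Pa 1 [::] erefl; rewrite big_nil mulr1; apply.
rewrite big_cons; apply: aug_mul_span; first by apply: hz; rewrite mem_head.
by apply: IHzs => y yz; apply: hz; rewrite inE yz orbT.
Qed.

(* By continuity of the product, high powers of each basis vector of [[g, g]]
   lie in the ideal [K] of all [u] with [q] vanishing on [U u U]. *)
Lemma aug_vanish q : triangular g -> cont_seminorm q -> exists N, forall zs v,
  (size zs >= N)%N -> (forall z, z \in zs -> aug z) ->
  q (inc (\prod_(z <- zs) z * v)) = 0.
Proof.
move=> tri cq.
pose K u := forall a b, q (inc (a * u * b)) = 0.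
have q0 : q 0 = 0 by exact: seminorm0 cq.1.
have sq := cq.1.
have K0 : K 0 by move=> a b; rewrite mulr0 mul0r (linear_fun0 incL).
have KD u v : K u -> K v -> K (u + v).
  move=> hu hv a b; rewrite mulrDr mulrDl (linear_funD incL).
  apply/eqP; rewrite eq_le (seminorm_ge0 sq) andbT (le_trans (seminormD sq _ _)) //.
  by rewrite hu hv addr0.
have KZ a u : K u -> K (a *: u).
  move=> hu c d; rewrite -scalerAr -scalerAl (linear_funZ incL) (seminormZ sq).
  by rewrite hu mulr0.
have Kl u v : K v -> K (u * v) by move=> hv a b; rewrite mulrA hv.
have Kr u v : K u -> K (u * v) by move=> hu a b; rewrite mulrA -mulrA hu.
have [N hN] : nil_mod j K (derived_alg g).
  have sp : <<cinf_n A>>%VS = derived_alg g by exact: span_basis (cinf_n_basis A).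
  apply: (derived_nil_mod env_lieA K0 KD KZ Kl Kr tri sp) => _ /tnthP[i ->].
  have [q1 cq1 hq1] := mul_seminorm (@cinf_mul_continuous R g A) cq.
  have [q2 cq2 hq2] := mul_seminorm (@cinf_mul_continuous R g A) cq1.
  have [n [C C0 hC]] := section_bound cq2.
  (* The exponent [n.+1] is just beyond what [q2] sees. The two passages from [q] to [q1] and [q2]
     deal with the factors [b] and [a] of [K]. *)
  pose be : {ffun 'I_l -> nat} := [ffun i' => if i' == i then n.+1 else 0%N].
  pose al : {ffun 'I_k -> nat} := [ffun => 0%N].
  exists n.+1 => a b.
  have e : j (tnth (cinf_n A) i) ^+ n.+1 = mono U (cinf_e A) (cinf_n A) al be.
    rewrite /mono big1 ?mul1r => [|i' _]; last by rewrite ffunE expr0.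
    rewrite (big_only1 i) // => [|i' ne _]; first by rewrite ffunE eqxx.
    by rewrite ffunE (negPf ne) expr0.
  have z2 : q2 (inc (j (tnth (cinf_n A) i) ^+ n.+1)) = 0.
    rewrite e [inc _](cinf_inc_pbw (c := A)).
    have [M hM] := jet_bounded n n%:R (monomial_fun R al).
    have [_] := hC _ `|M| (normr_ge0 _) (jet_le_mono (leqnn _) (lexx _) (ler_norm _) hM) be.
    by apply => /(_ i); rewrite ffunE eqxx ltnn.
  apply/eqP; rewrite eq_le (seminorm_ge0 sq) andbT !incM (le_trans (hq1 _ _)) //.
  apply: mulr_le0_ge0; last exact: (seminorm_ge0 cq1.1).
  by rewrite (le_trans (hq2 _ _)) // z2 mulr0.
exists N => zs v sz hz.
rewrite -(cat_take_drop N zs) big_cat /= -mulrA.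
set w := _ * v; rewrite -[_ * w]mul1r mulrA.
have : dprod_span N (\prod_(z <- take N zs) z).
  have := @aug_prod_span (take N zs); rewrite size_takel //; apply => z /mem_take; exact: hz.
move=> /(_ K) h; apply: h => // a xs sx xn; apply: Kl; apply: hN.
elim: xs N {sz w} sx xn => [|x xs IHxs] N <- xn; first by rewrite big_nil; exact: ipow1.
rewrite big_cons; apply: ipowS; first by apply: xn; rewrite mem_head.
by apply: IHxs => // y yx; apply: xn; rewrite inE yx orbT.
Qed.

End Realization.

(** * Derivatives of polynomial functions *)

Section PolynomialFunctions.
Variables (R : realType) (k : nat).
Local Notation V := 'rV[R]_k.
Implicit Types f g : V -> R^o.

Definition partial (i : 'I_k) f : V -> R^o := fun x => 'D_(delta_mx 0 i) f x.

Lemma polyfun_partial f i : polyfun f -> polyfun (partial i f).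
Proof. by move=> /polyfun_diff[_ /(_ i)[]]. Qed.

Lemma partialD f g i : polyfun f -> polyfun g ->
  partial i (f \+ g) = partial i f \+ partial i g.
Proof.
move=> /polyfun_diff[_ /(_ i)[df _]] /polyfun_diff[_ /(_ i)[dg _]].
by apply/funext => x; rewrite /partial deriveD.
Qed.

Lemma partialM f g i : polyfun f -> polyfun g ->
  partial i (f \* g) = (f \* partial i g) \+ (g \* partial i f).
Proof.
move=> /polyfun_diff[_ /(_ i)[df _]] /polyfun_diff[_ /(_ i)[dg _]].
by apply/funext => x; rewrite /partial deriveM.
Qed.

Lemma iter_partial_rcons s i f : iter_partial (rcons s i) f = iter_partial s (partial i f).
Proof. by rewrite /iter_partial foldr_rcons. Qed.

Lemma jet_leS n c f M : jet_le n.+1 c f M <->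
  (forall x, cube c x -> `|f x| <= M) /\ forall i, jet_le n c (partial i f) M.
Proof.
split=> [h|[h0 h] s x sn xc].
  split=> [x xc|i s x sn xc]; first exact: (h [::]).
  by rewrite -iter_partial_rcons; apply: h => //; rewrite size_rcons.
case/lastP: s sn => [_|s i]; first exact: h0.
by rewrite size_rcons iter_partial_rcons => sn; exact: h.
Qed.

Lemma jet_le0 c f M : jet_le 0 c f M <-> forall x, cube c x -> `|f x| <= M.
Proof. by split=> [h x xc|h [|//] x _ xc]; [exact: (h [::])|exact: h]. Qed.

Lemma jet_leD n c f g M N : polyfun f -> polyfun g -> jet_le n c f M ->
  jet_le n c g N -> jet_le n c (f \+ g) (M + N).
Proof.
have h0 f' g' : (forall x, cube c x -> `|f' x| <= M) -> (forall x, cube c x -> `|g' x| <= N) ->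
    forall x, cube c x -> `|(f' \+ g') x| <= M + N.
  by move=> hf hg x xc; rewrite (le_trans (ler_normD _ _)) // lerD ?hf ?hg.
elim: n f g => [|n IHn] f g pf pg; first by rewrite !jet_le0; exact: h0.
rewrite !jet_leS => -[hf df] [hg dg]; split=> [|i]; first exact: h0.
by rewrite partialD //; apply: IHn; rewrite ?df ?dg //; exact: polyfun_partial.
Qed.

(** By the Leibniz rule each derivative doubles the number of terms, whence [2 ^+ n]. *)
Lemma jet_leM n c f g M N : 0 <= M -> 0 <= N -> polyfun f -> polyfun g ->
  jet_le n c f M -> jet_le n c g N -> jet_le n c (f \* g) (2 ^+ n * (M * N)).
Proof.
move=> M0 N0.
have h0 f' g' : (forall x, cube c x -> `|f' x| <= M) -> (forall x, cube c x -> `|g' x| <= N) ->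
    forall x, cube c x -> `|(f' \* g') x| <= M * N.
  by move=> hf hg x xc; rewrite normrM ler_pM ?hf ?hg.
elim: n f g => [|n IHn] f g pf pg; first by rewrite mul1r !jet_le0; exact: h0.
move=> hf hg.
have hf' : jet_le n c f M by apply: jet_le_mono hf.
have hg' : jet_le n c g N by apply: jet_le_mono hg.
move: hf hg; rewrite !jet_leS => -[hf df] [hg dg]; split=> [x xc|i].
  apply: le_trans (h0 _ _ hf hg x xc) _.
  by rewrite ler_peMl ?mulr_ge0 // exprn_ege1 // ler1n.
rewrite partialM // exprS -mulrA mulr_natl mulr2n.
have qf := polyfun_partial i pf; have qg := polyfun_partial i pg.
apply: jet_leD; [exact: polyfun_mul|exact: polyfun_mul|exact: IHn|].
have -> : g \* partial i f = partial i f \* g by apply/funext => x; rewrite /= mulrC.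
exact: IHn.
Qed.

Lemma jet_le_cst n c (a M : R) : `|a| <= M -> jet_le n c (cst a : V -> R^o) M.
Proof.
elim: n a => [|n IHn] a aM; first by rewrite jet_le0.
rewrite jet_leS; split=> // i.
have -> : partial i (cst a) = cst 0 by apply/funext => x; exact: derive_cst.
by apply: IHn; rewrite normr0 (le_trans _ aM).
Qed.

Lemma polyfun_monomials f : polyfun f -> exists r : seq (R * {ffun 'I_k -> nat}),
  forall x, f x = \sum_(p <- r) p.1 * monomial_fun R p.2 x.
Proof.
elim=> [c|i|{}f g _ [r hr] _ [s hs]|{}f g _ [r hr] _ [s hs]].
- exists [:: (c, [ffun => 0%N])] => x; rewrite big_seq1 /= big1 ?mulr1 // => j _.
  by rewrite ffunE expr0.
- exists [:: (1, [ffun j => (j == i : nat)])] => x; rewrite big_seq1 /= mul1r.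
  rewrite (big_only1 i) // => [|j ne _]; first by rewrite ffunE eqxx expr1.
  by rewrite ffunE (negPf ne) expr0.
- by exists (r ++ s) => x; rewrite big_cat /= hr hs.
- exists (allpairs (fun p q : R * {ffun 'I_k -> nat} =>
    (p.1 * q.1, [ffun i => (p.2 i + q.2 i)%N])) r s) => x.
  rewrite /= hr hs big_allpairs_dep big_distrl /=; apply: eq_bigr => p _.
  rewrite big_distrr /=; apply: eq_bigr => q _.
  rewrite mulrACA; congr (_ * _); rewrite -big_split /=; apply: eq_bigr => i _.
  by rewrite ffunE exprD.
Qed.

Lemma polyfun_sum I (r : seq I) (F : I -> V -> R^o) : (forall i, polyfun (F i)) ->
  polyfun (fun x => \sum_(i <- r) F i x).
Proof.
move=> pF; elim: r => [|i r IHr].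
  rewrite (_ : (fun x => _) = cst 0); first exact: polyfun_cst.
  by apply/funext => x; rewrite big_nil.
rewrite (_ : (fun x => _) = F i \+ (fun x => \sum_(i <- r) F i x)).
  exact: polyfun_add.
by apply/funext => x; rewrite big_cons.
Qed.

End PolynomialFunctions.

(** * Local multiplicative convexity *)

Section MultiplicativelyConvex.
Variables (R : realType) (g : lieAlg R) (A : cinf g).
Hypothesis tri : triangular g.
Local Notation k := (cinf_k A).
Local Notation l := (cinf_l A).
Local Notation U := (cinf_env A).
Local Notation V := 'rV[R]_k.
Local Notation inc := (@cinf_inc R g A).
Local Notation chi := (@chi R g A).
Local Notation aug := (@aug R g A).
Local Notation incL := (@incL R g A).
Local Notation pn := (@pn R g A).

(** [u] is the tensor of [f] with the constant power series 1: the ordered polynomial in the [e_i]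
    with symbol [f]. *)
Definition is_section (f : V -> R^o) (u : U) := exists F : smooth R k,
  [/\ (F : V -> R^o) = f, inc u = cinf_tens F (monomial_fps R [ffun => 0%N]) &
    forall x, chi x u = f x].

Lemma polyfun_chi u : polyfun (fun x => chi x u : R^o).
Proof.
have [r ->] := cinf_pbw_span u.
rewrite (_ : (fun x => _) = (fun x => \sum_(p <- [seq p <- r | p.2 == [ffun => 0%N]])
  p.1.1 * monomial_fun R p.1.2 x)).
  apply: polyfun_sum => p.
  exact: (polyfun_mul (polyfun_cst _ _) (monomial_polyfun _ _)).
apply/funext => x; rewrite chi_pbw /coef big_filter.
have := jet_sum r (fun p => p.2 == [ffun => 0%N]) (fun p => p.1.1 *: monomial_fun R p.1.2) [::] x.
rewrite /= => ->; apply: eq_bigr => p _.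
exact: (jetZ p.1.1 (monomial_fun R p.1.2) [::] x).
Qed.

Lemma exists_section f : polyfun f -> exists u, is_section f u.
Proof.
move=> pf; have [r hr] := polyfun_monomials pf.
pose rr := [seq (p.1, p.2, [ffun => 0%N] : {ffun 'I_l -> nat}) | p <- r].
exists (pbw U (cinf_e A) (cinf_n A) rr), (Smooth (polyfun_smooth pf)).
have cE : coef rr [ffun => 0%N] = Smooth (polyfun_smooth pf).
  apply: val_inj; apply/funext => x; rewrite /= hr /coef.
  have := jet_sum rr (fun p => p.2 == [ffun => 0%N]) (fun p => p.1.1 *: monomial_fun R p.1.2) [::] x.
  rewrite /= => ->; rewrite /rr big_map; apply: eq_big => [p|p _] /=; first by rewrite eqxx.
  exact: (jetZ p.1 (monomial_fun R p.2) [::] x).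
split=> // [|x]; last by rewrite chi_pbw cE.
rewrite inc_pbw -cE /coef (tens_suml (cinf_tensP A)) /rr !big_map.
by apply: eq_big => [p|p _] //=; rewrite eqxx.
Qed.

Lemma section1 : is_section (cst 1) 1.
Proof.
exists (monomial_fun R [ffun => 0%N]); split.
- by apply/funext => x /=; rewrite big1 // => i _; rewrite ffunE expr0.
- rewrite -cinf_inc_pbw !big1 ?mulr1 // => i _; by rewrite ffunE expr0.
- by move=> x; rewrite chi1.
Qed.

Lemma is_section_bound q : cont_seminorm q -> exists n, exists2 C, 0 <= C &
  forall f u M, 0 <= M -> is_section f u -> jet_le n n%:R f M -> q (inc u) <= C * M.
Proof.
move=> cq; have [n [C C0 h]] := section_bound cq; exists n, C => // f u M M0.
by move=> [F [Ff -> _]] fM; have [] := h F M M0 _ [ffun => 0%N]; rewrite ?Ff.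
Qed.

Lemma seminorm_prod_bound N (q : A -> R) : cont_seminorm q ->
  exists2 q1, cont_seminorm q1 & forall ys : seq A, (0 < size ys <= N.+1)%N ->
    q (\prod_(y <- ys) y) <= \prod_(y <- ys) q1 y.
Proof.
elim: N q => [|N IHN] q cq.
  exists q => // -[|y [|//]] // _; by rewrite !big_seq1.
have [p cp hp] := mul_seminorm (@cinf_mul_continuous R g A) cq.
have [p1 cp1 hp1] := IHN p cp.
have c1 := cont_seminormD cq (cont_seminormD cp cp1).
exists (fun x => q x + (p x + p1 x)) => // -[//|y ys] /= hs.
have q0 := seminorm_ge0 cq.1; have p0 := seminorm_ge0 cp.1; have p10 := seminorm_ge0 cp1.1.
case: ys hs => [_|z ys hs]; first by rewrite !big_seq1 lerDl addr_ge0.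
rewrite big_cons [leRHS]big_cons (le_trans (hp _ _)) // ler_pM //.
  by rewrite addrCA lerDl addr_ge0.
apply: le_trans (hp1 (z :: ys) hs) _; apply: ler_prod => i _; rewrite p10 /=.
by rewrite addrA lerDr addr_ge0.
Qed.

Definition chi_prods (ys : seq U) : V -> R^o := fun x => \prod_(y <- ys) chi x y.

Lemma chi_prods_polyfun ys : polyfun (chi_prods ys).
Proof.
rewrite (_ : chi_prods ys = fun x => chi x (\prod_(y <- ys) y)); first exact: polyfun_chi.
by apply/funext => x; rewrite /chi_prods chi_prod.
Qed.

Lemma jet_le_chi_prods n ys :
  jet_le n n%:R (chi_prods ys) (\prod_(y <- ys) (2 ^+ n * pn n (inc y))).
Proof.
elim: ys => [|y ys IHys].
  rewrite big_nil (_ : chi_prods _ = cst 1); first by apply: jet_le_cst; rewrite normr1.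
  by apply/funext => x; rewrite /chi_prods big_nil.
rewrite big_cons (_ : chi_prods _ = (fun x => chi x y : R^o) \* chi_prods ys); last first.
  by apply/funext => x; rewrite /chi_prods big_cons.
rewrite -mulrA; apply: jet_leM => //.
- by apply: seminorm_ge0; case: (pn_cont A n).
- apply: prodr_ge0 => z _; rewrite mulr_ge0 ?exprn_ge0 //.
  by apply: seminorm_ge0; case: (pn_cont A n).
- exact: polyfun_chi.
- exact: chi_prods_polyfun.
- exact: jet_le_chi.
Qed.

(* With [s] a linear section of the characters, the product [x_1 ... x_r] is the
   section of the product of the symbols plus the telescoping sum of the
   [c_i x_(i+2) ... x_r], where
   [c_i = s(f_1 ... f_i) x_(i+1) - s(f_1 ... f_(i+1))] lies in the augmentation
   ideal.  Iterating this [N] times exhausts the products not killed by [q]. *)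
Lemma prod_bound_U (q : A -> R) : cont_seminorm q -> exists2 Q : A -> R, cont_seminorm Q &
  exists2 C, 0 <= C & forall xs : seq U, q (inc (\prod_(x <- xs) x)) <= C * \prod_(x <- xs) Q (inc x).
Proof.
move=> cq; have [N hN] := aug_vanish tri cq.
(* The only products split directly consist of fewer than [N] augmentation factors and one section,
   so a bound for bounded length suffices. *)
have [q1 cq1 hq1] := seminorm_prod_bound N cq.
have [q2 cq2 hq2] := mul_seminorm (@cinf_mul_continuous R g A) cq1.
have c12 := cont_seminormD cq1 cq2.
have [n [C C0 hC]] := is_section_bound c12.
have q0 := seminorm_ge0 cq.1; have q10 := seminorm_ge0 cq1.1; have q20 := seminorm_ge0 cq2.1.
pose Q0 a := 2 ^+ n * pn n a.
have cQ0 : cont_seminorm Q0 by apply: cont_seminormZ; [exact: exprn_ge0|exact: pn_cont].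
have Q00 := seminorm_ge0 cQ0.1.
(* An error [u * x - u'] has two parts: [q2] measures the letter [x] in the first, [Q0] measures its
   symbol in the second. *)
pose Q a := q2 a + Q0 a.
have cQ : cont_seminorm Q by exact: cont_seminormD.
have QQ a : 0 <= Q a by rewrite addr_ge0.
pose M := Num.max 1 C.
have M1 : 1 <= M by rewrite le_max lexx.
have M0 : 0 <= M by exact: le_trans M1.
pose w (xs : seq U) := \prod_(x <- xs) Q (inc x).
have w0 xs : 0 <= w xs by exact: prodr_ge0.
pose w0' (xs : seq U) := \prod_(x <- xs) Q0 (inc x).
have w0'0 xs : 0 <= w0' xs by exact: prodr_ge0.
have w0w xs : w0' xs <= w xs.
  by apply: ler_prod => x _; rewrite Q00 lerDr q20.
have hs ys u : is_section (chi_prods ys) u -> q1 (inc u) + q2 (inc u) <= M * w0' ys.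
  move=> su; have h : q1 (inc u) + q2 (inc u) <= C * w0' ys.
    exact: (hC _ _ _ (w0'0 ys) su (@jet_le_chi_prods n ys)).
  apply: le_trans h _.
  by rewrite ler_wpM2r // le_max lexx orbT.
have hs1 ys u : is_section (chi_prods ys) u -> q1 (inc u) <= M * w ys.
  move=> /hs h; apply: (@le_trans _ _ (q1 (inc u) + q2 (inc u))); first by rewrite lerDl.
  by apply: le_trans h _; rewrite ler_wpM2l.
have hs2 ys u : is_section (chi_prods ys) u -> q2 (inc u) <= M * w0' ys.
  by move=> /hs h; apply: le_trans h; rewrite lerDr.
pose v (zs : seq U) := \prod_(z <- zs) q1 (inc z).
have v0 zs : 0 <= v zs by exact: prodr_ge0.
have incprod zs : inc (\prod_(z <- zs) z) = \prod_(a <- map inc zs) a.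
  by elim: zs => [|z zs IH]; rewrite ?big_nil ?inc1 //= !big_cons incM IH.
(* [d] counts the augmentation factors still missing before [q] vanishes. Each round of telescoping
   yields one closing section and at most [size xs] errors, all with constant [M]; this explains the
   factor [M * (size xs).+1]. *)
have claim d : (d <= N)%N -> forall zs xs, size zs = (N - d)%N ->
    (forall z, z \in zs -> aug z) ->
    q (inc (\prod_(z <- zs) z * \prod_(x <- xs) x)) <=
    v zs * ((M * (size xs).+1%:R) ^+ d * w xs).
  elim: d => [_ zs xs sz az|d IHd dN zs xs sz az].
    by rewrite hN ?sz ?subn0 // mulr_ge0 // mulr_ge0 // exprn_ge0 // mulr_ge0.
  pose X (r : nat) : R := (M * r.+1%:R) ^+ d.
  have X1 r : 1 <= X r by rewrite exprn_ege1 // mulr_ege1 // ler1n.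
  have X_mono r s : (r <= s)%N -> X r <= X s.
    by move=> rs; rewrite lerXn2r ?nnegrE ?mulr_ge0 // ler_wpM2l // ler_nat ltnS.
  (* [u] is the section of the letters [ys] already read, [xs] the letters to come. Reading [x]
     replaces [u] by [u']; the error [c] joins [zs] and is treated by the bound for [d]. *)
  suff h ys u : is_section (chi_prods ys) u ->
      q (inc (\prod_(z <- zs) z * (u * \prod_(x <- xs) x))) <=
      v zs * ((M + (size xs)%:R * (M * X (size xs))) * (w ys * w xs)).
    have w1 : w [::] = 1 by rewrite /w big_nil.
    have := h [::] 1; rewrite mul1r w1 mul1r.
    rewrite (_ : chi_prods [::] = cst 1); last by apply/funext => x; rewrite /chi_prods big_nil.
    move=> /(_ section1) h'; apply: le_trans h' _; rewrite ler_wpM2l // ler_wpM2r //.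
    rewrite exprS -/(X (size xs)) -natr1 mulrDr mulr1 mulrDl addrC.
    by rewrite lerD // ?ler_peMr // mulrCA mulrA.
  elim: xs ys u => [|x xs IHxs] ys u su.
    rewrite big_nil mulr1 mul0r addr0 /w big_nil mulr1 -/(w ys).
    have -> : inc (\prod_(z <- zs) z * u) = \prod_(a <- rcons (map inc zs) (inc u)) a.
      by rewrite incM incprod -cats1 big_cat big_seq1.
    apply: le_trans (hq1 _ _) _; first by rewrite size_rcons size_map sz; lia.
    rewrite -cats1 big_cat big_seq1 big_map /= -/(v zs) ler_wpM2l //; exact: (hs1 _ _ su).
  have [u' su'] := exists_section (chi_prods_polyfun (rcons ys x)).
  pose c := u * x - u'.
  have ac : aug c.
    move=> y; rewrite /c (linear_funB (@chiL R g A y)) chiM.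
    case: su => _ [_ _ ->]; case: su' => _ [_ _ ->].
    by rewrite /chi_prods -cats1 big_cat big_seq1 subrr.
  rewrite big_cons (_ : u * (x * _) = c * \prod_(x <- xs) x + u' * \prod_(x <- xs) x); last first.
    by rewrite /c mulrBl subrK mulrA.
  rewrite mulrDr (linear_funD incL) (le_trans (seminormD cq.1 _ _)) //.
  have hc : q1 (inc c) <= M * (w ys * Q (inc x)).
    rewrite /c (linear_funB incL) (le_trans (seminormB cq1.1 _ _)) // incM.
    have h1 := le_trans (hq2 (inc u) (inc x)) (ler_wpM2r (q20 (inc x)) (hs2 _ _ su)).
    have h2 : q1 (inc u') <= M * w0' (rcons ys x).
      by apply: le_trans (hs _ _ su'); rewrite lerDl.
    apply: le_trans (lerD h1 h2) _.
    rewrite /w0' -cats1 big_cat big_seq1 /= -/(w0' ys) -mulrA -mulrDr -mulrDr.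
    by rewrite ler_wpM2l // -/(Q _) ler_wpM2r.
  have h1 : q (inc (\prod_(z <- zs) z * (c * \prod_(x <- xs) x))) <=
      v zs * (M * (w ys * Q (inc x))) * (X (size xs) * w xs).
    have h' := IHd (ltnW dN) (rcons zs c) xs.
    rewrite size_rcons sz subnSK // in h'; move/(_ erefl): h'.
    rewrite /v -cats1 !big_cat !big_seq1 -/(v zs) /= mulrA => h'.
    apply: le_trans (h' _) _.
      by move=> z; rewrite mem_cat inE => /orP[/az|/eqP ->].
    by rewrite ler_wpM2r ?mulr_ge0 ?exprn_ge0 ?mulr_ge0 // ler_wpM2l.
  have h2 := IHxs (rcons ys x) u' su'.
  apply: le_trans (lerD h1 h2) _.
  rewrite /w -cats1 big_cat big_seq1 [in leRHS]big_cons -/(w xs) -/(w ys) /=.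
  set a := w ys; set b := Q _; set e := w xs; set y := v zs.
  have -> : y * (M * (a * b)) * (X (size xs) * e) +
      y * ((M + (size xs)%:R * (M * X (size xs))) * (a * b * e)) =
      y * (M + ((size xs)%:R + 1) * (M * X (size xs))) * (a * b * e) by ring.
  rewrite natr1.
  have -> : y * ((M + (size xs).+1%:R * (M * X (size xs).+1)) * (a * (b * e))) =
      y * (M + (size xs).+1%:R * (M * X (size xs).+1)) * (a * b * e) by ring.
  rewrite ler_wpM2r ?mulr_ge0 ?w0 ?QQ // ler_wpM2l ?v0 // lerD2l.
  by rewrite ler_wpM2l // ler_wpM2l // X_mono.
(* The polynomial loss [(size xs).+1 ^ N] is at most [2 ^ (N * size xs)], that is, a factor [2 ^ N]
   for each letter. *)
exists (fun a => 2 ^+ N * Q a); first by apply: cont_seminormZ; rewrite ?exprn_ge0.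
exists (M ^+ N); first by rewrite exprn_ge0.
move=> xs; have := claim N (leqnn _) [::] xs; rewrite subnn /v !big_nil !mul1r.
move=> h; apply: le_trans (h erefl _) _ => //.
rewrite exprMn -mulrA ler_wpM2l ?exprn_ge0 // big_split /= -/(w xs) ler_wpM2r //.
rewrite big_const_seq count_predT iter_mulr_1 -exprM mulnC exprM lerXn2r ?nnegrE ?exprn_ge0 //.
rewrite -natrX ler_nat; exact: ltn_expl.
Qed.

End MultiplicativelyConvex.

Section SubmultiplicativeHull.
Variables (R : realType) (A : algType R) (Q : A -> R).
Hypothesis sQ : seminorm Q.
Let Q0 := seminorm_ge0 sQ.

Let val (r : seq (R * seq A)) : A := \sum_(p <- r) p.1 *: \prod_(x <- p.2) x.
Let wt (r : seq (R * seq A)) : R := \sum_(p <- r) `|p.1| * \prod_(x <- p.2) Q x.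

(* The largest submultiplicative seminorm below [Q]. *)
Definition submult_hull (a : A) : R := inf [set w | exists2 r, a = val r & w = wt r].
Local Notation rho := submult_hull.

Let wt_ge0 r : 0 <= wt r.
Proof. by apply: sumr_ge0 => p _; rewrite mulr_ge0 // prodr_ge0. Qed.

Let self a : a = val [:: (1, [:: a])].
Proof. by rewrite /val !big_seq1 scale1r. Qed.

Let has_inf_rho a : has_inf [set w | exists2 r, a = val r & w = wt r].
Proof.
split; first by exists (wt [:: (1, [:: a])]), [:: (1, [:: a])].
by exists 0 => _ [r _ ->].
Qed.

Let rho_le r : rho (val r) <= wt r.
Proof. by apply: ge_inf; [case: (has_inf_rho (val r))|exists r]. Qed.

Let rho_ge0 a : 0 <= rho a.
Proof.
apply: lb_le_inf; first by case: (has_inf_rho a).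
by move=> _ [r _ ->].
Qed.

Let rho_approx a e : 0 < e -> exists2 r, a = val r & wt r < rho a + e.
Proof.
move=> e0; have [_ [r ar ->] h] := inf_adherent e0 (has_inf_rho a).
by exists r.
Qed.

Let rhoD a b : rho (a + b) <= rho a + rho b.
Proof.
apply/ler_addgt0Pr => e e0; have e2 : 0 < e / 2 by rewrite divr_gt0.
have [r ar re] := rho_approx a e2; have [s bs se] := rho_approx b e2.
rewrite {1}ar {1}bs /val -big_cat /= -/(val _) (le_trans (rho_le _)) //.
rewrite /wt big_cat /= -/(wt r) -/(wt s).
by rewrite [e]splitr addrACA ltW // ltrD.
Qed.

Let rhoZle c a : rho (c *: a) <= `|c| * rho a.
Proof.
apply/ler_addgt0Pr => e e0.
have c1 : 0 < `|c| + 1 by rewrite ltr_wpDl.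
have [r ar re] := rho_approx a (divr_gt0 e0 c1).
have -> : c *: a = val [seq (c * p.1, p.2) | p <- r].
  rewrite [in LHS]ar /val big_map scaler_sumr; apply: eq_bigr => p _.
  by rewrite scalerA.
rewrite (le_trans (rho_le _)) // /wt big_map /=.
under eq_bigr => p _ do rewrite normrM -mulrA.
rewrite -mulr_sumr -/(wt r) (le_trans (ler_wpM2l (normr_ge0 c) (ltW re))) //.
rewrite mulrDr lerD2l mulrCA ler_piMr ?ltW //.
by rewrite ltr_pdivrMr // mul1r ltrDl.
Qed.

Let rhoZ c a : rho (c *: a) = `|c| * rho a.
Proof.
have [->|c0] := eqVneq c 0.
  apply/eqP; rewrite eq_le rhoZle /= normr0 mul0r; exact: rho_ge0.
apply/eqP; rewrite eq_le rhoZle /=.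
have := rhoZle c^-1 (c *: a); rewrite scalerA mulVf // scale1r normfV.
by rewrite ler_pdivlMl ?normr_gt0.
Qed.

Lemma submult_hull_seminorm : seminorm rho.
Proof. by split. Qed.

Lemma submult_hull_submult : submultiplicative rho.
Proof.
move=> a b; apply: le_mul_approx => // a' b' aa' bb'.
have [|r ar re] := @rho_approx a (a' - rho a); first by rewrite subr_gt0.
have [|s bs se] := @rho_approx b (b' - rho b); first by rewrite subr_gt0.
rewrite addrC subrK in re; rewrite addrC subrK in se.
have -> : a * b = val (allpairs (fun p q => (p.1 * q.1, p.2 ++ q.2)) r s).
  rewrite [in LHS]ar [in LHS]bs /val big_allpairs_dep big_distrl /=; apply: eq_bigr => p _.
  rewrite big_distrr /=; apply: eq_bigr => q _.
  by rewrite big_cat /= -scalerAl -scalerAr scalerA.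
rewrite (le_trans (rho_le _)) //; apply: (@le_trans _ _ (wt r * wt s)).
  rewrite /wt big_allpairs_dep big_distrl /=; apply: ler_sum => p _.
  rewrite big_distrr /=; apply: ler_sum => q _.
  by rewrite big_cat /= normrM mulrACA.
by apply: ler_pM => //; exact: ltW.
Qed.

Lemma submult_hull_le a : rho a <= Q a.
Proof.
rewrite [a in rho a]self (le_trans (rho_le _)) //.
by rewrite /wt !big_seq1 normr1 mul1r.
Qed.

Lemma submult_hull_ge (q : A -> R) C : seminorm q -> 0 <= C ->
  (forall xs, q (\prod_(x <- xs) x) <= C * \prod_(x <- xs) Q x) ->
  forall a, q a <= C * rho a.
Proof.
move=> sq C0 hq a; apply/ler_addgt0Pr => e e0.
have C1 : 0 < C + 1 by rewrite ltr_wpDl.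
have [r ar re] := rho_approx a (divr_gt0 e0 C1).
rewrite {1}ar (le_trans (seminorm_sum sq _ _ _)) //.
apply: (@le_trans _ _ (C * wt r)).
  rewrite /wt mulr_sumr; apply: ler_sum => p _.
  by rewrite (seminormZ sq) mulrCA ler_wpM2l.
rewrite (le_trans (ler_wpM2l C0 (ltW re))) // mulrDr lerD2l mulrCA ler_piMr ?ltW //.
by rewrite ltr_pdivrMr // mul1r ltrDl.
Qed.

End SubmultiplicativeHull.

Section ArensMichael.
Variables (R : realType) (g : lieAlg R) (A : cinf g).
Hypothesis tri : triangular g.
Local Notation inc := (@cinf_inc R g A).

Lemma mul_cont_seminorm (q : A -> R) a b : cont_seminorm q ->
  cont_seminorm (fun x : A => q (a * x * b)).
Proof.
move=> cq; have [q1 cq1 hq1] := mul_seminorm (@cinf_mul_continuous R g A) cq.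
have [q2 cq2 hq2] := mul_seminorm (@cinf_mul_continuous R g A) cq1.
have q10 := seminorm_ge0 cq1.1; have q20 := seminorm_ge0 cq2.1.
apply: (@seminorm_le_continuous _ _ _ (fun x => q2 a * q1 b * q2 x)).
- split=> [x y|c x]; first by rewrite mulrDr mulrDl seminormD //; case: cq.
  by rewrite -scalerAr -scalerAl seminormZ //; case: cq.
- by apply: cont_seminormZ => //; rewrite mulr_ge0.
- move=> x; rewrite mulrAC (le_trans (hq1 _ _)) // ler_wpM2r //.
Qed.

Lemma prod_bound (q : A -> R) : cont_seminorm q -> exists2 Q : A -> R, cont_seminorm Q &
  exists2 C, 0 <= C & forall xs : seq A, q (\prod_(x <- xs) x) <= C * \prod_(x <- xs) Q x.
Proof.
move=> cq; have [Q cQ [C C0 h]] := prod_bound_U tri cq; exists Q => //; exists C => //.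
(* Factors pass from [U] to [A] one at a time, by density and continuity in the single factor being
   moved. *)
suff H (s0 : seq (cinf_env A)) (s1 : seq A) : q (inc (\prod_(x <- s0) x) * \prod_(x <- s1) x)
    <= C * (\prod_(x <- s0) Q (inc x)) * \prod_(x <- s1) Q x.
  by move=> xs; have := H [::] xs; rewrite !big_nil inc1 mul1r mulr1.
elim: s1 s0 => [|y s1 IHs] s0; first by rewrite !big_nil !mulr1.
rewrite !big_cons.
have cont1 : continuous (fun y => q (inc (\prod_(x <- s0) x) * (y * \prod_(x <- s1) x))).
  have -> : (fun y => q (inc (\prod_(x <- s0) x) * (y * \prod_(x <- s1) x))) =
     (fun y => q (inc (\prod_(x <- s0) x) * y * \prod_(x <- s1) x)).
    by apply/funext => z; rewrite mulrA.
  by case: (mul_cont_seminorm (inc (\prod_(x <- s0) x)) (\prod_(x <- s1) x) cq).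
have Q0 := seminorm_ge0 cQ.1.
have cont2 : continuous (fun y => C * (\prod_(x <- s0) Q (inc x)) * (Q y * \prod_(x <- s1) Q x)).
  have -> : (fun y => C * (\prod_(x <- s0) Q (inc x)) * (Q y * \prod_(x <- s1) Q x)) =
     (fun y => C * (\prod_(x <- s0) Q (inc x)) * (\prod_(x <- s1) Q x) * Q y).
    by apply/funext => z; rewrite mulrA mulrAC.
  have h0 : 0 <= C * (\prod_(x <- s0) Q (inc x)) * (\prod_(x <- s1) Q x).
    by rewrite !mulr_ge0 // prodr_ge0.
  by case: (cont_seminormZ h0 cQ).
apply: (inc_dense_le cont1 cont2) => u.
have := IHs (rcons s0 u); rewrite -cats1 !big_cat !big_seq1 /= incM.
by rewrite !mulrA.
Qed.

Lemma submult_dominates (q : A -> R) : cont_seminorm q ->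
  exists p : A -> R, [/\ cont_seminorm p, submultiplicative p & forall a, q a <= p a].
Proof.
move=> cq; have [Q cQ [C C0 hQ]] := prod_bound cq.
have sr := submult_hull_seminorm cQ.1.
have cr : cont_seminorm (submult_hull Q).
  apply: (seminorm_le_continuous sr cQ); exact: submult_hull_le cQ.1.
have C1 : 0 <= C + 1 by rewrite addr_ge0.
have r0 := seminorm_ge0 sr.
(* Since [C + 1 >= 1], the rescaled hull is still submultiplicative. *)
exists (fun a => (C + 1) * submult_hull Q a); split; first exact: cont_seminormZ.
- move=> x y; rewrite mulrACA ler_pM ?mulr_ge0 //; last exact: submult_hull_submult cQ.1 x y.
  by rewrite ler_peMr // lerDr.
- move=> a; rewrite (le_trans (submult_hull_ge cQ.1 cq.1 C0 hQ a)) //.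
  by rewrite ler_wpM2r // lerDl.
Qed.

Theorem cinf_arens_michael : arens_michael A.
Proof.
have [hA cA _ _ _] := cinf_tensP A; split=> //.
have hp n : exists p : A -> R, [/\ cont_seminorm p, submultiplicative p &
    forall a, @pn R g A n a <= p a].
  by apply: submult_dominates; exact: pn_cont.
have [p hp'] := choice hp.
exists nat, p; split; last by move=> i; case: (hp' i).
apply: dominating_determines => [n|q cq]; first by case: (hp' n).
have [n [C C0 h]] := pn_dominates cq; exists n, C => // x.
by rewrite (le_trans (h x)) // ler_wpM2l //; case: (hp' n).
Qed.

End ArensMichael.

(** * Chebyshev expansions *)

Section PolynomiallyBounded.
Variable R : realType.
Implicit Types f h : nat -> R.

Definition poly_bounded f := (forall n, 0 <= f n) /\
  exists C e, 0 <= C /\ forall n, f n <= C * n.+1%:R ^+ e.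

Let pow_mono n e e' : (e <= e')%N -> (n.+1%:R : R) ^+ e <= n.+1%:R ^+ e'.
Proof. by move=> ee; rewrite ler_weXn2l // ler1n. Qed.

Lemma poly_bounded_cst (c : R) : 0 <= c -> poly_bounded (fun _ => c).
Proof. by move=> c0; split=> //; exists c, 0%N; split=> // n; rewrite mulr1. Qed.

Lemma poly_bounded_id : poly_bounded (fun n => n%:R).
Proof.
by split=> //; exists 1, 1%N; split=> // n; rewrite mul1r expr1 ler_nat.
Qed.

Lemma poly_boundedD f h : poly_bounded f -> poly_bounded h ->
  poly_bounded (fun n => f n + h n).
Proof.
move=> [f0 [C [e [C0 fC]]]] [h0 [C' [e' [C'0 hC]]]]; split=> [n|].
  by rewrite addr_ge0.
exists (C + C'), (maxn e e'); split=> [|n]; first by rewrite addr_ge0.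
rewrite mulrDl; apply: lerD; [apply: le_trans (fC n) _|apply: le_trans (hC n) _];
  by rewrite ler_wpM2l // pow_mono // ?leq_maxl ?leq_maxr.
Qed.

Lemma poly_boundedM f h : poly_bounded f -> poly_bounded h ->
  poly_bounded (fun n => f n * h n).
Proof.
move=> [f0 [C [e [C0 fC]]]] [h0 [C' [e' [C'0 hC]]]]; split=> [n|].
  by rewrite mulr_ge0.
exists (C * C'), (e + e')%N; split=> [|n]; first by rewrite mulr_ge0.
by rewrite exprD mulrACA ler_pM.
Qed.

Lemma poly_bounded_sum f : poly_bounded f -> poly_bounded (fun n => \sum_(i < n) f i).
Proof.
move=> [f0 [C [e [C0 fC]]]]; split=> [n|]; first exact: sumr_ge0.
exists C, e.+1; split=> // n; apply: (@le_trans _ _ (\sum_(i < n) C * n.+1%:R ^+ e)).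
  apply: ler_sum => i _; rewrite (le_trans (fC i)) // ler_wpM2l //.
  by rewrite lerXn2r ?nnegrE // ler_nat ltnS ltnW.
rewrite sumr_const card_ord exprS mulrCA -[leLHS]mulr_natl ler_wpM2r ?ler_nat //.
by rewrite mulr_ge0 ?exprn_ge0.
Qed.

Lemma poly_bounded_shift f : poly_bounded f -> poly_bounded (fun n => f n.+1).
Proof.
move=> [f0 [C [e [C0 fC]]]]; split=> [n //|]; exists (C * 2 ^+ e), e; split=> [|n].
  by rewrite mulr_ge0 ?exprn_ge0.
rewrite (le_trans (fC _)) // -mulrA -exprMn ler_wpM2l // lerXn2r ?nnegrE ?mulr_ge0 //.
by rewrite -natrM ler_nat; lia.
Qed.

End PolynomiallyBounded.

Section ChebyshevPolynomials.
Variable R : realType.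

Fixpoint chebT2 n : {poly R} * {poly R} :=
  if n is m.+1 then let: (u, v) := chebT2 m in (v, 2%:P * 'X * v - u) else (1, 'X).

Definition chebT n := (chebT2 n).1.

Fixpoint chebS2 n : {poly R} * {poly R} :=
  if n is m.+1 then let: (u, v) := chebS2 m in (v, 2%:P * 'X * v - u) else (0, 1).

(* The Chebyshev polynomials of the second kind, with [chebS n = U_(n-1)]. *)
Definition chebS n := (chebS2 n).1.

Lemma chebT_rec n : chebT n.+2 = 2%:P * 'X * chebT n.+1 - chebT n.
Proof. by rewrite /chebT /=; case: (chebT2 n). Qed.

Lemma chebS_rec n : chebS n.+2 = 2%:P * 'X * chebS n.+1 - chebS n.
Proof. by rewrite /chebS /=; case: (chebS2 n). Qed.

Lemma ind2 (P : nat -> Prop) : P 0%N -> P 1%N ->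
  (forall n, P n -> P n.+1 -> P n.+2) -> forall n, P n.
Proof.
move=> P0 P1 PS n; suff [] : P n /\ P n.+1 by [].
by elim: n => [//|n [h1 h2]]; split=> //; exact: PS.
Qed.

Lemma chebT_chebS n : chebT n.+1 = 'X * chebS n.+1 - chebS n.
Proof.
elim/ind2: n => [||n IH1 IH2].
- by rewrite /chebT /chebS /= mulr1 subr0.
- by rewrite chebT_rec chebS_rec /chebT /chebS /=; ring.
- by rewrite chebT_rec IH1 IH2 !chebS_rec; ring.
Qed.

Lemma chebS_step n : chebS n.+2 = chebS n + 2%:P * chebT n.+1.
Proof. by rewrite chebT_chebS chebS_rec; ring. Qed.

Lemma deriv_chebT n : (chebT n)^`() = n%:R%:P * chebS n.
Proof.
elim/ind2: n => [||n IH1 IH2].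
- by rewrite /chebT /chebS /= derivC mulr0.
- by rewrite /chebT /chebS /= derivX mulr1.
rewrite chebT_rec derivB IH1 !derivM derivC derivX IH2 chebT_chebS chebS_rec.
have e1 : n.+1%:R%:P = n%:R%:P + 1 :> {poly R} by rewrite -natr1 polyCD.
have e2 : n.+2%:R%:P = n%:R%:P + 2 :> {poly R}.
  by rewrite -[n.+2%:R]natr1 polyCD e1 polyC1; ring.
have e3 : 2%:P = 2 :> {poly R} by rewrite polyC_natr.
by rewrite e1 e2 e3; ring.
Qed.

Lemma chebT_cos n x : (chebT n).[cos x] = cos (n%:R * x).
Proof.
elim/ind2: n => [||n IH1 IH2].
- by rewrite /chebT /= hornerC mul0r cos0.
- by rewrite /chebT /= hornerX mul1r.
rewrite chebT_rec !hornerE IH1 IH2.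
have -> : n.+2%:R * x = n.+1%:R * x + x by rewrite -[n.+2]addn1 natrD mulrDl mul1r.
have -> : n%:R * x = n.+1%:R * x - x by rewrite -[n.+1]addn1 natrD mulrDl mul1r addrK.
by rewrite cosB cosD; ring.
Qed.

Lemma chebT_le1 n x : `|x| <= 1 -> `|(chebT n).[x]| <= 1.
Proof.
move=> x1; rewrite -[x]acosK ?chebT_cos; last by rewrite in_itv /= -ler_norml.
by rewrite ler_norml cos_geN1 cos_le1.
Qed.

(** Obtained by iterating [T_n' = n S_n] and bounding [S_n] by twice the sum of the [T_j] with
    [j < n]. *)
Fixpoint derivT_bound i n : R :=
  if i is i'.+1 then n%:R * (2 * \sum_(j < n) derivT_bound i' j) else 1.

Lemma derivT_bound_poly_bounded i : poly_bounded (derivT_bound i).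
Proof.
elim: i => [|i IHi] /=; first exact: poly_bounded_cst.
apply: poly_boundedM; first exact: poly_bounded_id.
by apply: poly_boundedM; [exact: poly_bounded_cst|exact: poly_bounded_sum].
Qed.

(** [S_(n+2) = S_n + 2 T_(n+1)] telescopes. A general linear [F] is allowed, so that the same
    transfer from [T] to [S] serves derivatives at a point and evaluation in an algebra. *)
Lemma chebS_sum (E : lmodType R) (q : E -> R) (F : {poly R} -> E) (t : nat -> R) n :
  seminorm q -> linear F -> (forall j, q (F (chebT j)) <= t j) -> (forall j, 0 <= t j) ->
  q (F (chebS n)) <= 2 * \sum_(j < n) t j.
Proof.
move=> sq lF hq t0; elim/ind2: n => [||n IH1 IH2].
- by rewrite /chebS /= (linear_fun0 lF) (seminorm0 sq) big_ord0 mulr0.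
- rewrite /chebS /= big_ord_recl big_ord0 addr0 (le_trans (hq 0%N)) //.
  by rewrite ler_peMl // ler1n.
rewrite chebS_step (linear_funD lF) mul_polyC (linear_funZ lF).
rewrite (le_trans (seminormD sq _ _)) // (seminormZ sq) ger0_norm //.
rewrite big_ord_recr big_ord_recr /= mulrDr lerD ?ler_wpM2l // (le_trans IH1) //.
by rewrite ler_wpM2l // lerDl.
Qed.

Lemma derivT_le i n x : `|x| <= 1 -> `|((chebT n)^`(i)).[x]| <= derivT_bound i n.
Proof.
move=> x1; elim: i n => [|i IHi] n; first exact: chebT_le1.
rewrite derivSn deriv_chebT.
have -> : ((n%:R%:P * chebS n)^`(i)).[x] = n%:R * ((chebS n)^`(i)).[x].
  by rewrite mul_polyC derivnZ hornerZ.
rewrite normrM normr_nat ler_wpM2l //.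
have sn : seminorm (fun y : R^o => `|y|).
  by split=> [y z|c y]; [exact: ler_normD|exact: normrM].
apply: (@chebS_sum R^o _ (fun p : {poly R} => (p^`(i)).[x] : R^o)) => //.
- by move=> c p q /=; rewrite derivnD derivnZ hornerD hornerZ.
- by move=> j; case: (derivT_bound_poly_bounded i).
Qed.

End ChebyshevPolynomials.

Section DiscreteOrthogonality.
Variable R : realType.

Lemma sum_cos_eq0 (M m : nat) : (0 < m < M)%N ->
  \sum_(j < M) cos (m%:R * (2 * pi * j%:R / M%:R)) = 0 :> R.
Proof.
move=> /andP[m0 mM]; have M0 : (0 : R) < M%:R by rewrite ltr0n; lia.
pose phi : R := pi * m%:R / M%:R.
have phi0 : 0 < phi by rewrite divr_gt0 // mulr_gt0 ?pi_gt0 // ltr0n.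
have phipi : phi < pi by rewrite ltr_pdivrMr // ltr_pM2l ?pi_gt0 // ltr_nat.
have sphi : sin phi != 0 by rewrite gt_eqF // sin_gt0_pi // phi0.
(* The angles advance by [2 phi], so multiplication by [2 sin phi] makes the sum telescope. *)
have h (n : nat) : 2 * sin phi * \sum_(j < n) cos (m%:R * (2 * pi * j%:R / M%:R)) =
    sin (2 * n%:R * phi - phi) + sin phi.
  elim: n => [|n IHn]; first by rewrite big_ord0 !mulr0 mul0r sub0r sinN addNr.
  rewrite big_ord_recr /= mulrDr IHn.
  have -> : m%:R * (2 * pi * n%:R / M%:R) = 2 * n%:R * phi :> R.
    by rewrite /phi; field; rewrite gt_eqF.
  have -> : 2 * n.+1%:R * phi - phi = 2 * n%:R * phi + phi.
    by rewrite -natr1; ring.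
  by rewrite sinB sinD; ring.
have nz : 2 * sin phi != 0 by rewrite mulf_neq0.
apply: (mulfI nz).
rewrite h mulr0.
have -> : 2 * M%:R * phi - phi = - phi + (pi *+ 2) *+ m.
  by rewrite /phi -[(pi *+ 2) *+ m]mulr_natr -[pi *+ 2]mulr_natr; field; rewrite gt_eqF.
by rewrite (periodicn (@sinD2pi R)) sinN addNr.
Qed.

(** The product-to-sum formula leaves the frequencies [n + i] and [|n - i|]; the hypothesis
    [n + i < M] keeps both below [M], where only frequency 0 survives. *)
Lemma sum_cos_cos (M n i : nat) : (n + i < M)%N ->
  \sum_(j < M) cos (n%:R * (2 * pi * j%:R / M%:R)) * cos (i%:R * (2 * pi * j%:R / M%:R)) =
  (if n == i then if n == 0%N then M%:R else M%:R / 2 else 0) :> R.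
Proof.
move=> niM.
have e j : cos (n%:R * (2 * pi * j%:R / M%:R)) * cos (i%:R * (2 * pi * j%:R / M%:R)) =
    2^-1 * cos ((n + i)%:R * (2 * pi * j%:R / M%:R)) +
    2^-1 * cos ((maxn n i - minn n i)%:R * (2 * pi * j%:R / M%:R)) :> R.
  set X := (2 * pi * j%:R / M%:R).
  have -> : (n + i)%:R * X = n%:R * X + i%:R * X by rewrite natrD mulrDl.
  have -> : cos ((maxn n i - minn n i)%:R * X) = cos (n%:R * X - i%:R * X).
    rewrite -mulrBl; have [le|lt] := leqP i n; first by rewrite natrB.
    by rewrite natrB ?(ltnW lt) // -cosN -mulNr opprB.
  rewrite cosD.
  by rewrite cosB; field.
under eq_bigr => j _ do rewrite e.
rewrite big_split /= -!mulr_sumr.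
have S0 m : m = 0%N -> \sum_(j < M) cos (m%:R * (2 * pi * j%:R / M%:R)) = M%:R :> R.
  move=> ->; under eq_bigr => j _ do rewrite mul0r cos0.
  by rewrite sumr_const card_ord.
have [ni|ni] := eqVneq n i.
  rewrite {}ni in niM e *.
  rewrite (S0 (_ - _)%N) ?maxnn ?minnn ?subnn //.
  have [i0|i0] := eqVneq i 0%N; first by rewrite S0 ?i0 //; field.
  by rewrite sum_cos_eq0 ?mulr0 ?add0r 1?mulrC //; lia.
by rewrite !sum_cos_eq0 ?mulr0 ?addr0 //; lia.
Qed.

End DiscreteOrthogonality.

Section ChebyshevExpansion.
Variables (R : realType) (B : algType R) (q : B -> R).
Hypothesis sq : seminorm q.
Local Notation lift := (map_poly (in_alg B)).
Implicit Types (p : {poly B}) (a : nat -> B).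

Definition cheb_sum a N : {poly B} := \sum_(i < N) (a i)%:P * lift (chebT R i).

Definition finsupp_below a N := forall i, (N <= i)%N -> a i = 0.

Lemma cheb_sum_widen a N N' : finsupp_below a N -> (N <= N')%N ->
  cheb_sum a N' = cheb_sum a N.
Proof.
move=> aN NN'; rewrite /cheb_sum -(subnKC NN') big_split_ord /= [X in _ + X]big1 ?addr0 //.
by move=> i _; rewrite aN ?mul0r // leq_addr.
Qed.

Let expandable p := exists N a, finsupp_below a N /\ p = cheb_sum a N.

Let expandableD p p' : expandable p -> expandable p' -> expandable (p + p').
Proof.
move=> [N [a [aN ->]]] [N' [a' [a'N ->]]].
exists (maxn N N'), (fun i => a i + a' i); split.
  by move=> i; rewrite geq_max => /andP[h h']; rewrite aN // a'N // addr0.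
rewrite -(cheb_sum_widen aN (leq_maxl N N')) -(cheb_sum_widen a'N (leq_maxr N N')).
rewrite /cheb_sum -big_split /=; apply: eq_bigr => i _.
by rewrite polyCD mulrDl.
Qed.

Let expandable1 (c : B) i : expandable (c%:P * lift (chebT R i)).
Proof.
exists i.+1, (fun j => if j == i then c else 0); split.
  by move=> j ij; rewrite gtn_eqF.
rewrite /cheb_sum big_ord_recr /= eqxx big1 ?add0r // => j _.
by rewrite ltn_eqF // mul0r.
Qed.

Lemma cheb_expansion p : exists N a, finsupp_below a N /\ p = cheb_sum a N.
Proof.
elim/poly_ind: p => [|p c [N [a [_ ->]]]].
  by exists 0%N, (fun=> 0); split=> //; rewrite /cheb_sum big_ord0.
apply: expandableD; last first.
  by have := expandable1 c 0; rewrite /chebT /= rmorph1 mulr1.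
rewrite /cheb_sum big_distrl /=.
elim/big_ind: _ => [||i _]; [|exact: expandableD|].
  by exists 0%N, (fun=> 0); split=> //; rewrite /cheb_sum big_ord0.
case: i => -[|i] /= _.
  have := expandable1 (a 0%N) 1; rewrite /chebT /= map_polyX rmorph1 mulr1; exact.
(* [X T_(i+1)] is the mean of [T_(i+2)] and [T_i]. *)
have := expandableD (expandable1 (2^-1 *: a i.+1) i.+2) (expandable1 (2^-1 *: a i.+1) i).
rewrite -mulrDr -rmorphD /= chebT_rec subrK -mulrA rmorphM /= mulrA; congr expandable.
rewrite rmorphM /= map_polyX map_polyC /= -commr_polyX mulrA; congr (_ * _ * _).
by rewrite -polyCM -[in LHS]mulr_algr -mulrA -scalerAl mul1r scalerA mulVf // scale1r mulr1.
Qed.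

Lemma horner_lift (f : {poly R}) (x : R) : (lift f).[x%:A] = (f.[x])%:A.
Proof. exact: (horner_map (in_alg B) f x). Qed.

Lemma cheb_sum_horner a N (x : R) :
  (cheb_sum a N).[x%:A] = \sum_(i < N) (chebT R i).[x] *: a i.
Proof.
rewrite /cheb_sum horner_sum; apply: eq_bigr => i _.
by rewrite hornerCM horner_lift mulr_algr.
Qed.

(** Discrete orthogonality recovers the coefficient from finitely many values at scalars, which is
    meaningful for coefficients in any algebra. *)
Lemma cheb_coef_le a N S n : finsupp_below a N ->
  (forall x, `|x| <= 1 -> q (cheb_sum a N).[x%:A] <= S) -> q (a n) <= 2 * S.
Proof.
move=> aN hS.
have S0 : 0 <= S by apply: le_trans (hS 0 _); rewrite ?normr0 ?seminorm_ge0.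
have [Nn|nN] := leqP N n; first by rewrite aN // seminorm0 // mulr_ge0.
(* With [2 N] nodes every frequency [n + i] is below the number of nodes. *)
pose M := (2 * N)%N; have M0 : (0 : R) < M%:R by rewrite ltr0n /M; lia.
pose th j : R := 2 * pi * j%:R / M%:R.
have e : \sum_(j < M) cos (n%:R * th j) *: (cheb_sum a N).[(cos (th j))%:A] =
    (if n == 0%N then M%:R else M%:R / 2) *: a n.
  under eq_bigr => j _ do rewrite cheb_sum_horner scaler_sumr.
  rewrite exchange_big /= (bigD1 (Ordinal nN)) //= [X in _ + X]big1 ?addr0.
    under eq_bigr => j _ do rewrite scalerA chebT_cos.
    rewrite -scaler_suml sum_cos_cos ?eqxx //; last by rewrite /M; lia.
  move=> i ne; under eq_bigr => j _ do rewrite scalerA chebT_cos.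
  rewrite -scaler_suml sum_cos_cos; last by rewrite /M; have := ltn_ord i; lia.
  by rewrite -(inj_eq val_inj) /= eq_sym in ne; rewrite (negPf ne) scale0r.
have h1 : q (\sum_(j < M) cos (n%:R * th j) *: (cheb_sum a N).[(cos (th j))%:A]) <= M%:R * S.
  rewrite (le_trans (seminorm_sum sq _ _ _)) //.
  apply: (@le_trans _ _ (\sum_(j < M) S)); last by rewrite sumr_const card_ord mulr_natl.
  have c1 j : `|cos (th j)| <= 1 by rewrite ler_norml cos_geN1 cos_le1.
  apply: ler_sum => j _; rewrite (seminormZ sq) -[leRHS]mul1r.
  apply: ler_pM; [exact: normr_ge0|exact: (seminorm_ge0 sq)| |exact: hS (c1 j)].
  by rewrite ler_norml cos_geN1 cos_le1.
rewrite e (seminormZ sq) in h1.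
have h2 : M%:R / 2 * q (a n) <= M%:R * S.
  apply: le_trans h1; apply: ler_wpM2r; first exact: (seminorm_ge0 sq).
  case: ifP => _; rewrite ger0_norm ?divr_ge0 //; try exact: ltW.
  by rewrite ler_pdivrMr // ler_peMr ?ltW //; rewrite (ltr_nat _ 1 2).
by move: h2; rewrite -mulrA ler_pM2l // mulrC ler_pdivrMr // mulrC.
Qed.

Lemma deriv_cheb_sum a N : (cheb_sum a N)^`() =
  \sum_(i < N) (a i *+ i)%:P * lift (chebS R i).
Proof.
rewrite /cheb_sum raddf_sum /=; apply: eq_bigr => i _.
rewrite derivM derivC mul0r add0r deriv_map deriv_chebT rmorphM /= map_polyC /= mulrA.
by rewrite -polyCM mulr_algr scaler_nat.
Qed.

(* Integrating [chebT n = (chebS n.+1 - chebS n.-1) / 2] term by term. *)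
Lemma cheb_primitive a b N : (0 < N)%N -> finsupp_below a N ->
  b 1%N = a 0%N - 2^-1 *: a 2%N ->
  (forall n, b n.+2 *+ n.+2 = 2^-1 *: (a n.+1 - a n.+3)) ->
  (cheb_sum b N.+1)^`() = cheb_sum a N.
Proof.
move=> N0 aN b1 b2; rewrite deriv_cheb_sum big_ord_recl /= mulr0n mul0r add0r.
suff h m : \sum_(i < m.+1) (b i.+1 *+ i.+1)%:P * lift (chebS R i.+1) =
    cheb_sum a m.+1 - (2^-1 *: a m.+1)%:P * lift (chebS R m) -
    (2^-1 *: a m.+2)%:P * lift (chebS R m.+1).
  have := h N.-1; rewrite prednK // => ->.
  by rewrite [a N]aN // [a N.+1]aN // !scaler0 !mul0r !subr0.
elim: m => [|m IHm].
  rewrite big_ord1 /cheb_sum big_ord1 b1 /chebT /chebS /= rmorph0 rmorph1 mulr0 !mulr1 subr0.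
  by rewrite polyCB.
rewrite big_ord_recr /= IHm /cheb_sum [in RHS]big_ord_recr /= -/(cheb_sum _ _).
rewrite b2 scalerBr polyCB mulrBl.
have -> : (a m.+1)%:P * lift (chebT R m.+1) =
    (2^-1 *: a m.+1)%:P * lift (chebS R m.+2) - (2^-1 *: a m.+1)%:P * lift (chebS R m).
  rewrite -mulrBr -rmorphB /= chebS_step addrC addKr rmorphM /= map_polyC /= mulrA.
  by rewrite -polyCM mulr_algr scalerA divff // scale1r.
by rewrite !addrA [LHS](ACl (1 * 4 * 2 * 3 * 5)).
Qed.

Lemma deriv_eq0 p : p^`() = 0 -> p = (p`_0)%:P.
Proof.
move=> p0; apply/polyP => -[|i]; rewrite coefC //=.
have := coef_deriv p i; rewrite p0 coef0 -scaler_nat => /esym/eqP.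
by rewrite scaler_eq0 pnatr_eq0 => /eqP.
Qed.

(** Induction on [r] by integrating the expansion of [p']: the new coefficient of index [n >= 2] is
    [(a_(n-1) - a_(n+1)) / (2 n)], a gain of one power of [n]. *)
Lemma cheb_decay r : exists2 C : R, 0 <= C & forall p S,
  (forall i (x : R), (i <= r)%N -> `|x| <= 1 -> q (p^`(i)).[x%:A] <= S) ->
  exists N a, [/\ finsupp_below a N, p = cheb_sum a N &
    forall n, q (a n) <= C * S / n.+1%:R ^+ r].
Proof.
elim: r => [|r [C C0 IH]].
  exists 2 => // p S hS; have [N [a [aN pE]]] := cheb_expansion p.
  exists N, a; split=> // n; rewrite expr0 divr1; apply: cheb_coef_le aN _ => x x1.
  by rewrite -pE; exact: (hS 0%N).
(* [C] serves the integrated coefficients, 2 those of index 0 and 1, which integration does not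
   improve. The power of 2 pays for [n + 1 <= 2 n], and for [n + 1 <= 2] at the small indices. *)
exists (2 ^+ r.+1 * (C + 2)).
  by rewrite mulr_ge0 ?exprn_ge0 // addr_ge0.
move=> p S hS.
have S0 : 0 <= S.
  by apply: le_trans (hS 0%N 0 _ _); rewrite ?normr0 //; exact: (seminorm_ge0 sq).
have [|N0 [a [aN0 dp ha]]] := IH p^`() S.
  by move=> i x ir x1; rewrite -derivSn; exact: hS.
pose N := N0.+1.
have aN : finsupp_below a N by move=> i Ni; rewrite aN0 // ltnW.
pose b c n := if n is n'.+1 then
    if n' is m.+1 then m.+2%:R^-1 *: (2^-1 *: (a m.+1 - a m.+3))
    else a 0%N - 2^-1 *: a 2%N
  else c.
have bN c : finsupp_below (b c) N.+1.
  case=> [//|[//|m]] Nm /=.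
  by rewrite !aN ?subrr ?scaler0 //; lia.
(* The constant of integration: [p] and the primitive with zero coefficient of [T_0] differ by
   it. *)
pose c := (p - cheb_sum (b 0) N.+1)`_0.
have pE : p = cheb_sum (b c) N.+1.
  have : p - cheb_sum (b 0) N.+1 = c%:P.
    apply: deriv_eq0; rewrite derivB (@cheb_primitive a) ?(cheb_sum_widen aN0) -?dp ?subrr //.
    by move=> n; rewrite -scaler_nat /b [LHS]scalerA mulfV ?scale1r ?pnatr_eq0.
  move=> /(canRL (subrK _)) ->; rewrite /cheb_sum !big_ord_recl /=.
  by rewrite polyC0 mul0r add0r /chebT /= rmorph1 mulr1.
exists N.+1, (b c); split=> //.
have b2 n : q (b c n) <= 2 * S.
  apply: cheb_coef_le (bN c) _ => x x1; rewrite -pE.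
  by have := hS 0%N x; exact.
have pw (n : nat) : 0 < n.+1%:R ^+ r.+1 :> R by rewrite exprn_gt0.
have small n : (n <= 1)%N -> q (b c n) <= 2 ^+ r.+1 * (C + 2) * S / n.+1%:R ^+ r.+1.
  move=> n1; apply: le_trans (b2 n) _; rewrite ler_pdivlMr //.
  rewrite [leLHS]mulrC mulrA ler_wpM2r // ler_pM ?exprn_ge0 //.
    by rewrite lerXn2r ?nnegrE // ler_nat; lia.
  by rewrite lerDr.
case=> [|[|m]]; [exact: small|exact: small|].
have hm j : (m.+1 <= j)%N -> q (a j) <= C * S / m.+2%:R ^+ r.
  move=> mj; apply: le_trans (ha j) _; apply: ler_wpM2l; first exact: mulr_ge0.
  by rewrite lef_pV2 ?posrE ?exprn_gt0 // lerXn2r ?nnegrE // ler_nat; lia.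
have h1 : q (b c m.+2) <= C * S / m.+2%:R ^+ r.+1.
  rewrite /= !(seminormZ sq) !ger0_norm ?invr_ge0 //.
  have -> : C * S / m.+2%:R ^+ r.+1 = m.+2%:R^-1 * (C * S / m.+2%:R ^+ r).
    by rewrite exprS invfM mulrCA.
  apply: ler_wpM2l; first by rewrite invr_ge0.
  rewrite mulrC ler_pdivrMr // mulr_natr mulr2n.
  apply: le_trans (seminormB sq _ _) _; apply: lerD; apply: hm; lia.
apply: le_trans h1 _.
apply: (@le_trans _ _ (2 ^+ r.+1 * (C + 2) * S / (2 * m.+2%:R) ^+ r.+1)).
  rewrite exprMn invfM mulrA; apply: ler_wpM2r; first by rewrite invr_ge0 exprn_ge0.
  have -> : 2 ^+ r.+1 * (C + 2) * S / 2 ^+ r.+1 = (C + 2) * S.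
    by rewrite -[2 ^+ r.+1 * _ * _]mulrA mulrAC divff ?mul1r // expf_neq0.
  by apply: ler_wpM2r => //; rewrite lerDl.
apply: ler_wpM2l; first by rewrite !mulr_ge0 ?exprn_ge0 // addr_ge0.
rewrite lef_pV2 ?posrE ?exprn_gt0 // ?mulr_gt0 //.
by rewrite lerXn2r ?nnegrE ?mulr_ge0 // -natrM ler_nat; lia.
Qed.

End ChebyshevExpansion.

(** * Growth of the Chebyshev polynomials of an element *)

Section HornerAlg.
Variables (R : realType) (U : algType R).

Lemma horner_algZ (u : U) c (p : {poly R}) : horner_alg u (c *: p) = c *: horner_alg u p.
Proof. by rewrite -mul_polyC rmorphM /= horner_algC mulr_algl. Qed.

Lemma horner_alg_linear (u : U) : linear (horner_alg u : {poly R} -> U).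
Proof. by move=> c p p'; rewrite rmorphD /= horner_algZ. Qed.

End HornerAlg.

Section ChebyshevGrowth.
Variables (R : realType) (U : algType R) (q : U -> R) (I : U -> Prop) (N : nat).
Hypotheses (sq : seminorm q) (mq : submultiplicative q).
Hypothesis I_nil : forall zs v, (N <= size zs)%N -> (forall z, z \in zs -> I z) ->
  q (\prod_(z <- zs) z * v) = 0.

Implicit Types u : U.

Let q0 := seminorm_ge0 sq.

Let q_prod zs y : q (\prod_(z <- zs) z * y) <= (\prod_(z <- zs) q z) * q y.
Proof.
elim: zs => [|z zs IHzs]; first by rewrite !big_nil !mul1r.
rewrite !big_cons -!mulrA (le_trans (mq _ _)) // ler_wpM2l ?q0 //.
Qed.

Let ev_rec u (P P' : {poly R}) : horner_alg u (2%:P * 'X * P - P') =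
  2 *: (horner_alg u P * u) - horner_alg u P'.
Proof.
rewrite -mulrA mul_polyC rmorphB /= horner_algZ -commr_polyX rmorphM /=.
by rewrite horner_algX.
Qed.

Let S0 u : horner_alg u (chebS R 0) = 0.
Proof. by rewrite /chebS /= rmorph0. Qed.

Let S1 u : horner_alg u (chebS R 1) = 1.
Proof. by rewrite /chebS /= rmorph1. Qed.

(* Duhamel's formula for the recursion defining [chebT]. *)
Lemma cheb_duhamel u (V d : nat -> U) n : V 0%N = 1 ->
  (forall j, d j = 2 *: (V j.+1 * u) - V j - V j.+2) ->
  horner_alg u (chebT R n) = V n + ((u - V 1%N) * horner_alg u (chebS R n) +
    \sum_(j < n) d j * horner_alg u (chebS R (n - j.+1))).
Proof.
move=> V0 hd; elim/ind2: n => [||n IH1 IH2].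
- by rewrite big_ord0 S0 mulr0 V0 !addr0 /chebT /= rmorph1.
- by rewrite big_ord1 subnn S0 S1 mulr0 mulr1 addr0 addrC subrK /chebT /= horner_algX.
have VE : V n.+2 = 2 *: (V n.+1 * u) - V n - d n by rewrite hd opprB addrCA subrr addr0.
rewrite VE chebT_rec ev_rec IH1 IH2 chebS_rec ev_rec.
have sE : \sum_(j < n.+2) d j * horner_alg u (chebS R (n.+2 - j.+1)) =
    2 *: (\sum_(j < n.+1) d j * horner_alg u (chebS R (n.+1 - j.+1)) * u) -
    \sum_(j < n) d j * horner_alg u (chebS R (n - j.+1)) + d n.
  rewrite !big_ord_recr /= !subnn !S0 subSS subSnn S1 !mulr0 addr0 mul0r addr0 mulr1.
  congr (_ + _); rewrite scaler_sumr -sumrB; apply: eq_bigr => j _.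
  have jn := ltn_ord j.
  have e1 : (n.+1 - j)%N = (n - j.+1).+2 by lia.
  have e2 : (n - j)%N = (n - j.+1).+1 by lia.
  by rewrite !subSS e1 e2 chebS_rec ev_rec mulrBr -mulrA -scalerAr.
rewrite sE -big_distrl /=.
set s1 := \sum_(j < n) _; set s2 := \sum_(j < n.+1) _; set D := u - _.
rewrite mulrBr -scalerAr !mulrA !mulrDl !scalerDr !opprD !addrA.
by rewrite [RHS](ACl (1 * 4 * 5 * 8 * 2 * 6 * 7 * 9 * (3 * 10))) /= addNr addr0.
Qed.

(** [V] follows the recursion of [T_n(u)] up to errors in [I]. Duhamel's formula puts such an error
    in front of an [S_m(u)], and [chebS_sum] reduces this to [T_j(u)] with one more factor from [I]
    in front; with [N] such factors all is zero. The bound [h] is fixed before [u], hence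
    uniform. *)
Lemma cheb_growth (v : nat -> R) : poly_bounded v -> exists h, poly_bounded h /\
  forall u (V : nat -> U), q u <= 1 -> V 0%N = 1 -> I (u - V 1%N) ->
    (forall n, I (2 *: (V n.+1 * u) - V n - V n.+2)) -> (forall n, q (V n) <= v n) ->
    forall n, q (horner_alg u (chebT R n)) <= h n.
Proof.
move=> pv; have v0 := pv.1.
pose dl n := 2 * v n.+1 + v n + v n.+2.
have pdl : poly_bounded dl.
  have h1 := poly_bounded_shift pv; have h2 := poly_bounded_shift h1.
  apply: poly_boundedD h2; apply: poly_boundedD pv.
  by apply: poly_boundedM h1; exact: poly_bounded_cst.
suff H d : (d <= N)%N -> exists h, poly_bounded h /\
  forall u (V : nat -> U), q u <= 1 -> V 0%N = 1 -> I (u - V 1%N) ->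
    (forall n, I (2 *: (V n.+1 * u) - V n - V n.+2)) -> (forall n, q (V n) <= v n) ->
    forall zs n, size zs = (N - d)%N -> (forall z, z \in zs -> I z) ->
    q (\prod_(z <- zs) z * horner_alg u (chebT R n)) <= (\prod_(z <- zs) q z) * h n.
  have [h [ph hh]] := H N (leqnn _); exists h; split=> // u V qu V0 IV Id qV n.
  have := hh u V qu V0 IV Id qV [::] n; rewrite !big_nil !mul1r subnn; exact.
elim: d => [_|d IHd dN].
  exists (fun=> 0); split; first exact: poly_bounded_cst.
  by move=> u V _ _ _ _ _ zs n sz Iz; rewrite I_nil ?sz ?subn0 // mulr0.
have [h [ph hh]] := IHd (ltnW dN); have h0 := ph.1.
pose H n := 2 * \sum_(i < n) h i.
have pH : poly_bounded H.
  by apply: poly_boundedM; [exact: poly_bounded_cst|exact: poly_bounded_sum].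
exists (fun n => v n + ((1 + v 1%N) * H n + (\sum_(j < n) dl j) * H n)); split.
  apply: poly_boundedD => //; apply: poly_boundedD; apply: poly_boundedM => //.
    by apply: poly_bounded_cst; rewrite addr_ge0.
  exact: poly_bounded_sum.
move=> u V qu V0 IV Id qV zs n sz Iz.
pose dd j := 2 *: (V j.+1 * u) - V j - V j.+2.
have pz : 0 <= \prod_(z <- zs) q z by apply: prodr_ge0 => z _; exact: q0.
have hS c m : I c -> (m <= n)%N ->
    q (\prod_(z <- zs) z * (c * horner_alg u (chebS R m))) <= (\prod_(z <- zs) q z) * (q c * H n).
  move=> Ic mn.
  have l : linear (fun P : {poly R} => \prod_(z <- rcons zs c) z * horner_alg u P).
    by move=> a P P'; rewrite horner_alg_linear mulrDr scalerAr.
  have := @chebS_sum R U q _ (fun j => (\prod_(z <- zs) q z) * q c * h j) m sq l _ _.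
  rewrite -cats1 !big_cat !big_seq1 /= -!mulrA => hc; apply: le_trans (hc _ _) _.
  - move=> j; have := hh u V qu V0 IV Id qV (rcons zs c) j.
    rewrite size_rcons sz subnSK // -cats1 !big_cat !big_seq1 /= -!mulrA; apply => //.
    by move=> z; rewrite mem_cat inE => /orP[/Iz|/eqP ->].
  - by move=> j; rewrite !mulr_ge0.
  - rewrite -mulr_sumr mulrCA -!mulrA; apply: ler_wpM2l => //; apply: ler_wpM2l => //.
    apply: ler_wpM2l => //; rewrite -(subnKC mn) big_split_ord /= lerDl.
    by apply: sumr_ge0 => i _.
rewrite (@cheb_duhamel u V dd) // !mulrDr (le_trans (seminormD sq _ _)) //.
apply: lerD.
  by apply: le_trans (q_prod _ _) _; rewrite ler_wpM2l.
rewrite (le_trans (seminormD sq _ _)) //; apply: lerD.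
  apply: le_trans (hS _ _ IV (leqnn n)) _; rewrite ler_wpM2l // ler_wpM2r //; first exact: pH.1.
  by rewrite (le_trans (seminormB sq _ _)) // lerD.
rewrite mulr_sumr (le_trans (seminorm_sum sq _ _ _)) // mulr_suml mulr_sumr.
apply: ler_sum => j _; apply: le_trans (hS _ _ (Id _) _) _; first by lia.
rewrite ler_wpM2l // ler_wpM2r //; first exact: pH.1.
rewrite (le_trans (seminormB sq _ _)) // lerD // (le_trans (seminormB sq _ _)) // lerD //.
rewrite (seminormZ sq) ger0_norm // ler_wpM2l // (le_trans (mq _ _)) //.
by rewrite -[leRHS]mulr1 ler_pM.
Qed.

End ChebyshevGrowth.

Section PolynomialComposition.
Variables (R : realType) (k : nat).
Local Notation V := 'rV[R]_k.
Implicit Types f : V -> R^o.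

Lemma polyfun_horner f (p : {poly R}) : polyfun f -> polyfun (fun x => p.[f x] : R^o).
Proof.
move=> pf; elim/poly_ind: p => [|p c IHp].
  rewrite (_ : (fun x => _) = cst 0); first exact: polyfun_cst.
  by apply/funext => x; rewrite horner0.
rewrite (_ : (fun x => _) = ((fun x => p.[f x] : R^o) \* f) \+ cst c).
  by apply: polyfun_add (polyfun_cst _ _); exact: polyfun_mul.
by apply/funext => x; rewrite hornerMXaddC.
Qed.

Lemma partial_cst (i : 'I_k) (a : R) : partial i (cst a : V -> R^o) = cst 0.
Proof. by apply/funext => x; exact: derive_cst. Qed.

Lemma partial_horner f (p : {poly R}) i : polyfun f ->
  partial i (fun x => p.[f x] : R^o) = (fun x => (p^`()).[f x] : R^o) \* partial i f.
Proof.
move=> pf; elim/poly_ind: p => [|p c IHp].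
  rewrite (_ : (fun x => _) = cst 0); last by apply/funext => x; rewrite horner0.
  by rewrite partial_cst; apply/funext => x; rewrite /= deriv0 horner0 mul0r.
rewrite (_ : (fun x => _) = ((fun x => p.[f x] : R^o) \* f) \+ cst c); last first.
  by apply/funext => x; rewrite hornerMXaddC.
have pp := polyfun_horner p pf.
rewrite partialD //; [|exact: polyfun_mul|exact: polyfun_cst].
rewrite partialM // IHp derivD derivM derivX derivC.
rewrite partial_cst; apply/funext => x /=; rewrite !hornerE /=; ring.
Qed.

(** The chain rule turns a derivative into a factor [partial i f], whose jets are at most 1, and one
    more derivative of [p]; so the bound is linear in [G]. *)
Lemma jet_le_horner s c : exists2 K : R, 0 <= K & forall f (p : {poly R}) G, polyfun f ->
  0 <= G -> jet_le s c f 1 ->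
  (forall i x, (i <= s)%N -> `|x| <= 1 -> `|(p^`(i)).[x]| <= G) ->
  jet_le s c (fun x => p.[f x]) (K * G).
Proof.
elim: s => [|s [K K0 IHs]].
  exists 1 => // f p G pf G0 /jet_le0 hf hp; rewrite mul1r jet_le0 => x xc.
  exact: (hp 0%N _ _ (hf x xc)).
exists (1 + 2 ^+ s * K); first by rewrite addr_ge0 // mulr_ge0 ?exprn_ge0.
move=> f p G pf G0 hf hp; have [h0 h1] := (jet_leS s c f 1).1 hf.
rewrite jet_leS; split=> [x xc|i].
  apply: le_trans (hp 0%N _ _ (h0 x xc)) _ => //.
  by rewrite mulrDl mul1r lerDl !mulr_ge0 ?exprn_ge0.
rewrite partial_horner //.
apply: (@jet_le_mono _ _ s s c c _ (2 ^+ s * (K * G * 1))) => //.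
  by rewrite mulr1 mulrA ler_wpM2r // lerDr.
apply: jet_leM => //; first exact: mulr_ge0.
- exact: polyfun_horner.
- exact: polyfun_partial.
apply: IHs => //; first by apply: jet_le_mono hf.
by move=> j x js x1; rewrite -derivSn; exact: hp.
Qed.

End PolynomialComposition.

Lemma tvs_continuousD (R : realType) (T : topologicalType) (E : tvsType R) (f f' : T -> E) :
  continuous f -> continuous f' -> continuous (fun x => f x + f' x).
Proof.
move=> cf cf' x; apply: (@cvg_comp2 _ _ _ _ _ (nbhs (f x)) (nbhs (f' x)) _ _ _ _ f f' +%R).
- exact: cf.
- exact: cf'.
- exact: (@add_continuous E (f x, f' x)).
Qed.

(** * A functional calculus in one element *)

Section CalculusEstimate.
Variables (R : realType) (g : lieAlg R) (A : cinf g).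
Hypothesis tri : triangular g.
Local Notation U := (cinf_env A).
Local Notation inc := (@cinf_inc R g A).
Local Notation chi := (@chi R g A).
Local Notation aug := (@aug R g A).
Local Notation pn := (@pn R g A).

Lemma inc_horner_alg (u : U) p : inc (horner_alg u p) = horner_alg (inc u) p.
Proof.
elim/poly_ind: p => [|p c IHp]; first by rewrite !rmorph0 (linear_fun0 (@incL R g A)).
rewrite !rmorphD !rmorphM /= !horner_algX !horner_algC.
by rewrite (linear_funD (@incL R g A)) incM IHp (linear_funZ (@incL R g A)) inc1.
Qed.

Lemma cinf_continuousM (T : topologicalType) (f f' : T -> A) : continuous f -> continuous f' ->
  continuous (fun x => f x * f' x).
Proof.
move=> cf cf' x; apply: (@cvg_comp2 _ _ _ _ _ (nbhs (f x)) (nbhs (f' x)) _ _ _ _ f f' *%R).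
- exact: cf.
- exact: cf'.
- exact: (@cinf_mul_continuous R g A (f x, f' x)).
Qed.

Lemma horner_alg_continuous (p : {poly R}) : continuous (fun a : A => horner_alg a p).
Proof.
elim/poly_ind: p => [|p c IHp].
  rewrite (_ : (fun a => _) = cst 0); first exact: cst_continuous.
  by apply/funext => a; rewrite rmorph0.
rewrite (_ : (fun a => _) = fun a => horner_alg a p * a + c%:A); last first.
  by apply/funext => a; rewrite rmorphD rmorphM /= horner_algX horner_algC.
apply: (@tvs_continuousD R _ A (fun a => horner_alg a p * a) (cst c%:A)); last exact: cst_continuous.
by apply: (@cinf_continuousM _ (fun a => horner_alg a p) id) => // a; exact: cvg_id.
Qed.

(** If [pn s (inc u) <= 1], the symbol of [u] and its jets are at most 1 on the cube, where the
    [T_n] and their derivatives are polynomially bounded. The sections of [T_n] of the symbol are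
    the comparison sequence for [cheb_growth]. *)
Lemma cheb_growth_U (q : A -> R) : cont_seminorm q -> submultiplicative q ->
  exists2 Q : A -> R, cont_seminorm Q & exists h, poly_bounded h /\
  forall u n, Q (inc u) <= 1 -> q (horner_alg (inc u) (chebT R n)) <= h n.
Proof.
move=> cq mq; have [N hN] := aug_vanish tri cq.
have [s [C C0 hC]] := is_section_bound cq.
have [K K0 hK] := @jet_le_horner R (cinf_k A) s s%:R.
pose G n := \sum_(i < s.+1) derivT_bound R i n.
have pG : poly_bounded G.
  rewrite /G; elim: s.+1 => [|m IHm].
    rewrite (_ : (fun n => _) = fun=> 0); first exact: poly_bounded_cst.
    by apply/funext => n; rewrite big_ord0.
  rewrite (_ : (fun n => _) = fun n => \sum_(i < m) derivT_bound R i n + derivT_bound R m n).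
    by apply: poly_boundedD => //; exact: derivT_bound_poly_bounded.
  by apply/funext => n; rewrite big_ord_recr.
have G0 := pG.1.
pose v n := q (inc 1) + C * (K * G n).
have pv : poly_bounded v.
  apply: poly_boundedD; first exact: poly_bounded_cst (seminorm_ge0 cq.1 _).
  by apply: poly_boundedM; [exact: poly_bounded_cst|apply: poly_boundedM => //; exact: poly_bounded_cst].
have sqU : seminorm (fun u : U => q (inc u)).
  split=> [x y|c x]; first by rewrite (linear_funD (@incL R g A)) (seminormD cq.1).
  by rewrite (linear_funZ (@incL R g A)) (seminormZ cq.1).
have mqU : submultiplicative (fun u : U => q (inc u)) by move=> x y; rewrite incM.
have [h [ph hh]] := cheb_growth sqU mqU hN pv.
exists (fun a => q a + pn s a); first by apply: cont_seminormD => //; exact: pn_cont.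
exists h; split=> // u n Qu.
have qu : q (inc u) <= 1.
  by apply: le_trans Qu; rewrite lerDl; apply: seminorm_ge0; case: (pn_cont A s).
have pu : pn s (inc u) <= 1.
  by apply: le_trans Qu; rewrite lerDr; apply: (seminorm_ge0 cq.1).
pose f x : R^o := chi x u; have pf : polyfun f by exact: polyfun_chi.
have hf : jet_le s s%:R f 1 by apply: jet_le_mono (@jet_le_chi R g A s u).
have [V0 hV0] := choice (fun n => exists_section (polyfun_horner (chebT R n) pf)).
(* The chosen section of [T_0] is replaced by 1 itself, because Duhamel's formula requires [V 0 = 1]
   exactly. *)
pose V n := if n is 0%N then 1 else V0 n.
have chiV m x : chi x (V m) = (chebT R m).[chi x u].
  case: m => [|m] /=; first by rewrite chi1 /chebT /= hornerC.
  by case: (hV0 m.+1) => _ [_ _ ->].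
rewrite -inc_horner_alg; apply: (hh u V) => //.
- by move=> x; rewrite (linear_funB (@chiL R g A x)) chiV /chebT /= hornerX subrr.
- move=> m x; rewrite !(linear_funB (@chiL R g A x)) (linear_funZ (@chiL R g A x)) chiM !chiV.
  by rewrite chebT_rec !hornerE /= /GRing.scale /=; ring.
case=> [|m]; first by rewrite /v /= lerDl !mulr_ge0.
rewrite /v; apply: (@le_trans _ _ (C * (K * G m.+1))); last first.
  by rewrite lerDr; exact: seminorm_ge0 cq.1 _.
apply: hC (hV0 m.+1) _; first exact: mulr_ge0.
apply: hK => // i x i_s x1; apply: le_trans (derivT_le _ _ x1) _.
rewrite /G (bigD1 (Ordinal (i_s : (i < s.+1)%N))) //= lerDl; apply: sumr_ge0 => j _.
by case: (derivT_bound_poly_bounded R j).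
Qed.

(** The strict inequality [Q a < 1] makes the set of counterexamples open, so a nonempty one would
    meet the dense image of [U]. *)
Lemma cheb_growth_cinf (q : A -> R) : cont_seminorm q -> submultiplicative q ->
  exists2 Q : A -> R, cont_seminorm Q & exists h, poly_bounded h /\
  forall a n, Q a < 1 -> q (horner_alg a (chebT R n)) <= h n.
Proof.
move=> cq mq; have [Q cQ [h [ph hh]]] := cheb_growth_U cq mq.
exists Q => //; exists h; split=> // a n Qa; rewrite leNgt; apply/negP => ha.
have cT : continuous (fun a : A => q (horner_alg a (chebT R n))).
  move=> b; apply: (@continuous_comp _ _ _ (fun a : A => horner_alg a (chebT R n)) q).
    exact: horner_alg_continuous.
  exact: cq.2.
pose O := [set b : A | Q b < 1] `&` [set b | h n < q (horner_alg b (chebT R n))].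
have oO : open O.
  apply: openI.
    by apply: (@open_comp _ _ Q [set x | x < 1]) => [x _|]; [exact: cQ.2|exact: open_lt].
  apply: (@open_comp _ _ (fun b => q (horner_alg b (chebT R n))) [set x | h n < x]) => [x _|].
    exact: cT.
  exact: open_gt.
have [|b [[/= Qb hb] [u _ ub]]] := (@cinf_inc_dense R g A) O _ oO.
  by exists a.
by move: hb; rewrite -ub ltNge hh // ub; exact: ltW.
Qed.

Lemma sum_inv_sqr_le N : \sum_(i < N) (i.+1%:R ^+ 2)^-1 <= 2 :> R.
Proof.
(* The increment [2 / (x (x + 1))] of the right side dominates [1 / x^2] for [x >= 1]. *)
suff h : \sum_(i < N) (i.+1%:R ^+ 2)^-1 <= 2 - 2 / N.+1%:R :> R.
  by rewrite (le_trans h) // gerBl divr_ge0.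
elim: N => [|N IHN]; first by rewrite big_ord0 divr1 subrr.
rewrite big_ord_recr /= (le_trans (lerD IHN (lexx _))) //.
have -> : N.+2%:R = N.+1%:R + 1 :> R by rewrite -natr1.
set x : R := N.+1%:R; have x1 : 1 <= x by rewrite ler1n.
rewrite -subr_ge0.
have -> : 2 - 2 / (x + 1) - (2 - 2 / x + (x ^+ 2)^-1) = (x - 1) / (x ^+ 2 * (x + 1)).
  by field; rewrite !gt_eqF //; lra.
by rewrite divr_ge0 ?mulr_ge0 ?exprn_ge0 //; lra.
Qed.

(** If [T_n(a)] grows like [n^e], then [e + 2] derivatives make the coefficients decay like
    [n^(-e-2)] and leave the summable [n^(-2)]. *)
Lemma calculus_estimate (q : A -> R) : cont_seminorm q -> submultiplicative q ->
  exists2 Q : A -> R, cont_seminorm Q & exists r, exists2 C, 0 <= C &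
  forall a (p : {poly A}) S, Q a < 1 ->
    (forall i x, (i <= r)%N -> `|x| <= 1 -> q (p^`(i)).[x%:A] <= S) -> q p.[a] <= C * S.
Proof.
move=> cq mq; have [Q cQ [h [[h0 [Ch [e [Ch0 hC]]]] hh]]] := cheb_growth_cinf cq mq.
have [C C0 hdec] := cheb_decay cq.1 e.+2.
exists Q => //; exists e.+2, (C * Ch * 2); first by rewrite !mulr_ge0.
move=> a p S Qa hS; have [N [c [_ -> hc]]] := hdec p S hS.
have S0 : 0 <= S.
  by apply: le_trans (hS 0%N 0 _ _); rewrite ?normr0 //; exact: seminorm_ge0 cq.1 _.
rewrite /cheb_sum horner_sum (le_trans (seminorm_sum cq.1 _ _ _)) //.
apply: (@le_trans _ _ (\sum_(i < N) C * S * Ch * (i.+1%:R ^+ 2)^-1)); last first.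
  have -> : C * Ch * 2 * S = C * S * Ch * 2 by ring.
  by rewrite -mulr_sumr; apply: ler_wpM2l; [rewrite !mulr_ge0|exact: sum_inv_sqr_le].
apply: ler_sum => i _; rewrite hornerCM (le_trans (mq _ _)) //.
have := ler_pM (seminorm_ge0 cq.1 _) (seminorm_ge0 cq.1 _) (hc i) (le_trans (hh a i Qa) (hC i)).
move=> H; apply: le_trans H _.
have i0 : 0 < i.+1%:R :> R by rewrite ltr0n.
rewrite -addn2 exprD invfM.
set y := _ ^+ e; set z := _ ^+ 2.
have y0 : y != 0 by rewrite gt_eqF ?exprn_gt0.
suff -> : C * S * (y^-1 / z) * (Ch * y) = C * S * Ch / z by [].
by field; rewrite y0 gt_eqF ?exprn_gt0.
Qed.

End CalculusEstimate.

(** * Polynomial growth *)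

Section TaylorPolynomials.
Variable R : realType.
Implicit Types s t x : R.

Definition cos_poly s m : {poly R} := \sum_(n < m) cos_coeff s n *: 'X^n.
Definition sin_poly s m : {poly R} := \sum_(n < m) sin_coeff s n *: 'X^n.

Lemma cos_coeffM s x n : cos_coeff (s * x) n = cos_coeff s n * x ^+ n.
Proof. by rewrite /cos_coeff /= exprMn; ring. Qed.

Lemma sin_coeffM s x n : sin_coeff (s * x) n = sin_coeff s n * x ^+ n.
Proof. by rewrite /sin_coeff /= exprMn; ring. Qed.

Lemma cos_coeffS s n : cos_coeff s n.+1 * n.+1%:R = - s * sin_coeff s n.
Proof.
have n1 : n.+1%:R != 0 :> R by rewrite pnatr_eq0.
have f0 : n`!%:R != 0 :> R by rewrite pnatr_eq0 -lt0n fact_gt0.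
rewrite /cos_coeff /sin_coeff /= factS natrM exprS negbK.
have [on|on] /= := boolP (odd n); last by rewrite !mul0r mulr0.
have -> : (-1) ^ uphalf n = - (-1) ^ n.-1./2 :> R.
  by case: n on {n1 f0} => [//|n] /= _; rewrite -!exprnP exprS mulN1r.
by rewrite -exprnP; field; rewrite f0 nat1r n1.
Qed.

Lemma sin_coeffS s n : sin_coeff s n.+1 * n.+1%:R = s * cos_coeff s n.
Proof.
have n1 : n.+1%:R != 0 :> R by rewrite pnatr_eq0.
have f0 : n`!%:R != 0 :> R by rewrite pnatr_eq0 -lt0n fact_gt0.
rewrite /cos_coeff /sin_coeff /= factS natrM exprS.
by rewrite -?exprnP; field; rewrite f0 nat1r n1.
Qed.

Lemma deriv_cos_poly s m : (cos_poly s m.+1)^`() = (- s) *: sin_poly s m.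
Proof.
rewrite /cos_poly big_ord_recl /= derivD derivZ derivC scaler0 add0r raddf_sum scaler_sumr /=.
apply: eq_bigr => i _; rewrite derivZ derivXn /= -scaler_nat !scalerA.
by rewrite /bump /= add1n cos_coeffS.
Qed.

Lemma deriv_sin_poly s m : (sin_poly s m.+1)^`() = s *: cos_poly s m.
Proof.
rewrite /sin_poly big_ord_recl /= derivD derivZ derivC scaler0 add0r raddf_sum scaler_sumr /=.
apply: eq_bigr => i _; rewrite derivZ derivXn /= -scaler_nat !scalerA.
by rewrite /bump /= add1n sin_coeffS.
Qed.

Lemma cos_poly_horner s m x : (cos_poly s m).[x] = series (cos_coeff (s * x)) m.
Proof.
rewrite /series /= big_mkord /cos_poly horner_sum; apply: eq_bigr => i _.
by rewrite hornerZ hornerXn cos_coeffM.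
Qed.

Lemma sin_poly_horner s m x : (sin_poly s m).[x] = series (sin_coeff (s * x)) m.
Proof.
rewrite /series /= big_mkord /sin_poly horner_sum; apply: eq_bigr => i _.
by rewrite hornerZ hornerXn sin_coeffM.
Qed.

Lemma series_exp_tail (u : nat -> R) t s m : `|t| <= s -> cvgn (series u) ->
  (forall n, `|u n| <= exp_coeff `|t| n) ->
  `|limn (series u) - series u m| <= expR s - series (exp_coeff s) m.
Proof.
move=> ts cu ut; have s0 : 0 <= s by exact: le_trans (normr_ge0 t) ts.
have ce := is_cvg_series_exp_coeff s.
have mono : nondecreasing_seq (series (exp_coeff s)).
  by apply/nondecreasing_seqP => n; rewrite /series /= big_nat_recr //= lerDl exp_coeff_ge0.
have us n : `|u n| <= exp_coeff s n.
  by rewrite (le_trans (ut n)) // /exp_coeff /= ler_wpM2r // lerXn2r ?nnegrE.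
have h n : (m <= n)%N -> `|series u n - series u m| <= expR s - series (exp_coeff s) m.
  move=> mn; apply: (@le_trans _ _ (series (exp_coeff s) n - series (exp_coeff s) m)).
    rewrite !sub_series_geq // (le_trans (ler_norm_sum _ _ _)) //; exact: ler_sum.
  by rewrite lerD2r; exact: nondecreasing_cvgn_le.
have c : (fun n => `|series u n - series u m|) @ \oo --> `|limn (series u) - series u m|.
  by apply: cvg_norm; apply: cvgB => //; exact: cvg_cst.
rewrite -(cvg_lim _ c) //; apply: limr_le; first by apply/cvg_ex; eexists; exact: c.
by exists m.
Qed.

Lemma trig_coeff_le x n : `|cos_coeff x n| <= exp_coeff `|x| n /\
  `|sin_coeff x n| <= exp_coeff `|x| n.
Proof.
rewrite /exp_coeff /cos_coeff /sin_coeff /=.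
rewrite !normrM normfV !normr_nat !normrX !normrN normr1 !expr1n !mulr1.
case: odd => /=; rewrite ?mul1r ?mul0r; split=> //; rewrite divr_ge0 ?exprn_ge0 //.
Qed.

(** Differentiation exchanges the two families up to a factor [s] or [-s] and lowers [m] by one. Far
    enough in the sequence the polynomials are within 1 of the cosine and sine, hence at most 2. *)
Lemma taylor_poly_bound s i : exists M, forall m x, (M <= m)%N -> `|x| <= 1 ->
  `|(cos_poly s m)^`(i).[x]| <= 2 * `|s| ^+ i /\ `|(sin_poly s m)^`(i).[x]| <= 2 * `|s| ^+ i.
Proof.
elim: i => [|i [M IHi]].
  have ce : series (exp_coeff `|s|) @ \oo --> expR `|s| by exact: is_cvg_series_exp_coeff.
  have /cvgrPdist_le/(_ 1 ltr01) [M _ hM] := ce.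
  exists M => m x Mm x1.
  have tail : expR `|s| - series (exp_coeff `|s|) m <= 1.
    exact: le_trans (ler_norm _) (hM m Mm).
  have sx : `|s * x| <= `|s| by rewrite normrM ler_piMr.
  rewrite mulr1 !derivn0 cos_poly_horner sin_poly_horner.
  have hc := series_exp_tail m sx (@is_cvg_series_cos_coeff R (s * x)) (fun n => (trig_coeff_le (s * x) n).1).
  have hs := series_exp_tail m sx (@is_cvg_series_sin_coeff R (s * x)) (fun n => (trig_coeff_le (s * x) n).2).
  have ec : limn (series (cos_coeff (s * x))) = cos (s * x) by rewrite unlock.
  have es : limn (series (sin_coeff (s * x))) = sin (s * x) by rewrite unlock.
  rewrite ec in hc; rewrite es in hs.
  have c1 : `|cos (s * x)| <= 1 by rewrite ler_norml cos_geN1 cos_le1.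
  have s1 : `|sin (s * x)| <= 1 by rewrite ler_norml sin_geN1 sin_le1.
  move: hc hs c1 s1; rewrite !ler_norml => /andP[a1 a2] /andP[b1 b2] /andP[c1 c2] /andP[d1 d2].
  split; lra.
exists M.+1 => -[//|m] x Mm x1; rewrite !derivSn deriv_cos_poly deriv_sin_poly.
have [hc hs] := IHi m x Mm x1.
rewrite !derivnZ !hornerZ !normrM normrN exprS.
by split; rewrite mulrCA ler_wpM2l.
Qed.

End TaylorPolynomials.

Section ExponentialOfComplexification.
Variables (R : realType) (A : lcAlgType R).
Local Notation AC := (complexification A).

Lemma cplx_scale_real (a : R) (u : AC) : (a%:C)%C *: u = (a *: u.1, a *: u.2) :> AC.
Proof. by congr pair; rewrite /= scale0r ?subr0 ?addr0. Qed.

Lemma cplx_seminorm_real (p : AC -> R) : cplx_submult_seminorm p -> continuous p ->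
  cont_seminorm (fun x : A => p (x, 0)) /\
  forall x y, p (x, y) <= p (x, 0) + p (y, 0).
Proof.
move=> [pD pZ pM] cp; split; first split.
- split=> [x y|a x]; first by rewrite -[X in (_, X)](addr0 (0 : A)) (pD (x, 0) (y, 0)).
  have -> : (a *: x, 0) = (a%:C)%C *: ((x, 0) : AC) by rewrite cplx_scale_real scaler0.
  by rewrite pZ /ComplexField.Normc.normc /= expr0n addr0 sqrtr_sqr.
- move=> x; apply: (@continuous_comp _ _ _ (fun x : A => (x, 0) : AC) p); last exact: cp.
  by apply: cvg_pair; [exact: cvg_id|exact: cvg_cst].
move=> x y.
have -> : (x, y) = ((x, 0) : AC) + (0, y).
  by congr pair => /=; rewrite ?addr0 ?add0r.
rewrite (le_trans (pD _ _)) // lerD2l.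
have -> : (0, y) = (Complex 0 1) *: ((y, 0) : AC).
  by congr pair; rewrite /= ?scale0r ?scaler0 ?subr0 ?scale1r ?add0r.
by rewrite pZ /ComplexField.Normc.normc /= expr0n expr1n add0r sqrtr1 mul1r.
Qed.

Lemma exp_partial_sum s (b : A) m :
  series (fun n => (n`!%:R : R[i])^-1 *: (Complex 0 s *: cplx_inj b) ^+ n) m =
  (horner_alg b (cos_poly s m), horner_alg b (sin_poly s m)) :> AC.
Proof.
have e n : (n`!%:R : R[i])^-1 *: (Complex 0 s *: cplx_inj b) ^+ n =
    (cos_coeff s n *: b ^+ n, sin_coeff s n *: b ^+ n) :> AC.
  elim: n => [|n IHn].
    have -> : cos_coeff s 0 = 1 by rewrite /cos_coeff /= !mul1r invr1.
    have -> : sin_coeff s 0 = 0 by rewrite /sin_coeff /= !mul0r.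
    by rewrite !expr0 invr1 !scale1r scale0r.
  rewrite exprSr factS natrM invfM -scalerA scalerAl IHn.
  have -> : (n.+1%:R : R[i])^-1 = ((n.+1%:R^-1)%:C)%C by rewrite fmorphV rmorph_nat.
  have n1 : n.+1%:R != 0 :> R by rewrite pnatr_eq0.
  have c : cos_coeff s n.+1 = n.+1%:R^-1 * (- s * sin_coeff s n) by rewrite -cos_coeffS mulrCA mulVf ?mulr1.
  have d : sin_coeff s n.+1 = n.+1%:R^-1 * (s * cos_coeff s n) by rewrite -sin_coeffS mulrCA mulVf ?mulr1.
  rewrite cplx_scale_real; congr pair => /=.
    rewrite !scale0r scaler0 subrr mulr0 sub0r add0r c -scalerAr -scalerAl !scalerA -exprSr.
    by rewrite -scaleNr scalerA mulNr.
  rewrite !scale0r scaler0 subrr mulr0 add0r addr0 d -scalerAr -scalerAl !scalerA -exprSr.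
  by congr (_ *: _); ring.
have hX n : horner_alg b 'X^n = b ^+ n by rewrite rmorphXn /= horner_algX.
rewrite /series /= big_mkord /cos_poly /sin_poly !rmorph_sum /=.
under eq_bigr => n _ do rewrite e.
under [X in (X, _)]eq_bigr => n _ do rewrite horner_algZ hX.
under [X in (_, X)]eq_bigr => n _ do rewrite horner_algZ hX.
elim: m => [|m IHm]; first by rewrite !big_ord0.
by rewrite !big_ord_recr /= IHm.
Qed.

End ExponentialOfComplexification.

Theorem cinf_polynomial_growth (R : realType) (g : lieAlg R) (A : cinf g) :
  triangular g -> polynomial_growth A.
Proof.
move=> tri b p hp cp; have [cp1 p2] := cplx_seminorm_real hp cp.
have [q [cq mq pq]] := submult_dominates tri cp1.
have [Q cQ [r [C C0 hC]]] := calculus_estimate tri cq mq.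
have q0 := seminorm_ge0 cq.1; have Q0 := seminorm_ge0 cQ.1.
pose rho := Q b + 1; have rho1 : 1 <= rho by rewrite lerDr.
have rho0 : 0 < rho by exact: lt_le_trans rho1.
pose a : A := rho^-1 *: b.
have Qa : Q a < 1.
  by rewrite (seminormZ cQ.1) gtr0_norm ?invr_gt0 // mulrC ltr_pdivrMr // mul1r ltrDl.
(* Cosine and sine contribute [2 C] each, and [rho ^+ r] comes from replacing [s b] by [(rho s) a]
   with [Q a < 1]. The last 1 makes the constant positive. *)
exists (4 * C * q 1 * rho ^+ r + 1), r%:R; split=> [||s].
- by rewrite ltr_wpDl // !mulr_ge0 // exprn_ge0 // ltW.
- by [].
set K := _ + 1.
have K0 : 0 <= K * (1 + `|s|) `^ r%:R.
  by rewrite mulr_ge0 ?powR_ge0 // addr_ge0 // !mulr_ge0 // exprn_ge0 // ltW.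
have -> : Complex 0 s *: cplx_inj b = Complex 0 (rho * s) *: cplx_inj a :> complexification A.
  congr pair; rewrite /= ?scaler0 ?scale0r ?subrr ?add0r //.
  by rewrite /a scalerA mulrAC mulfV ?mul1r // gt_eqF.
(* If the exponential series has no sum, [xget] returns 0 and the estimate is trivial. *)
rewrite /alg_exp; case: xgetP => [w _ hw|_]; last first.
  by rewrite (seminorm0 cp1.1).
have [M hM] := choice (taylor_poly_bound (rho * s)).
(* One threshold for all orders of differentiation up to [r]. *)
pose N := (\max_(i < r.+1) M i)%N.
pose D := 2 * (rho * (1 + `|s|)) ^+ r * q 1.
have rs1 : 1 <= rho * (1 + `|s|) by rewrite mulr_ege1 // lerDl.
have srs : `|rho * s| <= rho * (1 + `|s|).
  by rewrite normrM gtr0_norm // ler_wpM2l ?lerDr // ltW.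
have poly_bd (P : {poly R}) : (forall i x, (i <= r)%N -> `|x| <= 1 ->
    `|P^`(i).[x]| <= 2 * `|rho * s| ^+ i) -> q (horner_alg a P) <= C * D.
  move=> hP; apply: (hC a (map_poly (in_alg A) P)) => // i x ir x1.
  rewrite derivn_map horner_lift (seminormZ cq.1) /D ler_wpM2r //.
  rewrite (le_trans (hP i x ir x1)) // ler_wpM2l //.
  apply: (@le_trans _ _ ((rho * (1 + `|s|)) ^+ i)); last by rewrite ler_weXn2l.
  by rewrite lerXn2r ?nnegrE // (le_trans ler01).
have bd m : (N <= m)%N -> p (horner_alg a (cos_poly (rho * s) m),
    horner_alg a (sin_poly (rho * s) m)) <= K * (1 + `|s|) `^ r%:R.
  move=> Nm; apply: le_trans (p2 _ _) _.
  have hMm i x : (i <= r)%N -> `|x| <= 1 -> _ := fun ir x1 => hM i m x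
    (leq_trans (leq_bigmax (Ordinal (ir : (i < r.+1)%N))) Nm) x1.
  have h1 := le_trans (pq _) (poly_bd _ (fun i x ir x1 => (hMm i x ir x1).1)).
  have h2 := le_trans (pq _) (poly_bd _ (fun i x ir x1 => (hMm i x ir x1).2)).
  apply: le_trans (lerD h1 h2) _; rewrite powR_mulrn ?addr_ge0 // /D /K exprMn.
  set S := (1 + _) ^+ r; set T := rho ^+ r.
  have S0 : 0 <= S by rewrite exprn_ge0 // addr_ge0.
  have -> : C * (2 * (T * S) * q 1) + C * (2 * (T * S) * q 1) = 4 * C * q 1 * T * S by ring.
  by rewrite ler_wpM2r // lerDl.
have cw := cvg_comp _ _ hw (cp w).
rewrite -(cvg_lim _ cw) //; apply: limr_le; first by apply/cvg_ex; eexists; exact: cw.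
by exists N => // m Nm /=; rewrite exp_partial_sum; exact: bd.
Qed.
(** * Polynomials in several noncommuting elements *)

Section FormalDerivative.
Variables (R : realType) (k : nat).
Local Notation V := 'rV[R]_k.
Local Notation terms := (seq (R * {ffun 'I_k -> nat})).

Definition pfun (r : terms) : V -> R^o := fun x => \sum_(t <- r) t.1 * monomial_fun R t.2 x.

Definition lower (j : 'I_k) (al : {ffun 'I_k -> nat}) :=
  [ffun i => if i == j then (al i).-1 else al i].

Definition formal_deriv j (r : terms) : terms := [seq (t.1 * (t.2 j)%:R, lower j t.2) | t : R * {ffun 'I_k -> nat} <- r].

Lemma polyfun_pfun r : polyfun (pfun r).
Proof.
apply: polyfun_sum => t.
exact: (polyfun_mul (polyfun_cst _ _) (monomial_polyfun _ _)).
Qed.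

Lemma partial_coord (i j : 'I_k) :
  partial j (fun x : V => x 0 i : R^o) = cst (i == j)%:R.
Proof.
apply/funext => x; apply: cvg_lim => //; apply: cvg_near_cst.
near=> h; rewrite /= !mxE addrK eqxx /= -mulr_natl.
have h0 : h != 0 by near: h; exact: nbhs_dnbhs_neq.
by rewrite !mulr1 [LHS]mulrA mulVf ?mul1r.
Unshelve. all: by end_near. Qed.

Lemma partial_coordX (i j : 'I_k) n :
  partial j (fun x : V => x 0 i ^+ n : R^o) = fun x => (x 0 i ^+ n.-1 *+ n) * (i == j)%:R.
Proof.
have := partial_horner 'X^n j (polyfun_coord R i).
rewrite (_ : (fun x : V => _) = fun x : V => x 0 i ^+ n : R^o); last first.
  by apply/funext => x; rewrite hornerXn.
move=> ->; rewrite partial_coord; apply/funext => x /=.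
by rewrite derivXn hornerMn hornerXn.
Qed.

Lemma partial_monomial j al : partial j (monomial_fun R al) =
  fun x => (al j)%:R * monomial_fun R (lower j al) x.
Proof.
have pX i n : polyfun (fun x : V => x 0 i ^+ n : R^o).
  rewrite (_ : (fun x => _) = fun x : V => ('X^n).[x 0 i] : R^o).
    exact: polyfun_horner (polyfun_coord R i).
  by apply/funext => x; rewrite hornerXn.
have pP (s : seq 'I_k) P : polyfun (fun x : V => \prod_(i <- s | P i) x 0 i ^+ al i : R^o).
  elim: s => [|i s IHs].
    rewrite (_ : (fun x => _) = cst 1); first exact: polyfun_cst.
    by apply/funext => x; rewrite big_nil.
  have := polyfun_mul (pX i (al i)) IHs.
  have [Pi|Pi] := boolP (P i); last first.
    by move=> _; rewrite (_ : (fun x => _) = fun x : V => \prod_(i <- s | P i) x 0 i ^+ al i : R^o) //;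
      apply/funext => x; rewrite big_cons (negPf Pi).
  by congr polyfun; apply/funext => x; rewrite big_cons Pi.
have d0 (s : seq 'I_k) :
    partial j (fun x : V => \prod_(i <- s | i != j) x 0 i ^+ al i : R^o) = cst 0.
  elim: s => [|i s IHs].
    rewrite (_ : (fun x => _) = cst 1); first exact: partial_cst.
    by apply/funext => x; rewrite big_nil.
  have [ij|ij] := eqVneq i j.
    rewrite -[RHS]IHs; congr partial; apply/funext => x.
    by rewrite big_cons ij eqxx.
  rewrite (_ : (fun x => _) = (fun x : V => x 0 i ^+ al i : R^o) \*
    (fun x : V => \prod_(i <- s | i != j) x 0 i ^+ al i : R^o)); last first.
    by apply/funext => x; rewrite big_cons ij.
  rewrite partialM // IHs partial_coordX (negPf ij); apply/funext => x /=.
  by rewrite !mulr0 addr0.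
rewrite (_ : (monomial_fun R al : V -> R^o) = (fun x : V => x 0 j ^+ al j : R^o) \*
    (fun x : V => \prod_(i <- index_enum 'I_k | i != j) x 0 i ^+ al i : R^o)); last first.
  by apply/funext => x; rewrite /= (bigD1 j).
rewrite partialM // d0 partial_coordX eqxx; apply/funext => x /=.
rewrite mulr0 add0r mulr1 [in RHS](bigD1 j) //= ffunE eqxx mulrC -mulr_natl -mulrA.
congr (_ * (_ * _)); apply: eq_bigr => i ij; by rewrite ffunE (negPf ij).
Qed.

Lemma partial_pfun j r : partial j (pfun r) = pfun (formal_deriv j r).
Proof.
elim: r => [|t r IHr].
  have e : pfun [::] = cst 0 by apply/funext => x; rewrite /pfun big_nil.
  by rewrite e partial_cst -e.
have e t' r' : pfun (t' :: r') = (cst t'.1 \* monomial_fun R t'.2) \+ pfun r'.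
  by apply/funext => x; rewrite /pfun big_cons.
have pm : polyfun (monomial_fun R t.2) by exact: monomial_polyfun.
rewrite /= !e partialD; [|apply: polyfun_mul => //; exact: polyfun_cst|exact: polyfun_pfun].
rewrite IHr partialM //; last exact: polyfun_cst.
rewrite partial_cst partial_monomial; apply/funext => x /=.
by rewrite mulr0 addr0 mulrA.
Qed.

Lemma jet_le_formal_deriv i n c j r M : jet_le (n + i) c (pfun r) M ->
  jet_le n c (pfun (iter i (formal_deriv j) r)) M.
Proof.
elim: i n => [|i IHi] n; first by rewrite addn0.
rewrite addnS -addSn => /IHi; rewrite jet_leS => -[_ /(_ j)].
by rewrite partial_pfun.
Qed.

End FormalDerivative.

Section ScalePoly.
Variables (R : realType) (B : algType R).
Implicit Types p : {poly B}.

Definition scale_poly (rho : R) p : {poly B} := \poly_(i < size p) (rho ^+ i *: p`_i).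

Lemma coef_scale_poly rho p i : (scale_poly rho p)`_i = rho ^+ i *: p`_i.
Proof. by rewrite coef_poly; case: ltnP => // h; rewrite nth_default ?scaler0. Qed.

Lemma scale_poly_horner rho p a : (scale_poly rho p).[a] = p.[rho *: a].
Proof.
rewrite horner_poly horner_coef; apply: eq_bigr => i _.
by rewrite exprZn -scalerAl -scalerAr.
Qed.

Lemma derivn_scale_poly rho p i : (scale_poly rho p)^`(i) =
  (rho ^+ i)%:A *: scale_poly rho p^`(i).
Proof.
elim: i => [|i IHi]; first by rewrite expr0 !scale1r.
rewrite !derivnS IHi; apply/polyP => m.
rewrite coef_deriv !coefZ !coef_scale_poly coef_deriv !mulr_algl -!scalerMnr !scalerA.
by rewrite -!exprD addnS.
Qed.

End ScalePoly.

Section Evaluation.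
Variables (R : realType) (h : lieAlg R) (B : cinf h) (k : nat) (b : 'I_k -> B) (q : B -> R).
Hypotheses (tri : triangular h) (cq : cont_seminorm q) (mq : submultiplicative q).
Local Notation V := 'rV[R]_k.
Local Notation terms := (seq (R * {ffun 'I_k -> nat})).

Lemma calculus_estimate_at (a : B) : exists r rho, exists2 C, 0 <= C &
  forall (p : {poly B}) S, (forall i x, (i <= r)%N -> `|x| <= rho -> q (p^`(i)).[x%:A] <= S) ->
    q p.[a] <= C * S.
Proof.
have [Q cQ [r [C C0 hC]]] := calculus_estimate tri cq mq.
have q0 := seminorm_ge0 cq.1; have Q0 := seminorm_ge0 cQ.1.
pose rho := Q a + 1; have rho1 : 1 <= rho by rewrite lerDr.
have rho0 : 0 < rho by exact: lt_le_trans rho1.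
exists r, rho, (C * rho ^+ r); first by rewrite mulr_ge0 // exprn_ge0 // ltW.
move=> p S hS.
have S0 : 0 <= S by apply: le_trans (hS 0%N 0 _ _); rewrite ?normr0 // ltW.
have -> : p.[a] = (scale_poly rho p).[rho^-1 *: a].
  by rewrite scale_poly_horner scalerA divff ?scale1r // gt_eqF.
rewrite -mulrA; apply: hC => [|i x ir x1].
  by rewrite (seminormZ cQ.1) gtr0_norm ?invr_gt0 // mulrC ltr_pdivrMr // mul1r ltrDl.
rewrite derivn_scale_poly hornerZ scale_poly_horner scalerA mulr_algl (seminormZ cq.1).
have r0 n : 0 <= rho ^+ n by rewrite exprn_ge0 // ltW.
rewrite ger0_norm //; apply: ler_pM => //; first by rewrite ler_weXn2l.
by apply: hS => //; rewrite normrM gtr0_norm // ler_piMr // ltW.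
Qed.

(** The variables in [s] are already replaced by the noncommuting [b i], multiplied in the order of
    [s]; the others still have real values. *)
Definition hybrid (s : seq 'I_k) (r : terms) (x : V) : B :=
  \sum_(t <- r) (t.1 * \prod_(i | i \notin s) x 0 i ^+ t.2 i) *: \prod_(i <- s) b i ^+ t.2 i.

Let hybrid_poly (s : seq 'I_k) (j : 'I_k) (r : terms) (x : V) : {poly B} := \sum_(t <- r)
  ((t.1 * \prod_(i | i \notin rcons s j) x 0 i ^+ t.2 i) *: \prod_(i <- s) b i ^+ t.2 i)%:P *
  'X^(t.2 j).

Let upd (j : 'I_k) (y : R) (x : V) : V := \row_i (if i == j then y else x 0 i).

Let hybrid_poly_b s j r x : (hybrid_poly s j r x).[b j] = hybrid (rcons s j) r x.
Proof.
rewrite /hybrid_poly horner_sum; apply: eq_bigr => t _.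
by rewrite hornerCM hornerXn -scalerAl -cats1 big_cat big_seq1.
Qed.

Let hybrid_poly_scalar s j r x y : j \notin s ->
  (hybrid_poly s j r x).[y%:A] = hybrid s r (upd j y x).
Proof.
move=> js; rewrite /hybrid_poly horner_sum; apply: eq_bigr => t _.
rewrite hornerCM hornerXn exprZn expr1n mulr_algr scalerA; congr (_ *: _).
rewrite [in RHS](bigD1 j) //= mxE eqxx mulrCA; congr (_ * (_ * _)).
apply: eq_big => [i|i]; first by rewrite mem_rcons inE negb_or andbC.
by rewrite mem_rcons inE negb_or mxE => /andP[/negPf ->].
Qed.

Let deriv_hybrid_poly s j r x : j \notin s ->
  (hybrid_poly s j r x)^`() = hybrid_poly s j (formal_deriv j r) x.
Proof.
move=> js; rewrite /hybrid_poly raddf_sum /= big_map; apply: eq_bigr => t _ /=.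
rewrite derivM derivC mul0r add0r derivXn ffunE eqxx mulrnAr -mulrnAl -polyCMn.
congr (_%:P * _); rewrite -scaler_nat scalerA; congr (_ *: _).
  rewrite mulrCA mulrA; congr (_ * _); apply: eq_bigr => i.
  by rewrite mem_rcons inE negb_or ffunE => /andP[/negPf ->].
rewrite !big_seq; apply: eq_bigr => i i_s.
by rewrite ffunE; case: eqP => // ij; rewrite -ij i_s in js.
Qed.

(** The variable [j] to be replaced comes last, so it is the variable of a polynomial with
    coefficients in [B] on its left. The one-variable estimate returns it to real values at the cost
    of [r0] more derivatives. *)
Lemma hybrid_bound s : uniq s -> forall c : R, exists n, exists2 C, 0 <= C &
  forall r M, jet_le n n%:R (pfun r) M -> forall x, cube c x -> q (hybrid s r x) <= C * M.
Proof.
elim/last_ind: s => [_ c|s j IHs].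
  exists (Num.bound `|c|), (q 1); first exact: seminorm_ge0 cq.1 _.
  move=> r M hM x xc.
  have -> : hybrid [::] r x = (pfun r x)%:A.
    by rewrite /hybrid /pfun scaler_suml; apply: eq_bigr => t _; rewrite big_nil.
  rewrite (seminormZ cq.1) mulrC; apply: ler_wpM2l; first exact: seminorm_ge0 cq.1 _.
  apply: (hM [::]) => // i; rewrite (le_trans (xc i)) // (le_trans (ler_norm _)) // ltW //.
  exact: archi_boundP.
rewrite rcons_uniq => /andP[js us] c.
have [r0 [rho [C0 C00 hC0]]] := calculus_estimate_at (b j).
(* The estimate at [b j] uses real values up to [rho], so the cube has to contain them. *)
have [n [C C00' hC]] := IHs us (Num.max c rho).
exists (n + r0)%N, (C0 * C); first exact: mulr_ge0.
move=> r M hM x xc; rewrite -hybrid_poly_b -mulrA; apply: hC0 => i y ir yrho.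
have -> : (hybrid_poly s j r x)^`(i) = hybrid_poly s j (iter i (formal_deriv j) r) x.
  by elim: i {ir} => [//|i IHi]; rewrite derivnS IHi deriv_hybrid_poly.
rewrite hybrid_poly_scalar //; apply: hC.
  apply: jet_le_formal_deriv; apply: jet_le_mono hM => //; first by rewrite leq_add2l.
  by rewrite ler_nat leq_addr.
move=> i'; rewrite mxE; case: ifP => _; first by rewrite le_max yrho orbT.
by rewrite le_max xc.
Qed.

Lemma evaluation_bound : exists n, exists2 C, 0 <= C &
  forall r M, jet_le n n%:R (pfun r) M ->
    q (\sum_(t <- r) t.1 *: \prod_(i < k) b i ^+ t.2 i) <= C * M.
Proof.
have [n [C C0 hC]] := hybrid_bound (index_enum_uniq 'I_k) 0.
exists n, C => // r M hM; have := hC r M hM 0 _.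
rewrite /hybrid; under eq_bigr => t _.
  rewrite big_pred0 ?mulr1; last by move=> i; rewrite mem_index_enum.
  over.
by apply => i; rewrite mxE normr0.
Qed.

End Evaluation.

(** * Extension by continuity and functoriality *)

Section Separation.
Variables (R : realType) (E : tvsType R).
Hypothesis hE : hausdorff_space E.

Lemma seminorm_separated (z : E) : (forall q, cont_seminorm q -> q z = 0) -> z = 0.
Proof.
move=> hz; apply/esym/hE => P Q P0 Qz; exists z; split; last exact: nbhs_singleton.
have /nbhs_seminormP[q cq qP] := P0; apply: qP => /=.
by rewrite subr0 hz.
Qed.

Lemma dense_eq (T : tvsType R) (D : set T) (phi psi : T -> E) : dense D -> continuous phi ->
  continuous psi -> (forall x, D x -> phi x = psi x) -> forall x, phi x = psi x.
Proof.
move=> dD cphi cpsi e x; apply/eqP; rewrite -subr_eq0; apply/eqP.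
apply: seminorm_separated => q cq; apply/eqP; rewrite eq_le (seminorm_ge0 cq.1) andbT.
have cB : continuous (fun x => q (phi x - psi x)).
  move=> y; apply: (@continuous_comp _ _ _ (fun y => phi y - psi y) q); last exact: cq.2.
  apply: (@cvg_comp2 _ _ _ _ _ (nbhs (phi y)) (nbhs (psi y)) _ _ _ _ phi psi (fun a b => a - b)).
  - exact: cphi.
  - exact: cpsi.
  - exact: (@sub_continuous E (phi y, psi y)).
apply: (dense_le (G := cst 0) dD cB) => [|y Dy]; first exact: cst_continuous.
by rewrite e // subrr (seminorm0 cq.1).
Qed.

End Separation.

Section ExtensionByContinuity.
Variables (R : realType) (U : lmodType R) (E F : tvsType R) (i : U -> E) (T : U -> F).
Hypotheses (iL : linear i) (TL : linear T) (i_dense : dense (range i)).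
Hypotheses (hF : hausdorff_space F) (cF : lc_complete F).
Hypothesis T_bounded : forall q, cont_seminorm q ->
  exists2 p, cont_seminorm p & forall u, q (T u) <= p (i u).

Let approx p (x : E) e : cont_seminorm p -> 0 < e -> exists u, p (i u - x) < e.
Proof.
move=> cp e0; have px := cont_seminorm_nbhs x cp e0.
have [||y [/interior_subset py [u _ uy]]] := i_dense (O := ([set y | p (y - x) < e])^°).
- by exists x.
- exact: open_interior.
by exists u; rewrite uy.
Qed.

Let germ (x : E) : set_system F := [set S | exists2 p, cont_seminorm p &
  forall u, p (i u - x) < 1 -> S (T u)].

Let germ_proper x : ProperFilter (germ x).
Proof.
split=> [[p cp hp]|].
  by have [u /hp] := approx x cp ltr01.
split=> [|P Q [p cp hp] [p' cp' hp']|P Q PQ [p cp hp]].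
- have [p cp _] := @exists_cont_seminorm R E setT filterT.
  by exists p.
- exists (fun x => p x + p' x); first exact: cont_seminormD.
  have p0 := seminorm_ge0 cp.1; have p'0 := seminorm_ge0 cp'.1.
  move=> u hu; split; [apply: hp|apply: hp']; apply: le_lt_trans hu.
    by rewrite lerDl.
  by rewrite lerDr.
- by exists p => // u /hp; exact: PQ.
Qed.

(** The filter [germ x] of values [T u] with [i u] near [x] is Cauchy. Its limit is recorded only
    through this inequality, from which linearity, continuity and the extension property all
    follow. *)
Let limit x : exists y, forall q p, cont_seminorm q -> cont_seminorm p ->
  (forall u, q (T u) <= p (i u)) -> forall u, q (y - T u) <= p (x - i u).
Proof.
have [|y hy] := cF (germ_proper x).
  move=> W /nbhs_seminormP[q cq qW].
  have [p cp qp] := T_bounded cq.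
  have c2 : cont_seminorm (fun x => 2 * p x) by exact: cont_seminormZ.
  pose S := [set w | exists2 u, p (i u - x) < 2^-1 & w = T u].
  have gS : germ x S.
    exists (fun x => 2 * p x) => // u hu; exists u => //.
    by rewrite -[ltRHS]mulr1 ltr_pdivlMl.
  exists (S, S) => // -[_ _] [/= [u hu ->] [v hv ->]]; apply: qW => /=.
  rewrite subr0 -(linear_funB TL) (le_lt_trans (qp _)) // (linear_funB iL).
  have -> : i u - i v = (i u - x) - (i v - x) by rewrite opprB addrA subrK.
  rewrite (le_lt_trans (seminormB cp.1 _ _)) //.
  by rewrite [ltRHS](splitr 1) ltrD // mul1r.
exists y => q p cq cp qp u; apply/ler_addgt0Pr => e e0.
have e2 : 0 < e / 2 by rewrite divr_gt0.
have [p' cp' hp'] := hy _ (cont_seminorm_nbhs y cq e2).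
have [|v hv] := @approx (fun z => p' z + (e / 2)^-1 * p z) x 1 _ ltr01.
  by apply: cont_seminormD => //; apply: cont_seminormZ => //; rewrite invr_ge0 ltW.
have p'0 := seminorm_ge0 cp'.1 (i v - x); have p0 := seminorm_ge0 cp.1 (i v - x).
have h1 : q (T v - y) < e / 2.
  apply: hp'; apply: le_lt_trans hv; rewrite lerDl mulr_ge0 // invr_ge0 ltW //.
have h2 : p (i v - x) < e / 2.
  rewrite -[ltRHS]mulr1 -ltr_pdivrMl //; apply: le_lt_trans hv; rewrite lerDr //.
have -> : y - T u = (T v - T u) - (T v - y) by rewrite opprB [RHS]addrC addrA subrK.
rewrite (le_trans (seminormB cq.1 _ _)) // -(linear_funB TL).
have h3 := qp (v - u); rewrite (linear_funB iL) in h3.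
have h4 : p (i v - i u) <= p (i v - x) + p (x - i u).
  by rewrite -(subrKA x) (le_trans (seminormD cp.1 _ _)).
lra.
Qed.

Lemma extension_by_continuity : exists phi : E -> F,
  [/\ linear phi, continuous phi & forall u, phi (i u) = T u].
Proof.
have [phi hphi] := choice limit.
have phiL : linear phi.
  move=> a x y; apply/eqP; rewrite -subr_eq0; apply/eqP.
  apply: (seminorm_separated hF) => q cq; have [p cp qp] := T_bounded cq.
  apply/eqP; rewrite eq_le (seminorm_ge0 cq.1) andbT; apply/ler_addgt0Pr => e e0; rewrite add0r.
  pose d := e / (2 * (`|a| + 1)).
  have a1 : 0 < `|a| + 1 by rewrite ltr_wpDl.
  have d0 : 0 < d by rewrite divr_gt0 // mulr_gt0.
  have [u hu] := approx x cp d0; have [v hv] := approx y cp d0.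
  rewrite seminorm_distC in hu; last exact: cp.1.
  rewrite seminorm_distC in hv; last exact: cp.1.
  have h1 := hphi x q p cq cp qp u; have h2 := hphi y q p cq cp qp v.
  have h3 := hphi (a *: x + y) q p cq cp qp (a *: u + v).
  have h4 : p (a *: x + y - i (a *: u + v)) <= `|a| * p (x - i u) + p (y - i v).
    rewrite iL opprD addrACA -scalerBr (le_trans (seminormD cp.1 _ _)) //.
    by rewrite (seminormZ cp.1).
  have h5 : q (phi (a *: x + y) - (a *: phi x + phi y)) <= q (phi (a *: x + y) - T (a *: u + v))
      + (`|a| * q (phi x - T u) + q (phi y - T v)).
    have -> : phi (a *: x + y) - (a *: phi x + phi y) = (phi (a *: x + y) - T (a *: u + v)) -
        (a *: (phi x - T u) + (phi y - T v)).
      by rewrite TL scalerBr [a *: phi x - _ + _]addrACA -opprD opprB addrA subrK.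
    rewrite (le_trans (seminormB cq.1 _ _)) // lerD2l (le_trans (seminormD cq.1 _ _)) //.
    by rewrite (seminormZ cq.1).
  have h6 : `|a| * p (x - i u) <= `|a| * d by rewrite ler_wpM2l // ltW.
  have h7 : `|a| * q (phi x - T u) <= `|a| * d by rewrite ler_wpM2l // (le_trans h1) // ltW.
  have h8 : e = 2 * (`|a| * d + d) by rewrite /d; field; rewrite gt_eqF.
  by rewrite h8; lra.
have bd q p x : cont_seminorm q -> cont_seminorm p -> (forall u, q (T u) <= p (i u)) ->
    q (phi x) <= p x.
  move=> cq cp qp; have := hphi x q p cq cp qp 0.
  by rewrite (linear_fun0 TL) (linear_fun0 iL) !subr0.
exists phi; split=> // [x W /nbhs_seminormP[q cq qW]|u].
  have [p cp qp] := T_bounded cq.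
  apply: filterS (cont_seminorm_nbhs x cp ltr01) => y /= py; apply: qW => /=.
  by rewrite -(linear_funB phiL) (le_lt_trans (bd q p _ cq cp qp)).
apply/eqP; rewrite -subr_eq0; apply/eqP; apply: (seminorm_separated hF) => q cq.
have [p cp qp] := T_bounded cq; apply/eqP; rewrite eq_le (seminorm_ge0 cq.1) andbT.
by rewrite (le_trans (hphi _ q p cq cp qp u)) // subrr (seminorm0 cp.1).
Qed.

End ExtensionByContinuity.

(** * Continuity of the induced map *)

Section Functoriality.
Variables (R : realType) (g h : lieAlg R) (A : cinf g) (B : cinf h) (f : g -> h).
Variable F : cinf_env A -> cinf_env B.
Hypotheses (tri : triangular h) (f_hom : lie_hom f) (F_map : env_map_of f F).
Local Notation U := (cinf_env A).
Local Notation incA := (@cinf_inc R g A).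
Local Notation incB := (@cinf_inc R h B).
Local Notation G := (fun u => incB (F u)).

Let GL : linear G.
Proof. by move=> a u v; rewrite F_map.1.1 (@incL R h B). Qed.

Let G1 : G 1 = 1.
Proof. by rewrite /= F_map.1.2.1 inc1. Qed.

Let GM u v : G (u * v) = G u * G v.
Proof. by rewrite /= F_map.1.2.2 incM. Qed.

Let GX u n : G (u ^+ n) = G u ^+ n.
Proof. by elim: n => [|n IHn]; rewrite ?expr0 ?G1 // !exprS GM IHn. Qed.

Let G_prod I (r : seq I) (x : I -> U) : G (\prod_(i <- r) x i) = \prod_(i <- r) G (x i).
Proof. exact: (big_morph G GM G1). Qed.

Let b i : B := incB (env_inj (cinf_env B) (f (tnth (cinf_e A) i))).
Let nu i : B := incB (env_inj (cinf_env B) (f (tnth (cinf_n A) i))).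

Lemma lie_hom_derived v : v \in derived_alg g -> f v \in derived_alg h.
Proof.
rewrite /derived_alg /lie_brv; apply: (mem_span_lin f_hom.1) => _ /allpairsP[[x y] [_ _ ->]] /=.
by rewrite f_hom.2; exact: mem_derived.
Qed.

Let nu_nilpotent q : cont_seminorm q -> exists N, forall i n, (N < n)%N -> q (nu i ^+ n) = 0.
Proof.
move=> cq; have [N hN] := aug_vanish tri cq; exists N => i n Nn.
have := hN (nseq n (env_inj (cinf_env B) (f (tnth (cinf_n A) i)))) 1.
rewrite size_nseq (ltnW Nn) mulr1 => /(_ isT).
have -> z : \prod_(x <- nseq n z) x = z ^+ n :> cinf_env B.
  by elim: n {Nn} => [|n IHn] /=; rewrite ?big_nil ?big_cons ?exprS ?IHn.
have -> z : incB (z ^+ n) = incB z ^+ n.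
  by elim: n {Nn} => [|n IHn]; rewrite ?expr0 ?inc1 // !exprS incM IHn.
apply => z; rewrite mem_nseq => /andP[_ /eqP ->] x.
by rewrite chi_derived // lie_hom_derived // cinf_n_mem.
Qed.

(** In the expansion of [u] the monomials from [[g, g]] with a large exponent have images killed by
    [q'], so boundedly many terms remain. In each, the coefficient is evaluated at the [b i], and
    [evaluation_bound] controls this by the jets that [pn n] measures. *)
Lemma env_map_bound q : cont_seminorm q -> exists2 p, cont_seminorm p &
  forall u, q (incB (F u)) <= p (incA u).
Proof.
move=> /(submult_dominates tri)[q' [cq mq qq']].
have q0 := seminorm_ge0 cq.1.
have [n0 [C C0 hC]] := evaluation_bound b tri cq mq.
have [N hN] := nu_nilpotent cq.
pose n := maxn N n0.
pose K := #|{: {ffun 'I_(cinf_l A) -> 'I_n.+1}}|.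
pose nus (be : {ffun 'I_(cinf_l A) -> nat}) := \prod_(i < cinf_l A) nu i ^+ be i.
pose un (c : {ffun 'I_(cinf_l A) -> 'I_n.+1}) : {ffun 'I_(cinf_l A) -> nat} :=
  [ffun i => c i : nat].
pose D := \sum_c q' (nus (un c)).
have D0 : 0 <= D by apply: sumr_ge0 => c _; exact: q0.
have nusD be : index_le n be -> q' (nus be) <= D.
  move=> hbe; have -> : be = un [ffun i => inord (be i)].
    by apply/ffunP => i; rewrite !ffunE inordK // ltnS.
  by rewrite /D (bigD1 [ffun i => inord (be i)]) //= lerDl; apply: sumr_ge0 => c _; exact: q0.
have nus0 be : ~ index_le n be -> q' (nus be) = 0.
  move=> /existsNP[i /negP]; rewrite -ltnNge => hi.
  have zi : q' (nu i ^+ be i) = 0 by apply: hN; apply: leq_ltn_trans hi; exact: leq_maxl.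
  rewrite /nus; have : i \in index_enum 'I_(cinf_l A) by rewrite mem_index_enum.
  elim: (index_enum _) => [//|i' s IHs]; rewrite inE big_cons => his.
  apply/eqP; rewrite eq_le q0 andbT (le_trans (mq _ _)) //.
  by case/predU1P: his => [<-|/IHs ->]; rewrite ?zi ?mul0r ?mulr0.
have KCD : 0 <= K%:R * (C * D) by rewrite !mulr_ge0.
exists (fun a => K%:R * (C * D) * pn n a); first exact: cont_seminormZ KCD (pn_cont A n).
move=> u; apply: le_trans (qq' _) _; have [r ->] := cinf_pbw_span u.
pose rb be := [seq p.1 | p <- r & p.2 == be].
pose ev (s : seq (R * {ffun 'I_(cinf_k A) -> nat})) :=
  \sum_(t <- s) t.1 *: \prod_(i < cinf_k A) b i ^+ t.2 i.
have -> : incB (F (pbw U (cinf_e A) (cinf_n A) r)) =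
    \sum_(be <- undup (map snd r)) ev (rb be) * nus be.
  rewrite /pbw (linear_fun_sum GL).
  under [RHS]eq_bigr => be _.
    rewrite /ev /rb big_map big_filter big_mkcond /= big_distrl /=.
    over.
  rewrite exchange_big /= !big_seq; apply: eq_bigr => p pr.
  rewrite (bigD1_seq p.2) ?mem_undup ?map_f ?undup_uniq //= eqxx [X in _ + X]big1 ?addr0; last first.
    by move=> be; rewrite eq_sym => /negPf ->; rewrite mul0r.
  rewrite (linear_funZ GL) -scalerAl; congr (_ *: _).
  rewrite /mono GM !G_prod; congr (_ * _); apply: eq_bigr => i _.
    by rewrite GX /= F_map.2.
  by rewrite GX /= F_map.2.
have P0 := seminorm_ge0 (pn_cont A n).1 (incA (pbw U (cinf_e A) (cinf_n A) r)).
rewrite (le_trans (seminorm_sum cq.1 _ _ _)) // -mulrA.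
apply: sum_index_le => [||be nb|be hb]; rewrite ?undup_uniq ?mulr_ge0 //.
  by apply/eqP; rewrite eq_le q0 andbT (le_trans (mq _ _)) // nus0 // mulr0.
rewrite mulrAC (le_trans (mq _ _)) // ler_pM // ?nusD //; apply: hC.
have -> : pfun (rb be) = coef r be.
  apply/funext => x; rewrite /pfun /rb big_map big_filter /coef.
  have := jet_sum r (fun p => p.2 == be) (fun p => p.1.1 *: monomial_fun R p.1.2) [::] x.
  rewrite /= => ->; apply: eq_bigr => p _.
  exact/esym/(jetZ p.1.1 (monomial_fun R p.1.2) [::] x).
apply: jet_le_mono (jet_le_coef r hb) => //; first exact: leq_maxr.
by rewrite ler_nat leq_maxr.
Qed.

Lemma exists_cinf_map : exists2 phi : A -> B, cont_alg_hom phi &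
  forall u, phi (incA u) = incB (F u).
Proof.
have [hB cB _ _ _] := cinf_tensP B.
have [phi [phiL phiC phiE]] := extension_by_continuity (@incL R g A) GL
  (@cinf_inc_dense R g A) hB cB env_map_bound.
exists phi => //; split=> //; split=> //; split; first by rewrite -(@inc1 R g A) phiE.
have cl (a : A) : continuous (fun x : A => x * a).
  apply: (@cinf_continuousM R g A _ id (cst a)) => [x|]; [exact: cvg_id|exact: cst_continuous].
have cr (a : A) : continuous (fun x : A => a * x).
  apply: (@cinf_continuousM R g A _ (cst a) id) => [|x]; [exact: cst_continuous|exact: cvg_id].
(* Multiplicativity is extended by density in the left factor, then in the right one. *)
have h1 x v : phi (x * incA v) = phi x * phi (incA v).
  apply: (dense_eq hB (@cinf_inc_dense R g A) (phi := fun x => phi (x * incA v))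
    (psi := fun x => phi x * phi (incA v))).
  - by move=> y; apply: (@continuous_comp _ _ _ (fun x => x * incA v) phi); [exact: cl|exact: phiC].
  - by apply: (@cinf_continuousM R h B _ phi (cst _)) => //; exact: cst_continuous.
  - by move=> _ [u _ <-]; rewrite -incM !phiE; exact: GM.
move=> x y.
apply: (dense_eq hB (@cinf_inc_dense R g A) (phi := fun y => phi (x * y))
  (psi := fun y => phi x * phi y)).
- by move=> z; apply: (@continuous_comp _ _ _ (fun y => x * y) phi); [exact: cr|exact: phiC].
- by apply: (@cinf_continuousM R h B _ (cst _) phi) => //; exact: cst_continuous.
- by move=> _ [u _ <-]; exact: h1.
Qed.

End Functoriality.

Section InducedHomomorphism.
Variable R : realType.

Lemma exists_env_map (g h : lieAlg R) (f : g -> h) (U : envelope g) (V : envelope h) :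
  lie_hom f -> exists2 F : U -> V, env_map_of f F & forall F', env_map_of f F' -> F' = F.
Proof.
move=> [fL fB]; have [jL jB] := env_lie V.
have [|F [hF uF]] := @env_univ R g U V (fun x => env_inj V (f x)).
  by split=> [a x y|x y]; rewrite ?fL ?jL ?fB ?jB.
by exists F => // F' hF'; rewrite (uF F').
Qed.

(** This also yields the functor laws: both sides of each are continuous and extend the same Lie
    homomorphism. *)
Lemma cinf_extends_unique (g h : lieAlg R) (f : g -> h) (A : cinf g) (B : cinf h)
    (phi psi : A -> B) : lie_hom f -> continuous phi -> continuous psi ->
  cinf_extends f A B phi -> cinf_extends f A B psi -> phi = psi.
Proof.
move=> hf cphi cpsi [F hF phiE] [F' hF' psiE]; have [hB _ _ _ _] := cinf_tensP B.
have [F0 _ uF0] := exists_env_map (cinf_env A) (cinf_env B) hf.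
apply/funext; apply: (dense_eq hB (@cinf_inc_dense R g A)) => // _ [u _ <-].
by rewrite phiE psiE (uF0 F) // (uF0 F').
Qed.

Lemma exists_cinf_hom (g h : lieAlg R) (f : g -> h) (A : cinf g) (B : cinf h) :
  triangular h -> lie_hom f ->
  exists phi : A -> B, cont_alg_hom phi /\ cinf_extends f A B phi.
Proof.
move=> tri hf; have [F hF _] := exists_env_map (cinf_env A) (cinf_env B) hf.
have [phi cphi phiE] := exists_cinf_map tri hf hF.
by exists phi; split=> //; exists F.
Qed.

Lemma cinf_extends_id (g : lieAlg R) (A : cinf g) : cinf_extends (fun x => x) A A (fun x => x).
Proof. by exists (fun u => u). Qed.

Lemma cinf_extends_comp (g h l : lieAlg R) (f : h -> l) (f' : g -> h) (A : cinf g) (B : cinf h)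
    (C : cinf l) (phi : B -> C) (psi : A -> B) :
  cinf_extends f B C phi -> cinf_extends f' A B psi ->
  cinf_extends (fun x => f (f' x)) A C (fun x => phi (psi x)).
Proof.
move=> [F [[FL [F1 FM]] Fj] phiE] [F' [[F'L [F'1 F'M]] F'j] psiE].
exists (fun u => F (F' u)); last by move=> u; rewrite psiE phiE.
split; last by move=> x; rewrite F'j Fj.
split; last split=> [|x y].
- by move=> a x y; rewrite F'L FL.
- by rewrite F'1 F1.
- by rewrite F'M FM.
Qed.

Lemma cinf_is_fam_pg (g : lieAlg R) (A : cinf g) : triangular g -> is_fam_pg A.
Proof.
move=> tri; split; last exact: cinf_polynomial_growth.
by split; [exact: cinf_arens_michael|exact: cinf_frechet].
Qed.

End InducedHomomorphism.

Theorem corollary4p5 (R : realType) :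
  (forall (g h : tri_lie R) (f : cat_hom g h)
          (A : cinf (sval g)) (B : cinf (sval h)),
     exists! phi : A -> B, cont_alg_hom phi /\ cinf_extends (sval f) A B phi)
  /\
  (forall C : (forall g : tri_lie R, cinf (sval g)),
     exists (HC : forall g : tri_lie R, is_fam_pg (C g))
            (F : functor_on (cinf_ob HC)),
       forall (g h : tri_lie R) (f : cat_hom g h),
         cinf_extends (sval f) (C g) (C h) (sval (functor_map F f))).
Proof.
split=> [g h f A B|C].
  have [phi [cphi ephi]] := exists_cinf_hom A B (svalP h) (svalP f).
  exists phi; split=> // psi [cpsi epsi].
  exact: cinf_extends_unique (svalP f) cphi.2 cpsi.2 ephi epsi.
have HC (g : tri_lie R) : is_fam_pg (C g) := cinf_is_fam_pg (C g) (svalP g).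
exists HC.
pose map (g h : tri_lie R) (f : cat_hom g h) :
    {phi : C g -> C h | cont_alg_hom phi /\ cinf_extends (sval f) (C g) (C h) phi} :=
  cid (exists_cinf_hom (C g) (C h) (svalP h) (svalP f)).
pose fmap (g h : tri_lie R) (f : cat_hom g h) : cat_hom (cinf_ob HC g) (cinf_ob HC h) :=
  exist _ (sval (map g h f)) (svalP (map g h f)).1.
have fmapE g h f : cinf_extends (sval f) (C g) (C h) (sval (fmap g h f)).
  exact: (svalP (map g h f)).2.
have fmapC g h f : continuous (sval (fmap g h f)) := (svalP (fmap g h f)).2.
have map_id g : fmap g g (cat_id g) = cat_id (cinf_ob HC g).
  apply: sval_inj; apply: cinf_extends_unique (svalP (cat_id g)) (fmapC _ _ _) _ (fmapE _ _ _) _.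
    by move=> x; exact: cvg_id.
  exact: cinf_extends_id.
have map_comp (x y z : tri_lie R) (f : cat_hom y z) (f' : cat_hom x y) :
    fmap x z (cat_comp f f') = cat_comp (fmap y z f) (fmap x y f').
  apply: sval_inj; apply: cinf_extends_unique (svalP (cat_comp f f')) (fmapC _ _ _) _ (fmapE _ _ _) _.
    by move=> u; apply: (@continuous_comp _ _ _ (sval (fmap x y f'))); exact: fmapC.
  exact: cinf_extends_comp.
by exists (FunctorOn map_id map_comp).
Qed.
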